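(* There exist absolute constants $c>0$ and $\alpha<1$ such that every $n$-vertex graph that is a subgraph of a sparse cluster graph has a vertex set $S$ with $|S|\le c\sqrt n$ whose removal leaves connected components each having at most $\alpha n$ vertices. In particular, this holds for the graph of every $4$-treetope.
   Context: A \emph{clustering} $(C,G)$ is a graph $G$ with a nested family $C$ of nonempty vertex subsets (for $X,Y\in C$: $X\subseteq Y$, $Y\subseteq X$ or $X\cap Y=\emptyset$), containing no complementary pair, with $V(G)$ added to $C$. Its \emph{cluster graph} contains $G$ plus a vertex $c_X$ for each $X\in C$; each $v\in V(G)$ is joined to $c_X$ for the smallest cluster $X\ni v$, and each $c_X$ ($X\neq V(G)$) is joined to $c_Y$ for the smallest $Y\supsetneq X$ in $C$. A \emph{clustered planar drawing} of $(C,G)$ is a crossing-free drawing of the planar graph $G$ in the plane together with pairwise non-crossing simple closed curves, one for each cluster $X\neq V(G)$, whose interior contains exactly the vertices of $X$, such that each edge crosses each curve at most once and only when exactly one endpoint of the edge lies in the corresponding cluster. A \emph{sparse clustering} is a clustering with a clustered planar drawing such that for any two disjoint vertex sets $X,Y$, each a cluster, the complement of a cluster, or a single vertex, with $X\cup Y\ne V(G)$, at most one edge of $G$ has one endpoint in $X$ and the other in $Y$. A \emph{sparse cluster graph} is the cluster graph of a sparse clustering. A treetope is a polytope $P$ with a distinguished facet $B$ such that every face of $P$ meeting $B$ in at most one point has dimension at most one; a $4$-treetope has dimension 4, and its graph is its 1-skeleton. *)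

(* Defs.v *)
From Stdlib Require Import Reals.
From mathcomp Require Import all_boot.
Delimit Scope R_scope with Re.

Set Implicit Arguments.
Unset Strict Implicit.
Unset Printing Implicit Defensive.

Definition simple_graph (T : finType) (E : rel T) : Prop :=
  symmetric E /\ irreflexive E.

Definition del_rel (T : finType) (E : rel T) (S : {set T}) : rel T :=
  [rel x y | [&& E x y, x \notin S & y \notin S]].

Definition component (T : finType) (E : rel T) (S : {set T}) (v : T) : {set T} :=
  [set w | connect (del_rel E S) v w].

Definition has_separator (n : nat) (E : rel 'I_n) (c alpha : R) : Prop :=
  exists S : {set 'I_n},
    (INR #|S| <= c * sqrt (INR n))%Re /\
    forall v, v \notin S -> (INR #|component E S v| <= alpha * INR n)%Re.

Definition laminar (m : nat) (C : {set {set 'I_m}}) : Prop :=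
  forall X Y, X \in C -> Y \in C ->
    [|| X \subset Y, Y \subset X | [disjoint X & Y]].

Definition clustering (m : nat) (E0 : rel 'I_m) (C : {set {set 'I_m}}) : Prop :=
  simple_graph E0 /\
  setT \in C /\
  (forall X, X \in C -> X != setT -> X != set0) /\
  laminar C /\
  (forall X, X \in C -> X != setT -> ~: X \notin C).

Definition min_cluster (m : nat) (C : {set {set 'I_m}}) (v : 'I_m) (X : {set 'I_m}) : bool :=
  [&& X \in C, v \in X & [forall Y in C, (v \in Y) ==> (X \subset Y)]].

Definition parent_cluster (m : nat) (C : {set {set 'I_m}}) (X Y : {set 'I_m}) : bool :=
  [&& X \in C, Y \in C, X \proper Y & [forall Z in C, (X \proper Z) ==> (Y \subset Z)]].

(* Nodes of the cluster graph: vertices of G (inl v) and cluster nodes c_X (inr X),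
   the latter only for X \in C (see cnode_valid). *)
Definition cnode (m : nat) : finType := ('I_m + {set 'I_m})%type.

Definition cnode_valid (m : nat) (C : {set {set 'I_m}}) (a : cnode m) : bool :=
  match a with inl _ => true | inr X => X \in C end.

Definition cluster_graph_edge (m : nat) (E0 : rel 'I_m) (C : {set {set 'I_m}})
  (a b : cnode m) : bool :=
  match a, b with
  | inl u, inl v => E0 u v
  | inl v, inr X => min_cluster C v X
  | inr X, inl v => min_cluster C v X
  | inr X, inr Y => parent_cluster C X Y || parent_cluster C Y X
  end.

Definition pt : Type := (R * R)%type.

Definition pdist (p q : pt) : R :=
  Rmax (Rabs (fst p - fst q)) (Rabs (snd p - snd q)).

Definition continuous01 (g : R -> pt) : Prop :=
  forall t, (0 <= t <= 1)%Re -> forall eps, (0 < eps)%Re ->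
    exists delta, (0 < delta)%Re /\
      forall s, (0 <= s <= 1)%Re -> (Rabs (s - t) < delta)%Re -> (pdist (g s) (g t) < eps)%Re.

Definition simple_arc (g : R -> pt) (p q : pt) : Prop :=
  continuous01 g /\ g 0%Re = p /\ g 1%Re = q /\
  forall s t, (0 <= s <= 1)%Re -> (0 <= t <= 1)%Re -> g s = g t -> s = t.

Definition simple_closed_curve (g : R -> pt) : Prop :=
  continuous01 g /\ g 0%Re = g 1%Re /\
  forall s t, (0 <= s < 1)%Re -> (0 <= t < 1)%Re -> g s = g t -> s = t.

Definition on_curve (g : R -> pt) (p : pt) : Prop :=
  exists t, (0 <= t <= 1)%Re /\ g t = p.

Definition path_avoiding (J : pt -> Prop) (p q : pt) : Prop :=
  exists h, continuous01 h /\ h 0%Re = p /\ h 1%Re = q /\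
    forall t, (0 <= t <= 1)%Re -> ~ J (h t).

Definition interior (g : R -> pt) (p : pt) : Prop :=
  ~ on_curve g p /\
  exists M, forall q, path_avoiding (on_curve g) p q -> (pdist q (0%Re, 0%Re) <= M)%Re.

(* Clustered planar drawing.  Edge {u,v} with u < v is drawn as arc u v;
   cluster X <> V(G) is drawn as the closed curve cur X. *)
Definition clustered_planar_drawing (m : nat) (E0 : rel 'I_m) (C : {set {set 'I_m}}) : Prop :=
  exists (pos : 'I_m -> pt) (arc : 'I_m -> 'I_m -> R -> pt) (cur : {set 'I_m} -> R -> pt),
    injective pos /\
    (forall u v : 'I_m, (u < v)%N -> E0 u v ->
       simple_arc (arc u v) (pos u) (pos v) /\
       forall t w, (0 < t < 1)%Re -> arc u v t <> pos w) /\
    (forall u v u' v' : 'I_m, (u < v)%N -> (u' < v')%N -> E0 u v -> E0 u' v' ->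
       (u, v) <> (u', v') ->
       forall s t, (0 < s < 1)%Re -> (0 < t < 1)%Re -> arc u v s <> arc u' v' t) /\
    (forall X, X \in C -> X != setT ->
       simple_closed_curve (cur X) /\
       (forall w, ~ on_curve (cur X) (pos w)) /\
       (forall w, interior (cur X) (pos w) <-> w \in X)) /\
    (forall X Y, X \in C -> Y \in C -> X != setT -> Y != setT -> X != Y ->
       forall p, on_curve (cur X) p -> ~ on_curve (cur Y) p) /\
    (forall (u v : 'I_m) X, (u < v)%N -> E0 u v -> X \in C -> X != setT ->
       (forall s t, (0 <= s <= 1)%Re -> (0 <= t <= 1)%Re ->
          on_curve (cur X) (arc u v s) -> on_curve (cur X) (arc u v t) -> s = t) /\
       ((exists t, (0 <= t <= 1)%Re /\ on_curve (cur X) (arc u v t)) ->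
          (u \in X) != (v \in X))).

Definition special_set (m : nat) (C : {set {set 'I_m}}) (X : {set 'I_m}) : bool :=
  [|| X \in C, ~: X \in C | #|X| == 1%N].

Definition sparse_condition (m : nat) (E0 : rel 'I_m) (C : {set {set 'I_m}}) : Prop :=
  forall X Y, special_set C X -> special_set C Y -> [disjoint X & Y] ->
    X :|: Y != setT ->
    (#|[set e : 'I_m * 'I_m | [&& (e.1 < e.2)%N, E0 e.1 e.2 &
          ((e.1 \in X) && (e.2 \in Y)) || ((e.1 \in Y) && (e.2 \in X))]]| <= 1)%N.

Definition sparse_clustering (m : nat) (E0 : rel 'I_m) (C : {set {set 'I_m}}) : Prop :=
  clustering E0 C /\ clustered_planar_drawing E0 C /\ sparse_condition E0 C.

Definition subgraph_of_sparse_cluster_graph (n : nat) (E : rel 'I_n) : Prop :=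
  exists (m : nat) (E0 : rel 'I_m) (C : {set {set 'I_m}}),
    sparse_clustering E0 C /\
    exists f : 'I_n -> cnode m,
      injective f /\ (forall i, cnode_valid C (f i)) /\
      (forall i j, E i j -> cluster_graph_edge E0 C (f i) (f j)).

Definition pt4 : Type := (R * R * R * R)%type.

Definition vzero : pt4 := (0%Re, 0%Re, 0%Re, 0%Re).
Definition vadd (x y : pt4) : pt4 :=
  let '(x1, x2, x3, x4) := x in let '(y1, y2, y3, y4) := y in
  (x1 + y1, x2 + y2, x3 + y3, x4 + y4)%Re.
Definition vscale (a : R) (x : pt4) : pt4 :=
  let '(x1, x2, x3, x4) := x in (a * x1, a * x2, a * x3, a * x4)%Re.
Definition dot (x y : pt4) : R :=
  let '(x1, x2, x3, x4) := x in let '(y1, y2, y3, y4) := y in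
  (x1 * y1 + x2 * y2 + x3 * y3 + x4 * y4)%Re.

Fixpoint sumR (k : nat) (f : nat -> R) : R :=
  match k with O => 0%Re | S k' => (sumR k' f + f k')%Re end.
Fixpoint vsum (k : nat) (f : nat -> pt4) : pt4 :=
  match k with O => vzero | S k' => vadd (vsum k' f) (f k') end.

Definition conv (pts : seq pt4) (x : pt4) : Prop :=
  exists lam : nat -> R,
    (forall i, (i < size pts)%N -> (0 <= lam i)%Re) /\
    sumR (size pts) lam = 1%Re /\
    x = vsum (size pts) (fun i => vscale (lam i) (nth vzero pts i)).

Definition affindep (k : nat) (p : nat -> pt4) : Prop :=
  forall lam : nat -> R,
    sumR k.+1 lam = 0%Re ->
    vsum k.+1 (fun i => vscale (lam i) (p i)) = vzero ->
    forall i, (i <= k)%N -> lam i = 0%Re.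

Definition dim_ge (S : pt4 -> Prop) (k : nat) : Prop :=
  exists p : nat -> pt4, (forall i, (i <= k)%N -> S (p i)) /\ affindep k p.
Definition dim_le (S : pt4 -> Prop) (k : nat) : Prop := ~ dim_ge S k.+1.
Definition dim_eq (S : pt4 -> Prop) (k : nat) : Prop := dim_ge S k /\ dim_le S k.

(* faces of a convex set P: intersections with supporting hyperplanes
   (including P itself and the empty face) *)
Definition is_face (P F : pt4 -> Prop) : Prop :=
  exists (a : pt4) (b : R),
    (forall x, P x -> (dot a x <= b)%Re) /\
    (forall x, F x <-> (P x /\ dot a x = b)).

Definition treetope4 (pts : seq pt4) (B : pt4 -> Prop) : Prop :=
  dim_eq (conv pts) 4 /\
  is_face (conv pts) B /\ dim_eq B 3 /\
  forall F, is_face (conv pts) F ->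
    (forall x y, F x -> B x -> F y -> B y -> x = y) -> dim_le F 1.

Definition segment (u v : pt4) (x : pt4) : Prop :=
  exists t, (0 <= t <= 1)%Re /\ x = vadd (vscale (1 - t) u) (vscale t v).

Definition is_polytope_graph (pts : seq pt4) (n : nat) (E : rel 'I_n) : Prop :=
  exists f : 'I_n -> pt4,
    injective f /\
    (forall i, is_face (conv pts) (fun x => x = f i)) /\
    (forall v, is_face (conv pts) (fun x => x = v) -> exists i, f i = v) /\
    (forall i j, E i j <-> (i != j /\ is_face (conv pts) (segment (f i) (f j)))).

Definition is_4treetope_graph (n : nat) (E : rel 'I_n) : Prop :=
  exists (pts : seq pt4) (B : pt4 -> Prop), treetope4 pts B /\ is_polytope_graph pts E.

(* Main.v *)
From Stdlib Require Import Reals Lra Classical ClassicalEpsilon FunctionalExtensionality Btauto.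
From Coquelicot Require Compactness.
From mathcomp Require Import all_boot zify.
Require Import Defs.

(** Both halves rest on one planar picture: a forest whose leaves are points of the plane
    joined by arcs, and whose other nodes are closed curves, the arc uv meeting exactly the
    curves of the nodes above u but not v, or above v but not u.  Sparsity leaves at most
    one crossing with the curve of t for each child of t, so the number of crossings is at
    most the number of nodes.  The leaves and crossings form a graph carried by the
    drawing; a parity count on five points shows that it has no K5 minor, so the theorem of
    Alon, Seymour and Thomas separates it with O(sqrt n) vertices.  Each node t owns the
    region formed by its own crossings and those of its children, which the curves make
    connected after K5-free bridges have been added; the regions of adjacent nodes meet and
    every crossing lies in two regions, so the separator carries over to the cluster graph.

    For a treetope with base B, a vertex t is visible from a linear functional w on the
    base when some tilt of w away from the base is maximised at t only.  A face with three
    vertices has two vertices in B; hence tilting further from t always reaches the same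
    vertex [next t], and [next] makes the vertices a forest whose leaves lie in B.  The sets
    of w from which t is visible are convex cones, nested along the forest.  Stereographic
    projection of the sphere of functionals turns the boundaries of slightly shrunken cones
    into the closed curves, and the edges of B into arcs that join functionals maximised at
    their ends through one exposing the edge.  The at most two highest vertices and the one
    seen from the pole of the projection are put into the separator. *)

Set Implicit Arguments.
Unset Strict Implicit.
Unset Printing Implicit Defensive.

(** * Separators of graphs without a K5 minor *)

(** Planarity is used only as the absence of a K5 minor. This property survives the addition of a
    bridge by a combinatorial argument, whereas redrawing with the bridge would call for faces of
    the drawing. The one topological fact about K5 is that ten paths joining five points in pairs
    cannot avoid each other whenever they have no end in common. The obstacle in both halves is that
    a node of high degree is not small in the drawing: it has to be spread over a region, and
    regions must be connected for a component of the cluster graph to stay within one component of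
    the separated drawing.

    The constants: a forest with n nodes yields at most 2n leaves and crossings, so the separator
    theorem, which asks for [5 * #|V| <= q * q], is applied with [10 * n <= q * q] and deletes at
    most [5 * q] vertices. Each of these lies in at most four areas and each area stands for at most
    two vertices of the graph, whence [40 * q]; at most three vertices are removed beforehand. The
    fraction [/ 2] arises because the search goes on as long as some component carries more than
    half of the weight. *)

Section Graphs.
Variable V : finType.
Implicit Types (e : rel V) (U W : {set V}).

Definition restr e U : rel V := [rel x y | [&& x \in U, y \in U & e x y]].
(** The empty set counts as connected, which is why [K5minor] asks separately for nonempty branch
    sets. *)
Definition cset e U := forall x y, x \in U -> y \in U -> connect (restr e U) x y.
Definition touch e U W := exists x y, [/\ x \in U, y \in W & e x y].
Definition K5minor e := exists B : 'I_5 -> {set V},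
  [/\ forall i, B i != set0, forall i, cset e (B i),
      forall i j, i != j -> [disjoint B i & B j]
    & forall i j, i != j -> touch e (B i) (B j)].

Lemma restr_sym e U : symmetric e -> symmetric (restr e U).
Proof. by move=> se x y; rewrite /restr /= (se x y) andbCA. Qed.

Lemma connect_mono e e' x y : subrel e e' -> connect e x y -> connect e' x y.
Proof. by move=> s; apply: connect_sub => a b /s; apply: connect1. Qed.

Lemma restr_sub e e' U W : subrel e e' -> U \subset W -> subrel (restr e U) (restr e' W).
Proof. by move=> se /subsetP sU x y /and3P[/sU ? /sU ? /se ?]; apply/and3P. Qed.

Lemma connect_restr_mono e e' U W x y : subrel e e' -> U \subset W ->
  connect (restr e U) x y -> connect (restr e' W) x y.
Proof. by move=> se sU; apply: connect_mono; apply: restr_sub. Qed.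

Lemma connect_restr_in e U x y : connect (restr e U) x y -> x \in U -> y \in U.
Proof.
case/connectP=> p; elim: p x => [|z p IH] x /=; first by move=> _ -> .
by case/andP=> /and3P[_ zU _] pz yl _; exact: IH pz yl zU.
Qed.

Lemma cset_hub e U h : symmetric e -> (forall x, x \in U -> connect (restr e U) h x) -> cset e U.
Proof.
move=> se H x y xU yU; apply: connect_trans (H _ yU).
by rewrite (sym_connect_sym (restr_sym U se)) H.
Qed.

(** Propagation of an invariant along a path; many connectivity proofs below take for [P]
    reachability inside a smaller set. *)
Lemma connect_inv e (P : V -> Prop) x y : (forall a b, e a b -> P a -> P b) ->
  connect e x y -> P x -> P y.
Proof.
move=> H /connectP[p]; elim: p x => [|z p IH] x /=; first by move=> _ ->.
by case/andP=> /H xz pz yl /xz; apply: IH.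
Qed.

Lemma cset_union e U W x : symmetric e -> cset e U -> cset e W -> x \in U -> x \in W ->
  cset e (U :|: W).
Proof.
move=> se cU cW xU xW; apply: (cset_hub (h := x)) => // y /setUP[] yI.
  by apply: connect_restr_mono (cU _ _ xU yI) => //; apply: subsetUl.
by apply: connect_restr_mono (cW _ _ xW yI) => //; apply: subsetUr.
Qed.

Lemma cset_touch e U W : symmetric e -> cset e U -> cset e W -> touch e U W ->
  cset e (U :|: W).
Proof.
move=> se cU cW [x [y [xU yW exy]]]; apply: (cset_hub (h := x)) => // z /setUP[] zI.
  by apply: connect_restr_mono (cU _ _ xU zI) => //; apply: subsetUl.
apply: (@connect_trans _ _ y).
  by apply: connect1; rewrite /restr /= !inE xU yW exy orbT.
by apply: connect_restr_mono (cW _ _ yW zI) => //; apply: subsetUr.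
Qed.

Lemma card_setU_le U W : #|U :|: W| <= #|U| + #|W|.
Proof. by rewrite cardsU leq_subr. Qed.

Lemma disjoint_setU U W (Z : {set V}) : [disjoint U & Z] -> [disjoint W & Z] -> [disjoint U :|: W & Z].
Proof. by rewrite -!setI_eq0 setIUl => /eqP-> /eqP->; rewrite setU0. Qed.

End Graphs.

(* L is one of the first q breadth-first layers around S0. *)
Lemma short_path_or_thin_layer (U : finType) (g : rel U) (S0 T0 : {set U}) q : 0 < q ->
  (exists x p, [/\ x \in S0, path g x p, last x p \in T0 & size p < q]) \/
  (exists2 L : {set U}, q * #|L| <= #|U| &
     forall x y, x \in S0 -> y \in T0 -> x \notin L -> ~~ connect (restr g (~: L)) x y).
Proof.
case: q => // q _.
pose step (X : {set U}) := X :|: [set y | [exists x in X, g x y]].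
pose B j := iter j step S0.
have Bpath j y : y \in B j -> exists x p, [/\ x \in S0, path g x p, last x p = y & size p <= j].
  elim: j y => [|j IH] y /=; first by move=> yS; exists y, [::].
  case/setUP=> [/IH[x [p [? ? ? s]]]|]; first by exists x, p; split=> //; apply: leq_trans s _.
  rewrite inE => /existsP[z /andP[/IH[x [p [xS gp lp s]]] gzy]].
  by exists x, (rcons p y); rewrite rcons_path last_rcons size_rcons gp lp.
have [/existsP[y /andP[yB yT]]|nT] := boolP [exists y, (y \in B q) && (y \in T0)].
  by left; have [x [p [xS gp lp s]]] := Bpath _ _ yB; exists x, p; split; rewrite ?lp ?ltnS.
right.
(* After the case analysis [q.+1] is the number of layers, numbered 0 to [q]; layer 0 is [S0]
   itself. *)
pose prev j := if j is j'.+1 then B j' else set0.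
pose layer j := B j :\: prev j.
have Bmon j k : j <= k -> B j \subset B k.
  by move/subnK <-; elim: (k - j) => // i IH; apply: subset_trans IH _; apply: subsetUl.
have sumL k : \sum_(j < k.+1) #|layer j| = #|B k|.
  elim: k => [|k IH]; first by rewrite big_ord1 /layer /= setD0.
  rewrite big_ord_recr /= IH /layer /= -(cardsID (B k) (B k.+1)).
  by rewrite (setIidPr (Bmon _ _ (leqnSn k))).
(* The layers are disjoint, so if none were thin their sizes would add up to more than [#|U|]. *)
have [/existsP[j thin]|] := boolP [exists j : 'I_q.+1, q.+1 * #|layer j| <= #|U|]; last first.
  rewrite negb_exists => /forallP thick.
  have : \sum_(j < q.+1) #|U|.+1 <= \sum_(j < q.+1) q.+1 * #|layer j|.
    by apply: leq_sum => j _; rewrite ltnNge.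
  by rewrite -big_distrr /= sumL sum_nat_const card_ord leq_mul2l /= ltnNge max_card.
exists (layer j) => // x y xS yT xL; apply/negP => con.
have: (y \in B j) && (y \notin layer j).
  apply: (connect_inv (P := fun z => (z \in B j) && (z \notin layer j))) con _.
    move=> a b /and3P[_ bL gab] /andP[aB].
    rewrite in_setC in bL; rewrite bL andbT [layer]lock -lock /layer in_setD aB andbT negbK.
    case: (nat_of_ord j) => [|i] /=; rewrite ?inE // => aBi.
    by apply/orP; right; apply/existsP; exists a; rewrite aBi.
  by rewrite xL andbT; apply: (subsetP (Bmon 0 j _)).
case/andP=> yB _; case/negP: nT; apply/existsP; exists y; rewrite yT andbT.
by apply: (subsetP (Bmon j q _)) yB; rewrite -ltnS.
Qed.

(* A search through copies of the graph, one for each number of sets already hit. *)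
Lemma hit_or_separate (V : finType) (e : rel V) (U : {set V}) k (A : nat -> {set V}) q :
  symmetric e -> U != set0 -> 0 < q -> k.+1 * #|V| <= q * q ->
  (exists T : {set V}, [/\ T \subset U, T != set0, cset e T, #|T| <= q &
     forall i, i < k -> exists2 v, v \in T & v \in A i]) \/
  (exists2 Z : {set V}, #|Z| <= q & forall W : {set V}, W \subset U -> [disjoint W & Z] ->
     W != set0 -> cset e W -> exists2 i, i < k & [disjoint W & A i]).
Proof.
move=> se /set0Pn[u0 u0U] q0 kq.
(* Level [i] leads to level [i.+1] only at a vertex of [A i], so a path from level 0 to level [k]
   visits every [A i]. The [k.+1] levels account for the left-hand side of
   [k.+1 * #|V| <= q * q]. *)
pose g : rel (V * 'I_k.+1) := fun a b => [&& a.1 \in U, b.1 \in U &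
  ((a.2 == b.2) && e a.1 b.1) || [&& b.1 == a.1, b.2 == a.2.+1 :> nat & a.1 \in A a.2]].
pose S0 := [set a : V * 'I_k.+1 | (a.1 \in U) && (a.2 == ord0)].
pose T0 := [set a : V * 'I_k.+1 | (a.1 \in U) && (a.2 == ord_max)].
have [[x [p [xS gp lT sp]]]|[L Lq sep]] := short_path_or_thin_layer g S0 T0 q0.
  left; exists [set v in map fst (x :: p)].
  have [xU x0] : x.1 \in U /\ x.2 = ord0 by move: xS; rewrite inE => /andP[? /eqP].
  have lm : (last x p).2 = ord_max by move: lT; rewrite inE => /andP[_ /eqP].
  suff [TU con hit] : [/\ [set v in map fst (x :: p)] \subset U,
      forall v, v \in map fst (x :: p) ->
        connect (restr e [set v in map fst (x :: p)]) x.1 v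
    & forall i, x.2 <= i < (last x p).2 -> exists2 v, v \in map fst (x :: p) & v \in A i].
    split=> //.
    - by apply/set0Pn; exists x.1; rewrite inE /= mem_head.
    - by apply: (cset_hub (h := x.1)) => // v; rewrite inE; apply: con.
    - rewrite cardsE; apply: leq_trans (card_size _) _.
      by rewrite size_map.
    - move=> i ik; have [|v vp vA] := hit i; first by rewrite x0 lm.
      by exists v; rewrite // inE.
  move: xU gp {x0 lm lT xS sp}; elim: p x => [|y p IH] x xU /=.
    move=> _; split.
    - by apply/subsetP=> v; rewrite inE inE => /eqP->.
    - by move=> v; rewrite inE => /eqP->.
    - by move=> i /andP[a b]; have := leq_ltn_trans a b; rewrite ltnn.
  case/andP=> /and3P[_ yU gxy] /(IH y yU)[TU con hit].
  have sub : [set v in map fst (y :: p)] \subset [set v in [:: x.1, y.1 & map fst p]].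
    by apply/subsetP=> v; rewrite !inE => ->; rewrite orbT.
  split.
  - apply/subsetP=> v; rewrite inE inE => /orP[/eqP->//|vp].
    by apply: (subsetP TU); rewrite inE.
  - move=> v; rewrite inE => /orP[/eqP->//|/con/(connect_restr_mono (fun _ _ h => h) sub)].
    apply: connect_trans.
    case/orP: gxy => [/andP[_ exy]|/andP[/eqP-> _]]; last exact: connect0.
    by apply: connect1; rewrite /restr /= !inE !eqxx !orbT.
  - move=> i /andP[xi il].
    have [yi|iy] := leqP y.2 i.
      by have [|v vp vA] := hit i; [rewrite yi|exists v; rewrite // inE vp orbT].
    case/orP: gxy => [/andP[/eqP xy _]|/and3P[_ /eqP y2 xA]].
      by move: iy; rewrite -xy ltnNge xi.
    exists x.1; first exact: mem_head.
    by suff <- : x.2 = i :> nat by []; apply/eqP; rewrite eqn_leq xi -ltnS -y2.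
(* A connected [W] off this projection of [L] that met every [A i] would allow a walk inside [W] to
   climb through all levels without touching [L]. *)
right; exists [set z.1 | z in L].
  apply: leq_trans (leq_imset_card _ _) _.
  rewrite -(leq_pmul2l q0); apply: leq_trans Lq _.
  by rewrite card_prod card_ord mulnC.
move=> W WU WZ /set0Pn[w0 w0W] cW.
have [/existsP[i dis]|] := boolP [exists i : 'I_k, [disjoint W & A i]]; first by exists i.
rewrite negb_exists => /forallP hit; exfalso.
have WL w (i : 'I_k.+1) : w \in W -> (w, i) \notin L.
  move=> wW; apply/negP=> wL; move/pred0P: WZ => /(_ w) /=.
  by rewrite wW => /negbT/negP; apply; apply/imsetP; exists (w, i).
have level w w' i : w \in W -> w' \in W -> connect (restr g (~: L)) (w, i) (w', i).
  move=> wW w'W; apply: (connect_inv (P := fun v => connect (restr g (~: L)) (w, i) (v, i))) (cW w w' wW w'W) _ => //.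
  move=> a b /and3P[aW bW eab] con; apply: connect_trans con _; apply: connect1.
  rewrite /restr /= !in_setC !WL // /g /= eqxx eab.
  by rewrite !(subsetP WU).
have climb i : i < k.+1 -> connect (restr g (~: L)) (w0, ord0) (w0, inord i).
  elim: i => [|i IH] ik; first by rewrite (_ : inord 0 = ord0) //; apply: val_inj; rewrite /= inordK.
  apply: connect_trans (IH (ltnW ik)) _.
  have [v] := pred0Pn (hit (Ordinal (ik : i < k))) => /andP[/= vW vA].
  apply: connect_trans (level w0 v _ w0W vW) _.
  apply: (connect_trans (y := (v, inord i.+1))); last exact: level.
  apply: connect1; rewrite /restr /= !in_setC !WL // /g /= (subsetP WU) //=.
  by rewrite !inordK ?eqxx ?vA ?orbT // ltnW.
have := sep (w0, ord0) (w0, ord_max); rewrite !inE /= (subsetP WU) // !eqxx WL //.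
move/(_ isT isT isT)/negP; apply.
have := climb k (ltnSn k); rewrite (_ : inord k = ord_max) //.
by apply: val_inj; rewrite /= inordK.
Qed.

(** * Growing a clique minor towards the heavy component *)

Section Separator.
Variables (V : finType) (e : rel V) (w : V -> nat) (q : nat).
Hypotheses (se : symmetric e) (noK5 : ~ K5minor e) (qV : 5 * #|V| <= q * q).

Let total := \sum_x w x.
Let wt (U : {set V}) := \sum_(x in U) w x.
(** Two disjoint components cannot both carry more than half of the weight, so [big S] is either
    empty or a single component, the heavy one. *)
Let big (S : {set V}) := [set v | (v \notin S) && (total < 2 * wt (component e S v))].

Lemma del_relE (S : {set V}) : del_rel e S =2 restr e (~: S).
Proof. by move=> x y; rewrite /restr /del_rel /= !in_setC andbC -andbA. Qed.

Lemma mem_component (S : {set V}) u v : (u \in component e S v) = connect (restr e (~: S)) v u.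
Proof. by rewrite inE (eq_connect (del_relE S)). Qed.

Lemma component_eq (S : {set V}) u v : u \in component e S v -> component e S u = component e S v.
Proof.
move=> uv; apply/setP=> x; rewrite !mem_component in uv *.
by rewrite (same_connect (sym_connect_sym (restr_sym _ se)) uv).
Qed.

Lemma wt_disjoint (U U' : {set V}) : [disjoint U & U'] -> wt U + wt U' <= total.
Proof.
move=> dis; rewrite /wt /total [X in X + _]big_mkcond [X in _ + X]big_mkcond -big_split /=.
by apply: leq_sum => x _; case: ifP => [/(disjointFr dis)->|_]; [rewrite addn0|case: ifP].
Qed.

Lemma big_component (S : {set V}) u v : u \in big S -> v \in big S -> v \in component e S u.
Proof.
move=> uB vB; apply/negPn/negP => nc; move: uB vB; rewrite /big !in_set => /andP[_ wu] /andP[_ wv].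
have dis : [disjoint component e S u & component e S v].
  apply/pred0P => x /=; apply/negbTE/negP => /andP[xu xv]; case/negP: nc.
  by rewrite -(component_eq xu) (component_eq xv) mem_component connect0.
have := wt_disjoint dis; move: wu wv; lia.
Qed.

Lemma component_big (S : {set V}) u v : u \in big S -> v \in component e S u -> v \in big S.
Proof.
move=> uB vu; have := uB; rewrite /big !in_set (component_eq vu) => /andP[uS ->]; rewrite andbT.
rewrite mem_component in vu; rewrite -in_setC.
by apply: connect_restr_in vu _; rewrite in_setC.
Qed.

Lemma big_closed (S : {set V}) u v : u \in big S -> e u v -> v \notin S -> v \in big S.
Proof.
move=> uB euv vS; apply: component_big (uB) _; rewrite mem_component; apply: connect1.
by move: uB; rewrite inE /restr /= !in_setC euv vS andbT => /andP[->].
Qed.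

Lemma big_cset (S : {set V}) : cset e (big S).
Proof.
move=> u v uB vB; have := big_component uB vB; rewrite mem_component => con.
apply: (connect_inv (P := fun z => connect (restr e (big S)) u z)) con _ => //.
move=> a b /and3P[_ bS eab] ua; have aB := connect_restr_in ua uB.
apply: connect_trans ua _.
by apply: connect1; rewrite /restr /= aB eab (big_closed aB eab) // -in_setC.
Qed.

Lemma big_mono (S S' : {set V}) : S \subset S' -> big S' \subset big S.
Proof.
move=> SS; apply/subsetP=> v; rewrite !inE => /andP[vS lt].
rewrite (contra (subsetP SS v)) //=; apply: leq_trans lt _.
rewrite leq_mul2l /= /wt [X in X <= _]big_mkcond [X in _ <= X]big_mkcond; apply: leq_sum => x _.
case: ifP => // xc; rewrite ifT //; move: xc; rewrite !mem_component.
by apply: connect_restr_mono; rewrite ?setCS.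
Qed.

Let XX (L : {set {set V} * {set V}}) := \bigcup_(p in L) p.2.
Lemma bigcup_snd_setU1 p (L : {set {set V} * {set V}}) : XX (p |: L) = p.2 :|: XX L.
Proof.
apply/setP=> x; apply/bigcupP/setUP => [[r /setU1P[->|rL] xr]|[xp|/bigcupP[r rL xr]]].
- by left.
- by right; apply/bigcupP; exists r.
- by exists p; rewrite ?setU11.
- by exists r; rewrite // setU1r.
Qed.

(** After the coveys of Alon, Seymour and Thomas: the sets [p.1] are the branch sets of a clique
    minor, and the at most [q] vertices [p.2] of each, deleted together, keep the heavy component
    away from all branch sets. *)
Let covey (L : {set {set V} * {set V}}) :=
  (forall p, p \in L -> [/\ cset e p.1, p.1 != set0, p.2 \subset p.1, #|p.2| <= q &
     [disjoint p.1 & big (XX L)]]) /\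
  (forall p p', p \in L -> p' \in L -> p != p' -> [disjoint p.1 & p'.1] /\ touch e p.1 p'.1).

(** Five members would be the branch sets of a K5 minor. *)
Lemma covey_small L : covey L -> #|L| <= 4.
Proof.
case=> H1 H2; rewrite leqNgt; apply/negP => L5; apply: noK5.
pose f (i : 'I_5) := enum_val (widen_ord L5 i).
have fL i : f i \in L by apply: enum_valP.
have fI i j : i != j -> f i != f j.
  by apply: contra => /eqP/enum_val_inj/(congr1 val) /= /val_inj->.
exists (fun i => (f i).1); split=> [i|i|i j ij|i j ij].
- by have [] := H1 _ (fL i).
- by have [] := H1 _ (fL i).
- by have [] := H2 _ _ (fL i) (fL j) (fI _ _ ij).
- by have [] := H2 _ _ (fL i) (fL j) (fI _ _ ij).
Qed.

Lemma covey_XX L : covey L -> #|XX L| <= #|L| * q.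
Proof.
case=> H1 _; rewrite -sum_nat_const; rewrite /XX.
have H p : p \in L -> #|p.2| <= q by case/H1.
elim/big_rec2: _ => [|p m U pL IH]; first by rewrite cards0.
apply: leq_trans (leq_add (H _ pL) IH).
by rewrite cardsU leq_subr.
Qed.

Hypothesis nosep : forall S : {set V}, #|S| <= 5 * q -> big S != set0.

Lemma q_gt0 : 0 < q.
Proof.
have := nosep (S := set0); rewrite cards0 => /(_ isT) /set0Pn[x _].
have : 0 < #|V| by apply/card_gt0P; exists x.
by move: qV; case: (q) => //; lia.
Qed.

(** A covey can always be improved. Either a small connected part of the heavy component touches all
    members and joins them, or a small set [Z] cuts the heavy component off from some member [p];
    then [p] swallows what lies on its side of [Z], or is dropped if there is nothing to swallow.
    The weight 6 in the measure makes a loss in the heavy component outweigh the possible gain of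
    one member. *)
Lemma covey_false m L : covey L -> #|big (XX L)| * 6 + #|L| < m -> False.
Proof.
elim: m L => // m IH L cL; rewrite ltnS => Lm.
have L4 := covey_small cL; have XL := covey_XX cL; have [H1 H2] := cL.
have q0 := q_gt0.
have XL4 : #|XX L| <= 4 * q by apply: leq_trans XL _; rewrite leq_mul2r L4 orbT.
set b := big (XX L) in Lm H1.
have b0 : b != set0 by apply: nosep; apply: leq_trans XL4 _; rewrite leq_mul2r orbT.
pose p0 : {set V} * {set V} := (set0, set0).
pose C i := (nth p0 (enum L) i).
pose A i := [set v in b | [exists u in (C i).1, e v u]].
have CL i : i < #|L| -> C i \in L.
  by rewrite cardE => /(mem_nth p0); rewrite mem_enum.
have LC p : p \in L -> exists2 i, i < #|L| & C i = p.
  by rewrite -mem_enum => pL; exists (index p (enum L)); rewrite ?/C ?nth_index // cardE index_mem.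
(* At most four members, hence at most five levels in the search: the origin of the factor 5 in
   [qV]. *)
have qL : #|L|.+1 * #|V| <= q * q by apply: leq_trans qV; rewrite leq_mul2r ltnS L4 orbT.
have [[T [Tb T0 cT Tq hit]]|[Z Zq sep]] := hit_or_separate A se b0 q0 qL.
  pose L' := (T, T) |: L.
  have XL' : XX L' = T :|: XX L by apply: bigcup_snd_setU1.
  have bb : big (XX L') \subset b by apply: big_mono; rewrite XL' subsetUr.
  have Tdis p : p \in L -> [disjoint p.1 & T].
    by case/H1=> _ _ _ _; apply: disjointWr.
  have Ttouch p : p \in L -> touch e T p.1.
    case/LC=> i iL <-; have [v vT] := hit i iL; rewrite inE => /andP[_ /existsP[u /andP[uC evu]]].
    by exists v, u.
  apply: (IH L').
    split=> [p /setU1P[->|pL] /=|p p' /setU1P[->|pL] /setU1P[->|p'L]].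
    - split=> //; apply/pred0P => x /=; apply/negbTE/negP; case/andP=> xT.
      by rewrite inE XL' in_setU xT.
    - by have [a1 a2 a3 a4 a5] := H1 _ pL; split=> //; apply: disjointWr a5.
    - by rewrite eqxx.
    - by move=> _; split; [rewrite disjoint_sym; apply: Tdis|apply: Ttouch].
    - move=> _; split; first exact: Tdis.
      have [x [y [xT yp exy]]] := Ttouch _ pL; exists y, x; split=> //.
      by rewrite se.
    - exact: H2.
  have TL : (T, T) \notin L.
    apply/negP=> /Tdis /=; rewrite -setI_eq0 setIid => /eqP TE.
    by rewrite TE eqxx in T0.
  have bs : #|big (XX L')| < #|b|.
    apply: proper_card; apply/properP; split=> //.
    case/set0Pn: T0 => x xT; exists x; first exact: (subsetP Tb).
    by rewrite inE XL' in_setU xT.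
  have -> : #|L'| = #|L|.+1 by rewrite cardsU1 TL.
  by clear - Lm bs L4; lia.
(* At most [4 * q] vertices from the covey and [q] from [Z]: the bound in [nosep]. By the choice of
   [Z] some member [p] has no neighbour in [W]. *)
set W := big (XX L :|: Z).
have Wb : W \subset b by apply: big_mono; apply: subsetUl.
have XZ : #|XX L :|: Z| <= 5 * q.
  by rewrite (mulSnr 4); apply: leq_trans (card_setU_le _ _) (leq_add XL4 Zq).
have [||i iL WA] := sep W Wb _ _ (@big_cset _).
- by apply/pred0P => x /=; apply/negbTE/negP; case/andP; rewrite inE in_setU negb_or => /andP[/andP[_ /negbTE->]].
- exact: nosep.
set p := C i in WA; have pL : p \in L by apply: CL.
have [pc p00 pX pq pdis] := H1 _ pL.
(* [D] is the part of the heavy component outside [W] that is reachable from [p]; it will be added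
   to the branch set of [p]. *)
pose D := [set v in b :\: W | [exists a in A i :\: W, connect (restr e (b :\: W)) a v]].
have Db : D \subset b by apply/subsetP=> v; rewrite !inE => /andP[/andP[_ ->]].
have DA v : v \in A i -> v \notin W -> v \in D.
  move=> vA vW; have vb : v \in b by move: vA; rewrite inE => /andP[].
  by rewrite inE in_setD vW vb /=; apply/existsP; exists v; rewrite in_setD vA vW connect0.
have Dclosed u v : u \in D -> e u v -> v \in b -> v \notin W -> v \in D.
  rewrite inE => /andP[ubW /existsP[a /andP[aA au]]] euv vb vW.
  have vbW : v \in b :\: W by rewrite in_setD vW.
  rewrite inE vbW /=; apply/existsP; exists a; rewrite aA /=.
  apply: connect_trans au _; apply: connect1.
  by rewrite /restr /= ubW vbW euv.
(* The old [p.2] is given up: [Z :&: D] now shields the rest of the heavy component from [p] and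
   [D]. *)
pose X' := (XX L :\: p.1) :|: (Z :&: D).
pose b' := b :\: D.
have Wb' : W \subset b'.
  apply/subsetP=> v vW; rewrite in_setD (subsetP Wb) // andbT.
  by rewrite inE in_setD vW.
have b'X : [disjoint b' & X'].
  apply/pred0P => v /=; apply/negbTE/negP; case/andP; rewrite in_setD => /andP[vD].
  by rewrite in_set in_setU in_setD in_setI (negbTE vD) andbF orbF => /andP[/negbTE-> _]; rewrite andbF.
have b'closed u v : u \in b' -> e u v -> v \notin X' -> v \in b'.
  rewrite in_setD => /andP[uD ub] euv; rewrite in_setU negb_or => /andP[vX vZ].
  have vX0 : v \notin XX L.
    apply/negP => vXX; move: vX; rewrite in_setD vXX andbT negbK => vp.
    have uA : u \in A i by rewrite inE ub; apply/existsP; exists v; rewrite vp.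
    case/negP: uD; apply: DA => //; apply/negP => uW.
    by move/pred0P: WA => /(_ u) /=; rewrite uW uA.
  have vb : v \in b by apply: big_closed ub euv _.
  rewrite in_setD vb andbT; apply/negP => vD.
  have vW : v \notin W by move: vD; rewrite inE in_setD => /andP[/andP[]].
  have [uW|uW] := boolP (u \in W); last first.
    by case/negP: uD; apply: Dclosed vD _ ub uW; rewrite se.
  case/negP: (vW); apply: big_closed uW euv _; rewrite in_setU negb_or vX0.
  by move: vZ; rewrite in_setI vD andbT.
(* Leaving [b'] requires a vertex of [X'], and the new heavy component contains [W], which lies in
   [b']. *)
have bigb' : big X' \subset b'.
  have X'X : X' \subset XX L :|: Z by apply: setUSS; [apply: subsetDl|apply: subsetIl].
  have [v vW] : exists v, v \in W.
    by apply/set0Pn/nosep.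
  have vB : v \in big X' by apply: (subsetP (big_mono X'X)).
  apply/subsetP => u uB; have := big_component vB uB; rewrite mem_component => con.
  apply: (connect_inv (P := fun z => z \in b')) con (subsetP Wb' _ vW) => x y /and3P[_ yX exy] xb'.
  by apply: b'closed xb' exy _; rewrite -in_setC.
have XXp : XX (L :\ p) = XX L :\: p.1.
  apply/setP=> x; rewrite in_setD; apply/bigcupP/andP.
    case=> p' /setD1P[p'p p'L] xp'; split; last by apply/bigcupP; exists p'.
    have [_ _ p'X _ _] := H1 _ p'L; have [dis _] := H2 _ _ p'L pL p'p.
    by rewrite (disjointFr dis) // (subsetP p'X).
  case=> xp /bigcupP[p' p'L xp']; exists p' => //; rewrite in_setD1 p'L andbT.
  by apply: contra xp => /eqP <-; have [_ _ p'X _ _] := H1 _ p'L; apply: (subsetP p'X).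
have Lp : #|L| = #|L :\ p|.+1 by rewrite (cardsD1 p L) pL.
(* With [D] empty the member [p] contributes nothing to [X']; dropping it lowers the measure. *)
have [D0|D0] := eqVneq D set0.
  have XE : XX (L :\ p) = X' by rewrite XXp /X' D0 setI0 setU0.
  have bE : b' = b by rewrite /b' D0 setD0.
  apply: (IH (L :\ p)).
    split=> [p' /setD1P[p'p p'L]|p1 p2 /setD1P[_ ?] /setD1P[_ ?]]; last exact: H2.
    have [a1 a2 a3 a4 a5] := H1 _ p'L; split=> //.
    by apply: disjointWr a5; rewrite XE -bE.
  have := subset_leq_card bigb'; rewrite XE bE; move: Lm; rewrite Lp -/b.
  by move: #|big X'| #|b| #|L :\ p|; clear; lia.
pose p' : {set V} * {set V} := (p.1 :|: D, Z :&: D).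
pose L' := p' |: (L :\ p).
have XE : XX L' = X' by rewrite bigcup_snd_setU1 XXp setUC.
have Ddis p1 : p1 \in L -> [disjoint p1.1 & D].
  by case/H1=> _ _ _ _; apply: disjointWr.
have pt p1 : p1 \in L :\ p -> [disjoint p1.1 & p'.1] /\ touch e p1.1 p'.1.
  case/setD1P=> pp pL1; have [dis [x [y [xp yp exy]]]] := H2 _ _ pL1 pL pp.
  split; last by exists x, y; split=> //=; rewrite in_setU yp.
  by rewrite disjoint_sym disjoint_setU // disjoint_sym ?Ddis.
apply: (IH L').
  split=> [p1 /setU1P[->|p1L]|p1 p2 /setU1P[->|p1L] /setU1P[->|p2L]].
  - have cD v : v \in D -> exists2 u, u \in p.1 & connect (restr e p'.1) u v.
      move=> vD; have := vD; rewrite inE => /andP[vbW /existsP[a /andP[/setDP[aA aW] av]]].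
      have aD := DA _ aA aW.
      have := aA; rewrite inE => /andP[_ /existsP[u /andP[up eau]]].
      exists u => //; apply: (connect_trans (y := a)).
        by apply: connect1; rewrite /restr /= !in_setU up aD orbT se.
      apply: (connect_inv (P := fun z => connect (restr e p'.1) a z)) av _ => // x y.
      case/and3P=> xb yb exy ax.
      have xD : x \in p'.1 by apply: connect_restr_in ax _; rewrite in_setU aD orbT.
      have xD' : x \in D.
        case/setUP: xD => // xp; move: xb; rewrite in_setD (disjointFr pdis) //.
        by rewrite andbF.
      have yD : y \in D by apply: Dclosed xD' exy _ _; move: yb; rewrite in_setD => /andP[].
      by apply: connect_trans ax _; apply: connect1; rewrite /restr /= !in_setU xD' yD exy !orbT.
    case/set0Pn: (p00) => h hp.
    split.
    + apply: (cset_hub (h := h)) => // x /setUP[xp|xD].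
        by apply: connect_restr_mono (pc _ _ hp xp) => //; apply: subsetUl.
      have [u up con] := cD _ xD; apply: connect_trans con.
      by apply: connect_restr_mono (pc _ _ hp up) => //; apply: subsetUl.
    + by apply/set0Pn; exists h; rewrite in_setU hp.
    + by apply: subset_trans (subsetIr _ _) (subsetUr _ _).
    + by apply: leq_trans Zq; apply: subset_leq_card; apply: subsetIl.
    + apply: disjointWr (_ : big (XX L') \subset b') _; first by rewrite XE.
      rewrite disjoint_setU //; last by apply/pred0P => x /=; rewrite in_setD; case: (x \in D); rewrite ?andbF.
      by apply: disjointWr pdis; apply: subsetDl.
  - have [a1 a2 a3 a4 a5] := H1 _ (subsetP (subsetDl _ _) _ p1L); split=> //.
    by apply: disjointWr a5; rewrite XE; apply: subset_trans bigb' (subsetDl _ _).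
  - by rewrite eqxx.
  - move=> _; have [dis [x [y [? ? exy]]]] := pt _ p2L; split; first by rewrite disjoint_sym.
    by exists y, x; split=> //; rewrite se.
  - by move=> _; apply: pt.
  - by case/setD1P: p1L => _ ?; case/setD1P: p2L => _ ?; apply: H2.
have b'b : #|b'| < #|b|.
  apply: proper_card; apply/properP; split; first exact: subsetDl.
  case/set0Pn: D0 => x xD; exists x; first exact: (subsetP Db).
  by rewrite in_setD xD.
have bX := subset_leq_card bigb'.
have cL' : #|L'| <= #|L :\ p|.+1 by have := card_setU_le [set p'] (L :\ p); rewrite cards1.
rewrite XE; move: Lm; rewrite Lp -/b.
move: bX b'b cL'; move: #|big X'| #|b| #|b'| #|L'| #|L :\ p|; clear; lia.
Qed.
End Separator.

(* The separator theorem of Alon, Seymour and Thomas, for graphs without a K5 minor. *)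
Theorem K5_free_separator (V : finType) (e : rel V) (w : V -> nat) q :
  symmetric e -> ~ K5minor e -> 5 * #|V| <= q * q ->
  exists2 S : {set V}, #|S| <= 5 * q &
    forall v, v \notin S -> 2 * \sum_(x in component e S v) w x <= \sum_x w x.
Proof.
move=> se noK5 qV.
have [/existsP[S /andP[Sq /forallP H]]|/existsPn H] := boolP [exists S : {set V}, (#|S| <= 5 * q) &&
  [forall v, (v \notin S) ==> (2 * \sum_(x in component e S v) w x <= \sum_x w x)]].
  by exists S => // v vS; apply: (implyP (H v)).
exfalso; apply: (covey_false se noK5 qV (w := w) (L := set0) _ _ (ltnSn _)).
  move=> S Sq; have := H S; rewrite Sq /= => /forallPn[v]; rewrite negb_imply -ltnNge => /andP[vS lt].
  by apply/set0Pn; exists v; rewrite inE vS.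
by split=> [p|p p']; rewrite in_set0.
Qed.

(** * Transferring a separator to a graph of overlapping regions *)

Lemma connect_avoiding (V : finType) (e : rel V) (S U : {set V}) x y :
  cset e U -> [disjoint U & S] -> x \in U -> y \in U -> y \in component e S x.
Proof.
move=> cU dis xU yU; rewrite mem_component.
by apply: connect_restr_mono (cU _ _ xU yU) => //; rewrite -disjoints_subset.
Qed.

(** The weight of [i] is put on one representative of its region, and [T] collects the vertices
    whose region meets the separator of [e], at most [K] for each separator vertex. A walk in [E]
    that avoids [D] and [T] passes through regions disjoint from [S] and connected in pairs, so all
    their representatives lie in one component, of at most half the weight. *)
Theorem region_separator n (E : rel 'I_n) (V : finType) (e : rel V) (D : {set 'I_n})
    (R : 'I_n -> {set V}) K q :
  symmetric e -> ~ K5minor e -> 5 * #|V| <= q * q ->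
  (forall i, i \notin D -> R i != set0 /\ cset e (R i)) ->
  (forall i j, i \notin D -> j \notin D -> E i j -> cset e (R i :|: R j)) ->
  (forall x, #|[set i | (i \notin D) && (x \in R i)]| <= K) ->
  exists2 S : {set 'I_n}, #|S| <= #|D| + K * (5 * q) &
    forall v, v \notin S -> 2 * #|component E S v| <= n.
Proof.
move=> se noK5 qV HR HE HK.
pose rep i := [pick x in R i].
pose w x := #|[set i | (i \notin D) && (rep i == Some x)]|.
have [S Sq HS] := K5_free_separator w se noK5 qV.
pose T := [set i | (i \notin D) && ~~ [disjoint R i & S]].
have wtot U : \sum_(x in U) w x = #|[set i | (i \notin D) && (if rep i is Some x then x \in U else false)]|.
  rewrite -[RHS]sum1_card.
  rewrite (eq_bigr (fun x => \sum_(i | (i \notin D) && (rep i == Some x)) 1)); last first.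
    by move=> x _; rewrite /w -sum1_card; apply: eq_bigl => i; rewrite inE.
  rewrite (exchange_big_dep (fun i => i \in [set i | (i \notin D) && (if rep i is Some x then x \in U else false)])) /=.
    apply: eq_bigr => i; rewrite inE => /andP[iD]; case: (rep i) => // x xU.
    rewrite (big_pred1 x) // => y /=; rewrite iD /= [Some x == _]eq_sym.
    by apply/andP/eqP => [[_ /eqP[]]|->].
  by move=> x i xU /andP[iD /eqP ri]; rewrite inE iD ri.
exists (D :|: T).
  apply: leq_trans (card_setU_le _ _) _; rewrite leq_add2l.
  apply: (@leq_trans (#|S| * K)); last by rewrite mulnC leq_mul2l Sq orbT.
  rewrite -sum_nat_const.
  have -> : T = \bigcup_(x in S) [set i | (i \notin D) && (x \in R i)].
    apply/setP=> i; apply/idP/bigcupP => [|[x xS]]; rewrite !inE.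
      by case/andP=> iD /pred0Pn[x /andP[/= xR xS]]; exists x; rewrite // inE iD.
    by case/andP=> -> xR; apply/pred0Pn; exists x; rewrite /= xR.
  elim/big_rec2: _ => [|x m U xS IH]; first by rewrite cards0.
  by apply: leq_trans (card_setU_le _ _) (leq_add (HK x) IH).
move=> v vS.
have [vD vT] : v \notin D /\ [disjoint R v & S].
  by move: vS; rewrite in_setU in_set negb_or => /andP[vD]; rewrite vD negbK.
have repP i : i \notin D -> exists2 x, rep i = Some x & x \in R i.
  move=> /HR[/set0Pn[y yR] _]; rewrite /rep; case: pickP => [x xR|/(_ y)]; first by exists x.
  by rewrite yR.
have [x0 rx0 x0R] := repP v vD.
have inc i : i \in component E (D :|: T) v ->
    [/\ i \notin D, [disjoint R i & S] & R i \subset component e S x0].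
  move=> iC; suff : [&& i \notin D, [disjoint R i & S] & R i \subset component e S x0] by case/and3P.
  move: iC; rewrite mem_component => con.
  apply: (connect_inv (P := fun i => [&& i \notin D, [disjoint R i & S] & R i \subset component e S x0])) con _.
    move=> a b /and3P[_ bC Eab] /and3P[aD aS aR].
    have [bD bS] : b \notin D /\ [disjoint R b & S].
      by move: bC; rewrite in_setC in_setU in_set negb_or => /andP[bD]; rewrite bD negbK.
    rewrite bD bS /=; have [/set0Pn[z zR] _] := HR a aD.
    have dis : [disjoint R a :|: R b & S] by apply: disjoint_setU.
    apply/subsetP=> y yR; have := subsetP aR _ zR => /(component_eq se) <-.
    by apply: connect_avoiding (HE _ _ aD bD Eab) dis _ _; rewrite in_setU ?zR ?yR ?orbT.
  rewrite vD vT /=; apply/subsetP=> y yR.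
  by have [_ cR] := HR v vD; apply: connect_avoiding cR vT x0R yR.
have x0S : x0 \notin S by rewrite (disjointFr vT).
have total : \sum_x w x <= n.
  rewrite -[X in _ <= X]card_ord -(eq_bigl _ _ (fun x => in_setT x)) wtot.
  exact: max_card.
apply: leq_trans total; apply: leq_trans (HS _ x0S); rewrite leq_mul2l /= wtot.
apply: subset_leq_card; apply/subsetP=> i /inc[iD _ iR]; rewrite inE iD /=.
by have [x -> xR] := repP i iD; apply: (subsetP iR).
Qed.

(** * K5 minors and bridges *)

Section Bridge.
Variables (V : finType) (e f : rel V).
Hypothesis sf : symmetric f.

Lemma cset_crosses (X B : {set V}) p :
  (forall x y, f x y -> x \in X -> y \notin X -> x = p) ->
  cset f B -> ~~ [disjoint B & X] -> ~~ (B \subset X) -> p \in B.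
Proof.
move=> cross cB /pred0Pn[x /andP[/= xB xX]] /subsetPn[y yB yX].
have := connect_inv (P := fun z => (z \in X) || (p \in B)) _ (cB x y xB yB).
rewrite (negbTE yX) xX; apply=> // z z' /and3P[zB z'B fz] /orP[zX|->]; last by rewrite orbT.
have [//|z'X] := boolP (z' \in X); by rewrite -(cross _ _ fz zX z'X) zB.
Qed.

(** A connected set that meets [X] and also leaves it contains [p], so at most one branch set does
    so. An excursion outside [X] starts and ends at [p], hence cutting it off keeps the traces on
    [X] connected and touching. *)
Lemma K5minor_side (X : {set V}) p :
  (forall x y, f x y -> x \in X -> y \notin X -> x = p) ->
  (forall x y, f x y -> x \in X -> y \in X -> e x y) ->
  forall B : 'I_5 -> {set V}, (forall i, cset f (B i)) ->
  (forall i j, i != j -> [disjoint B i & B j]) ->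
  (forall i j, i != j -> touch f (B i) (B j)) ->
  (forall i, ~~ [disjoint B i & X]) -> K5minor e.
Proof.
move=> cross fe B cB dB tB mB; exists (fun i => B i :&: X); split.
- by move=> i; rewrite setI_eq0.
- move=> i x y /setIP[xB xX] /setIP[yB yX].
  (* While the walk is outside [X] it is recorded as waiting at [p]. *)
  have := connect_inv (P := fun z => if z \in X then connect (restr e (B i :&: X)) x z
    else connect (restr e (B i :&: X)) x p) _ (cB i x y xB yB).
  rewrite yX xX connect0; apply=> // z z' /and3P[zB z'B fz].
  have [zX|zX] := boolP (z \in X); have [z'X|z'X] := boolP (z' \in X) => //.
  + move=> con; apply: connect_trans con _; apply: connect1.
    by rewrite /restr /= !in_setI zB zX z'B z'X fe.
  + by rewrite (cross _ _ fz zX z'X).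
  + by rewrite sf in fz; rewrite (cross _ _ fz z'X zX).
- move=> i j /dB; apply: disjointW; exact: subsetIl.
- have notboth i j : i != j -> p \in B i -> p \in B j -> False.
    by move=> /dB d pi; rewrite (disjointFr d).
  have inp i z : z \in B i -> z \notin X -> p \in B i.
    move=> zB zX; apply: cset_crosses cross (cB i) (mB i) _.
    by apply/subsetPn; exists z.
  move=> i j ij; have [x [y [xB yB fxy]]] := tB i j ij.
  have [xX|xX] := boolP (x \in X); have [yX|yX] := boolP (y \in X).
  + by exists x, y; rewrite !in_setI xB yB xX yX fe.
  + by case: (notboth i j ij); rewrite ?(inp j y) // -(cross _ _ fxy xX yX).
  + by rewrite sf in fxy; case: (notboth i j ij); rewrite ?(inp i x) // -(cross _ _ fxy yX xX).
  + by case: (notboth i j ij); [apply: inp xB xX|apply: inp yB yX].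
Qed.
End Bridge.

Definition add_edge (V : finType) (e : rel V) a b : rel V :=
  fun x y => [|| e x y, (x == a) && (y == b) | (x == b) && (y == a)].

Lemma add_edge_sym (V : finType) (e : rel V) a b : symmetric e -> symmetric (add_edge e a b).
Proof.
move=> se x y; rewrite /add_edge se; congr orb.
by rewrite orbC; congr orb; rewrite andbC.
Qed.

(* The reason is that K5 is 2-connected. *)
Lemma add_bridge_K5_free (V : finType) (e : rel V) a b : symmetric e -> ~~ connect e a b ->
  ~ K5minor e -> ~ K5minor (add_edge e a b).
Proof.
move=> se nab noK5 [B [B0 cB dB tB]]; apply: noK5.
have sf := add_edge_sym a b se.
pose A := [set x | connect e a x].
have aA : a \in A by rewrite inE connect0.
have bA : b \notin A by rewrite inE.
have Ae x y : e x y -> (x \in A) = (y \in A).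
  by move=> exy; rewrite !inE; apply: same_connect_r (sym_connect_sym se) _ _ (connect1 exy) _.
have crossA x y : add_edge e a b x y -> x \in A -> y \notin A -> x = a /\ y = b.
  case/or3P => [/Ae->->//|/andP[/eqP-> /eqP->]//|/andP[/eqP-> _]].
  by rewrite (negbTE bA).
have inA (X : {set V}) : (X = A \/ X = ~: A) -> forall x y, add_edge e a b x y -> x \in X -> y \in X -> e x y.
  case=> -> x y; rewrite ?in_setC => /or3P[//|/andP[/eqP-> /eqP->]|/andP[/eqP-> /eqP->]];
    by rewrite ?aA ?(negbTE bA).
have [/forallP mA|/forallPn[i0]] := boolP [forall i, ~~ [disjoint B i & A]].
  by apply: (K5minor_side sf _ (inA A (or_introl erefl)) cB dB tB mA (p := a)) => x y /crossA H /H{}H /H[].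
rewrite negbK => d0.
have [/forallP mA|/forallPn[i1]] := boolP [forall i, ~~ [disjoint B i & ~: A]].
  apply: (K5minor_side sf _ (inA (~: A) (or_intror erefl)) cB dB tB mA (p := b)) => x y.
  by rewrite sf !in_setC negbK => /crossA H xA yA; case: (H yA xA).
rewrite negbK disjoints_subset setCK => /subsetP d1; exfalso.
have i01 : i1 != i0.
  apply/eqP => E; case/set0Pn: (B0 i1) => x xB.
  by have := d1 x xB; rewrite (disjointFr d0) // -E.
have [x [y [xB yB fxy]]] := tB i1 i0 i01.
have [xa yb] : x = a /\ y = b by apply: crossA => //; [apply: d1|rewrite (disjointFr d0)].
subst x y.
(* A third branch set touches both [B i0] and [B i1] and therefore has to cross the bridge, but the
   two ends of the bridge already belong to [B i1] and [B i0]. *)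
have [k k0 k1] : exists2 k, k != i0 & k != i1.
  have : 0 < #|~: [set i0; i1]| by rewrite cardsCs setCK card_ord cards2; case: (_ != _).
  by case/card_gt0P => k; rewrite !inE negb_or => /andP[]; exists k.
have ak : a \notin B k by rewrite (disjointFl (dB k i1 k1)).
have bk : b \notin B k by rewrite (disjointFl (dB k i0 k0)).
case/negP: ak; apply: (cset_crosses (X := A) (f := add_edge e a b)) (cB k) _ _.
- by move=> x y /crossA H /H{}H /H[].
- have [x [y [xk y1 fx]]] := tB k i1 k1; apply/pred0Pn; exists x; rewrite /= xk /=.
  apply: contraT => xA; rewrite sf in fx; have [_ xb] := crossA _ _ fx (d1 _ y1) xA.
  by rewrite xb (negbTE bk) in xk.
- have [x [y [xk y0 fx]]] := tB k i0 k0; apply/subsetPn; exists x => //.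
  apply/negP => xA; have yA : y \notin A by rewrite (disjointFr d0).
  have [xa _] := crossA _ _ fx xA yA.
  by rewrite xa (disjointFl (dB k i1 k1)) in xk.
Qed.

(** * Two disjoint edges of a continuous drawing of K5 meet *)

Local Open Scope R_scope.

Definition rltb (x y : R) : bool := if Rlt_dec x y then true else false.

Lemma rltbP x y : reflect (x < y) (rltb x y).
Proof. by rewrite /rltb; case: Rlt_dec => h; constructor. Qed.

(** Comparing abscissae with ties broken by ordinates amounts to an infinitesimal shear, so no
    general position has to be arranged. *)
Definition lex (p q : pt) : bool := rltb p.1 q.1 || (~~ rltb q.1 p.1 && rltb p.2 q.2).

Lemma lex_anti p q : p <> q -> lex q p = ~~ lex p q.
Proof.
case: p q => [x y] [x' y'] pq; rewrite /lex /=.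
case: (rltbP x' x); case: (rltbP x x') => //=; try lra.
case: (rltbP y y'); case: (rltbP y' y) => //=; try lra.
by move=> *; case: pq; congr pair; lra.
Qed.

(* Parity with which the vertical ray above r meets the staircase from p to q that runs
   horizontally at the height of p. *)
Definition above (p q r : pt) : bool := xorb (lex p r) (lex q r) && rltb r.2 p.2.
(** The full vertical line through [r] is crossed an odd number of times exactly when [p] and [q]
    compare differently with [r]; removing the upper ray leaves the ray below [r]. *)
Definition below (p q r : pt) : bool := xorb (above p q r) (xorb (lex p r) (lex q r)).

(** Separation by an axis-parallel line, which keeps not only the segments but also the two
    staircases apart. *)
Definition coord_sep (p p' r r' : pt) : Prop :=
  (p.1 < r.1 /\ p.1 < r'.1 /\ p'.1 < r.1 /\ p'.1 < r'.1) \/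
  (r.1 < p.1 /\ r'.1 < p.1 /\ r.1 < p'.1 /\ r'.1 < p'.1) \/
  (p.2 < r.2 /\ p.2 < r'.2 /\ p'.2 < r.2 /\ p'.2 < r'.2) \/
  (r.2 < p.2 /\ r'.2 < p.2 /\ r.2 < p'.2 /\ r'.2 < p'.2).

Lemma lex_lt p q : p.1 < q.1 -> lex p q = true.
Proof. by rewrite /lex; case: rltbP. Qed.

Lemma lex_gt p q : q.1 < p.1 -> lex p q = false.
Proof. by rewrite /lex; case: (rltbP p.1); case: (rltbP q.1) => //=; lra. Qed.

Lemma rltbT x y : x < y -> rltb x y = true. Proof. by case: rltbP. Qed.
Lemma rltbF x y : y < x -> rltb x y = false. Proof. by case: rltbP => // *; lra. Qed.

(** With a vertical separating line all four terms vanish. With a horizontal one they either vanish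
    or reduce to four comparisons that each occur once in either direction. *)
Lemma coord_sep_parity p p' r r' : coord_sep p p' r r' ->
  xorb (xorb (above r r' p) (above r r' p')) (xorb (below p p' r) (below p p' r')) = false.
Proof.
rewrite /below /above => -[[a [b [c d]]]|[[a [b [c d]]]|[[a [b [c d]]]|[a [b [c d]]]]]].
- by rewrite ?(lex_lt a) ?(lex_lt b) ?(lex_lt c) ?(lex_lt d) ?(lex_gt a) ?(lex_gt b) ?(lex_gt c) ?(lex_gt d).
- by rewrite ?(lex_lt a) ?(lex_lt b) ?(lex_lt c) ?(lex_lt d) ?(lex_gt a) ?(lex_gt b) ?(lex_gt c) ?(lex_gt d).
- have ne x y : x.2 < y.2 -> x <> y :> pt by move=> h e; move: h; rewrite e; lra.
  rewrite (rltbT a) (rltbT c) (rltbF a) (rltbF b).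
  rewrite (lex_anti (ne _ _ a)) (lex_anti (ne _ _ b)) (lex_anti (ne _ _ c)) (lex_anti (ne _ _ d)).
  by case: (lex p r); case: (lex p' r); case: (lex p r'); case: (lex p' r').
- have ne x y : x.2 < y.2 -> x <> y :> pt by move=> h e; move: h; rewrite e; lra.
  rewrite (rltbF a) (rltbF c) (rltbT a) (rltbT b). rewrite !andbF !andbT.
  by case: (lex p r); case: (lex p' r); case: (lex p r'); case: (lex p' r').
Qed.

Fixpoint pabove (a : nat -> pt) (n : nat) (r : pt) : bool :=
  if n is m.+1 then xorb (pabove a m r) (above (a m) (a m.+1) r) else false.

Definition pbelow a n r := xorb (pabove a n r) (xorb (lex (a 0%N) r) (lex (a n) r)).

Lemma pbelowS a n r : pbelow a n.+1 r = xorb (pbelow a n r) (below (a n) (a n.+1) r).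
Proof.
rewrite /pbelow /below /=.
by case: pabove; case: above; case: (lex (a 0%N) r); case: (lex (a n) r); case: (lex (a n.+1) r).
Qed.

(** The sum of [coord_sep_parity] over all pairs of steps: interior mesh points occur twice and
    cancel modulo 2. *)
Lemma polygon_parity a b n m :
  (forall i j, (i < n)%N -> (j < m)%N -> coord_sep (a i) (a i.+1) (b j) (b j.+1)) ->
  xorb (xorb (pabove b m (a 0%N)) (pabove b m (a n))) (xorb (pbelow a n (b 0%N)) (pbelow a n (b m))) = false.
Proof.
have row p p' : (forall j, (j < m)%N -> coord_sep p p' (b j) (b j.+1)) ->
    xorb (xorb (pabove b m p) (pabove b m p')) (xorb (below p p' (b 0%N)) (below p p' (b m))) = false.
  elim: m => [|k IH] H /=; first by case: below.
  have h1 := IH (fun j jk => H j (leqW jk)); have h2 := coord_sep_parity (H k (leqnn _)).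
  move: h1 h2; do 2 case: pabove; do 2 case: above; do 3 case: below => //.
elim: n => [|n IH] H.
  by rewrite /pbelow /=; case: (lex _ (b 0%N)); case: (lex _ (b m)); case: pabove.
have h1 := IH (fun i j ik => H i j (leqW ik)); have h2 := row _ _ (fun j => H n j (leqnn _)).
move: h1 h2; rewrite !pbelowS; do 3 case: pabove; do 2 case: pbelow; do 2 case: below => //.
Qed.

Lemma continuous01_near g t eps : continuous01 g -> 0 <= t <= 1 -> 0 < eps ->
  exists2 d, 0 < d & forall s, 0 <= s <= 1 -> Rabs (s - t) < d ->
    Rabs ((g s).1 - (g t).1) < eps /\ Rabs ((g s).2 - (g t).2) < eps.
Proof.
move=> cg t01 e0; have [d [d0 H]] := cg t t01 eps e0; exists d => // s s01 sd.
have := H s s01 sd; rewrite /pdist => h.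
by have := Rmax_l (Rabs ((g s).1 - (g t).1)) (Rabs ((g s).2 - (g t).2));
   have := Rmax_r (Rabs ((g s).1 - (g t).1)) (Rabs ((g s).2 - (g t).2)); lra.
Qed.

Lemma coord_sep_local a b s t : continuous01 a -> continuous01 b -> 0 <= s <= 1 -> 0 <= t <= 1 ->
  a s <> b t -> exists d : posreal, forall s1 s2 t1 t2, 0 <= s1 <= 1 -> 0 <= s2 <= 1 ->
    0 <= t1 <= 1 -> 0 <= t2 <= 1 -> Rabs (s1 - s) < d -> Rabs (s2 - s) < d ->
    Rabs (t1 - t) < d -> Rabs (t2 - t) < d -> coord_sep (a s1) (a s2) (b t1) (b t2).
Proof.
move=> ca cb s01 t01 ab.
pose gap := Rmax (Rabs ((a s).1 - (b t).1)) (Rabs ((a s).2 - (b t).2)).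
have gl := Rmax_l (Rabs ((a s).1 - (b t).1)) (Rabs ((a s).2 - (b t).2)); rewrite -/gap in gl.
have gr := Rmax_r (Rabs ((a s).1 - (b t).1)) (Rabs ((a s).2 - (b t).2)); rewrite -/gap in gr.
have gap0 : 0 < gap.
  have [//|g0] := Rlt_le_dec 0 gap; case: ab.
  rewrite [a s]surjective_pairing [b t]surjective_pairing.
  by congr pair; move: gl gr; split_Rabs; lra.
(* Displacing both points by less than a third of the gap preserves their order in the coordinate
   that realises it. *)
have [d1 d10 H1] := continuous01_near ca s01 (Rmult_lt_0_compat (/ 3) _ ltac:(lra) gap0).
have [d2 d20 H2] := continuous01_near cb t01 (Rmult_lt_0_compat (/ 3) _ ltac:(lra) gap0).
exists (mkposreal (Rmin d1 d2) (Rmin_pos _ _ d10 d20)) => s1 s2 t1 t2 i1 i2 i3 i4 /= l1 l2 l3 l4.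
have ml := Rmin_l d1 d2; have mr := Rmin_r d1 d2.
have [x1 y1] := H1 s1 i1 ltac:(lra); have [x2 y2] := H1 s2 i2 ltac:(lra).
have [x3 y3] := H2 t1 i3 ltac:(lra); have [x4 y4] := H2 t2 i4 ltac:(lra).
have ge : gap <= Rabs ((a s).1 - (b t).1) \/ gap <= Rabs ((a s).2 - (b t).2).
  by rewrite /gap /Rmax; case: Rle_dec => _; [right|left]; lra.
move: {gl gr gap0 H1 H2 l1 l2 l3 l4} ge x1 x2 x3 x4 y1 y2 y3 y4.
move=> ge /Rabs_def2[x1 x1'] /Rabs_def2[x2 x2'] /Rabs_def2[x3 x3'] /Rabs_def2[x4 x4'].
move=> /Rabs_def2[y1 y1'] /Rabs_def2[y2 y2'] /Rabs_def2[y3 y3'] /Rabs_def2[y4 y4'].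
rewrite /coord_sep; case: ge => ge.
  have [h|h] := Rle_lt_dec (a s).1 (b t).1.
    by left; rewrite Rabs_left1 in ge; lra.
  by right; left; rewrite Rabs_right in ge; lra.
have [h|h] := Rle_lt_dec (a s).2 (b t).2.
  by right; right; left; rewrite Rabs_left1 in ge; lra.
by right; right; right; rewrite Rabs_right in ge; lra.
Qed.

Lemma coord_sep_uniform a b : continuous01 a -> continuous01 b ->
  (forall s t, 0 <= s <= 1 -> 0 <= t <= 1 -> a s <> b t) ->
  exists2 d, 0 < d & forall s s' t t', 0 <= s <= 1 -> 0 <= s' <= 1 -> 0 <= t <= 1 -> 0 <= t' <= 1 ->
    Rabs (s' - s) < d -> Rabs (t' - t) < d -> coord_sep (a s) (a s') (b t) (b t').
Proof.
move=> ca cb ab.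
have loc s t : exists d : posreal, 0 <= s <= 1 -> 0 <= t <= 1 -> forall s1 s2 t1 t2,
    0 <= s1 <= 1 -> 0 <= s2 <= 1 ->
    0 <= t1 <= 1 -> 0 <= t2 <= 1 -> Rabs (s1 - s) < d -> Rabs (s2 - s) < d ->
    Rabs (t1 - t) < d -> Rabs (t2 - t) < d -> coord_sep (a s1) (a s2) (b t1) (b t2).
  have [[s01 t01]|n] := classic (0 <= s <= 1 /\ 0 <= t <= 1).
    by have [d H] := coord_sep_local ca cb s01 t01 (ab s t s01 t01); exists d => _ _.
  by exists (mkposreal 1 Rlt_0_1) => s01 t01; case: n.
pose del s t := proj1_sig (constructive_indefinite_description _ (loc s t)).
have delP s t := proj2_sig (constructive_indefinite_description _ (loc s t)).
(* Half of the local radius: a parameter close to the centre and a second one close to the first are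
   then both within the full radius. *)
have half s t : 0 < del s t / 2 by have := cond_pos (del s t); lra.
have [d Hd] := Compactness.compactness_value_2d 0 1 0 1 (fun s t => mkposreal _ (half s t)).
exists d; first exact: cond_pos.
move=> s s' t t' s01 s'01 t01 t'01 ss tt; apply: NNPP => nsep; apply: (Hd s t s01 t01).
case=> u [v [u01 [v01 /= [su [tv dd]]]]]; apply: nsep.
rewrite -/(del u v) in su tv dd *; have h := half u v.
move: ss tt su tv => /Rabs_def2[? ?] /Rabs_def2[? ?] /Rabs_def2[? ?] /Rabs_def2[? ?].
by apply: (delP u v u01 v01) => //; rewrite -/(del u v); apply: Rabs_def1; lra.
Qed.

(** The left-hand side of [polygon_parity] for the paths [ij] and [kl], with [A] for the parities of
    rays above the points and [o] for the lexicographic order. *)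
Definition pair_parity (A : nat -> nat -> nat -> bool) (o : nat -> nat -> bool) i j k l :=
  xorb (xorb (A k l i) (A k l j))
     (xorb (xorb (A i j k) (xorb (o i k) (o j k))) (xorb (A i j l) (xorb (o i l) (o j l)))).

Definition triple_parity (A : nat -> nat -> nat -> bool) i j k :=
  xorb (A i j k) (xorb (A i k j) (A j k i)).

(* Exactly one of the three pairings of four points interleaves. *)
Lemma quadruple_parity A o i j k l :
  o k j = negb (o j k) -> o l j = negb (o j l) -> o l k = negb (o k l) ->
  xorb (pair_parity A o i j k l) (xorb (pair_parity A o i k j l) (pair_parity A o i l j k)) =
  negb (xorb (xorb (triple_parity A i j k) (triple_parity A i j l))
             (xorb (triple_parity A i k l) (triple_parity A j k l))).
Proof.
rewrite /pair_parity /triple_parity => -> -> ->.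
by case: (o i j); case: (o j k); case: (o i k); case: (o i l); case: (o j l); case: (o k l);
   rewrite /=; btauto.
Qed.

(** Exchange of quantifiers over a finite type; it underlies the choices of a sufficiently small
    perturbation below. *)
Lemma fin_small (T : finType) (Q : T -> R -> Prop) :
  (forall x d d', 0 < d' <= d -> Q x d -> Q x d') ->
  (forall x, exists2 d, 0 < d & Q x d) -> exists2 d, 0 < d & forall x, Q x d.
Proof.
move=> mono ex; suff [d d0 H] : exists2 d, 0 < d & forall x, x \in enum T -> Q x d.
  by exists d => // x; apply: H; rewrite mem_enum.
elim: (enum T) => [|x s [d d0 H]]; first by exists 1; [lra|].
have [d' d'0 H'] := ex x; exists (Rmin d d'); first exact: Rmin_pos.
have := Rmin_l d d'; have := Rmin_r d d'; have := Rmin_pos _ _ d0 d'0 => m0 mr ml.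
move=> y; rewrite inE => /orP[/eqP->|/H yQ]; first by apply: mono H'; lra.
by apply: mono yQ; lra.
Qed.

(** Disjoint paths have parity 0, so by [quadruple_parity] the four triple parities inside any four
    of the points add up to 1 modulo 2. There are five quadruples and every triple lies in exactly
    two of them; adding up gives 0 = 1. *)
Theorem no_planar_K5 (P : nat -> pt) (g : nat -> nat -> R -> pt) :
  (forall i j, (i < j < 5)%N -> [/\ continuous01 (g i j), g i j 0 = P i & g i j 1 = P j]) ->
  (forall i j k l, (i < j < 5)%N -> (k < l < 5)%N -> i <> k -> i <> l -> j <> k -> j <> l ->
     forall s t, 0 <= s <= 1 -> 0 <= t <= 1 -> g i j s <> g k l t) -> False.
Proof.
move=> Hg dis.
have [||d d0 Hd] := @fin_small ('I_5 * 'I_5 * ('I_5 * 'I_5))%type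
  (fun x d => (x.1.1 < x.1.2 < 5)%N -> (x.2.1 < x.2.2 < 5)%N ->
     x.1.1 <> x.2.1 -> x.1.1 <> x.2.2 -> x.1.2 <> x.2.1 -> x.1.2 <> x.2.2 ->
     forall s s' t t', 0 <= s <= 1 -> 0 <= s' <= 1 -> 0 <= t <= 1 -> 0 <= t' <= 1 ->
    Rabs (s' - s) < d -> Rabs (t' - t) < d ->
    coord_sep (g x.1.1 x.1.2 s) (g x.1.1 x.1.2 s') (g x.2.1 x.2.2 t) (g x.2.1 x.2.2 t')).
- move=> x d d' dd H h1 h2 h3 h4 h5 h6 s s' t t' i1 i2 i3 i4 l1 l2.
  by apply: H => //; lra.
- case=> [[i j] [k l]] /=.
  have [[h1 h2 h3 [h4 h5 h6]]|n] := classic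
    [/\ (i < j < 5)%N, (k < l < 5)%N, i <> k & [/\ i <> l, j <> k & j <> l]]; last first.
    by exists 1; [lra|] => h1 h2 h3 h4 h5 h6; case: n.
  have [c1 _ _] := Hg _ _ h1; have [c2 _ _] := Hg _ _ h2.
  have ne (a b : 'I_5) : a <> b -> a <> b :> nat by move=> ab /val_inj.
  have [d d0 H] := coord_sep_uniform c1 c2 (dis i j k l h1 h2 (ne _ _ h3) (ne _ _ h4) (ne _ _ h5) (ne _ _ h6)).
  by exists d.
have [N [Nd N0]] := archimed_cor1 d d0.
have N0' : 0 < INR N by apply: lt_0_INR; apply/ltP; lia.
pose mesh i j k := g i j (INR k / INR N).
pose A i j r := pabove (mesh i j) N (P r).
pose o i j := lex (P i) (P j).
have mesh0 i j : (i < j < 5)%N -> mesh i j 0%N = P i.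
  by case/Hg=> _ <- _; rewrite /mesh /Rdiv Rmult_0_l.
have meshN i j : (i < j < 5)%N -> mesh i j N = P j.
  by case/Hg=> _ _ <-; rewrite /mesh /Rdiv Rinv_r //; lra.
have unit k : (k <= N)%N -> 0 <= INR k / INR N <= 1.
  move=> kN; have h : INR k <= INR N by apply: le_INR; apply/leP.
  split; first by apply: Rle_mult_inv_pos => //; apply: pos_INR.
  by apply: (Rmult_le_reg_r (INR N)) => //; rewrite /Rdiv Rmult_assoc Rinv_l; lra.
have step k : Rabs (INR k.+1 / INR N - INR k / INR N) < d.
  rewrite S_INR (_ : _ - _ = / INR N); last by field; lra.
  by rewrite Rabs_right //; apply: Rle_ge; apply/Rlt_le/Rinv_0_lt_compat.
have par i j k l : (i < j < 5)%N -> (k < l < 5)%N -> i <> k -> i <> l -> j <> k -> j <> l ->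
    pair_parity A o i j k l = false.
  move=> h1 h2 h3 h4 h5 h6.
  have h := @polygon_parity (mesh i j) (mesh k l) N N _.
  rewrite mesh0 ?meshN // mesh0 ?meshN // /pbelow ?mesh0 ?meshN // in h; apply: h => x y xN yN.
  have [i5 j5 k5 l5] : [/\ (i < 5)%N, (j < 5)%N, (k < 5)%N & (l < 5)%N] by split; lia.
  have ne (a b : nat) (a5 : (a < 5)%N) (b5 : (b < 5)%N) : a <> b -> Ordinal a5 <> Ordinal b5 by move=> ab [].
  apply: (Hd (Ordinal i5, Ordinal j5, (Ordinal k5, Ordinal l5)) h1 h2);
    first [exact: ne|exact: step|apply: unit; lia].
have I1 : 0 <= 1 <= 1 by lra.
have endp i j : (i < j < 5)%N -> g i j 1 = P j by case/Hg.
(* Antisymmetry of the order needs distinct points: if two of them coincided, two paths without a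
   common end would meet there. *)
have a12 : o 2%N 1%N = negb (o 1%N 2%N).
  apply: lex_anti => E; have [_ e _] := Hg 2%N 3%N isT.
  by apply: (dis 0%N 1%N 2%N 3%N isT isT _ _ _ _ 1 0) => //; rewrite ?endp ?e //; lra.
have a13 : o 3%N 1%N = negb (o 1%N 3%N).
  by apply: lex_anti => E; apply: (dis 0%N 1%N 2%N 3%N isT isT _ _ _ _ 1 1) => //; rewrite !endp.
have a14 : o 4%N 1%N = negb (o 1%N 4%N).
  by apply: lex_anti => E; apply: (dis 0%N 1%N 2%N 4%N isT isT _ _ _ _ 1 1) => //; rewrite !endp.
have a23 : o 3%N 2%N = negb (o 2%N 3%N).
  by apply: lex_anti => E; apply: (dis 0%N 2%N 1%N 3%N isT isT _ _ _ _ 1 1) => //; rewrite !endp.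
have a24 : o 4%N 2%N = negb (o 2%N 4%N).
  by apply: lex_anti => E; apply: (dis 0%N 2%N 1%N 4%N isT isT _ _ _ _ 1 1) => //; rewrite !endp.
have a34 : o 4%N 3%N = negb (o 3%N 4%N).
  by apply: lex_anti => E; apply: (dis 0%N 3%N 1%N 4%N isT isT _ _ _ _ 1 1) => //; rewrite !endp.
have := @quadruple_parity A o 0%N 1%N 2%N 3%N a12 a13 a23; rewrite !par //.
have := @quadruple_parity A o 0%N 1%N 2%N 4%N a12 a14 a24; rewrite !par //.
have := @quadruple_parity A o 0%N 1%N 3%N 4%N a13 a14 a34; rewrite !par //.
have := @quadruple_parity A o 0%N 2%N 3%N 4%N a23 a24 a34; rewrite !par //.
have := @quadruple_parity A o 1%N 2%N 3%N 4%N a23 a24 a34; rewrite !par //.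
by do 10 case: triple_parity.
Qed.

Definition pb (P : Prop) : bool := if excluded_middle_informative P then true else false.
Lemma pbP P : reflect P (pb P).
Proof. by rewrite /pb; case: excluded_middle_informative => h; constructor. Qed.

Lemma fin_argmin (T : finType) (P : T -> Prop) (f : T -> R) : (exists x, P x) ->
  exists x, P x /\ forall y, P y -> f x <= f y.
Proof.
case=> x0 Px0.
suff [x [Px _ H]] : exists x, [/\ P x, x \in x0 :: enum T & forall y, y \in x0 :: enum T -> P y -> f x <= f y].
  by exists x; split=> // y; apply: H; rewrite inE mem_enum orbT.
elim: (enum T) => [|z s [x [Px xs H]]].
  by exists x0; split=> //; [exact: mem_head|move=> y /[!inE] /eqP-> _; lra].
have [[Pz lt]|n] := classic (P z /\ f z < f x).
  exists z; split=> //; first by rewrite !inE eqxx orbT.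
  move=> y; rewrite !inE => /or3P[/eqP->|/eqP->|ys] Py.
  + by have := H x0 (mem_head _ _) Px0; lra.
  + exact: Rle_refl.
  + by have := H y; rewrite inE ys orbT => /(_ isT Py); lra.
exists x; split=> //; first by move: xs; rewrite !inE => /orP[->|->]; rewrite ?orbT.
move=> y; rewrite !inE => /or3P[/eqP->|/eqP->|ys] Py; first by apply: H (mem_head _ _) Px0.
  by apply: Rnot_lt_le => lt; apply: n.
by apply: H; rewrite // inE ys orbT.
Qed.

Lemma continuous01_intro (g : R -> pt) :
  (forall t, 0 <= t <= 1 -> forall eps, 0 < eps -> exists2 d, 0 < d & forall s, 0 <= s <= 1 ->
    Rabs (s - t) < d -> Rabs ((g s).1 - (g t).1) < eps /\ Rabs ((g s).2 - (g t).2) < eps) ->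
  continuous01 g.
Proof.
move=> H t t01 eps e0; have [d d0 h] := H t t01 eps e0; exists d; split=> // s s01 sd.
by have [? ?] := h s s01 sd; apply: Rmax_lub_lt.
Qed.

Definition subpath (g : R -> pt) (s s' t : R) : pt := g (s + t * (s' - s)).

Lemma subpath_range s s' t : 0 <= s <= 1 -> 0 <= s' <= 1 -> 0 <= t <= 1 -> 0 <= s + t * (s' - s) <= 1.
Proof. by move=> *; split; nra. Qed.

Lemma subpath_continuous g s s' : continuous01 g -> 0 <= s <= 1 -> 0 <= s' <= 1 ->
  continuous01 (subpath g s s').
Proof.
move=> cg s01 s'01; apply: continuous01_intro => t t01 eps e0.
have [d d0 H] := continuous01_near cg (subpath_range s01 s'01 t01) e0.
exists d => // u u01 ud; apply: H; first exact: subpath_range.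
rewrite (_ : _ - _ = (u - t) * (s' - s)); last by ring.
rewrite Rabs_mult; have : Rabs (s' - s) <= 1 by split_Rabs; lra.
by have := Rabs_pos (u - t); have := Rabs_pos (s' - s); nra.
Qed.

Definition concat_path (g h : R -> pt) (t : R) : pt :=
  if Rle_dec t (/ 2) then g (2 * t) else h (2 * t - 1).

(** A single formula for both halves, so that continuity at the joint is no special case. *)
Lemma concat_pathE g h t : g 1 = h 0 ->
  concat_path g h t = ((g (Rmin 1 (2 * t))).1 + (h (Rmax 0 (2 * t - 1))).1 - (g 1).1,
                       (g (Rmin 1 (2 * t))).2 + (h (Rmax 0 (2 * t - 1))).2 - (g 1).2).
Proof.
move=> E; rewrite /concat_path; case: Rle_dec => h2.
  rewrite Rmin_right ?Rmax_left; try lra.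
  by rewrite [LHS]surjective_pairing -E; congr pair; ring.
rewrite Rmin_left ?Rmax_right; try lra.
by rewrite [LHS]surjective_pairing; congr pair; ring.
Qed.

Lemma concat_path_continuous g h : continuous01 g -> continuous01 h -> g 1 = h 0 ->
  continuous01 (concat_path g h).
Proof.
move=> cg ch E; apply: continuous01_intro => t t01 eps e0.
have u01 s : 0 <= s <= 1 -> 0 <= Rmin 1 (2 * s) <= 1 by rewrite /Rmin; case: Rle_dec; lra.
have v01 s : 0 <= s <= 1 -> 0 <= Rmax 0 (2 * s - 1) <= 1 by rewrite /Rmax; case: Rle_dec; lra.
have [d1 d10 H1] := continuous01_near cg (u01 _ t01) (ltac:(lra) : 0 < eps / 2).
have [d2 d20 H2] := continuous01_near ch (v01 _ t01) (ltac:(lra) : 0 < eps / 2).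
have m0 := Rmin_pos _ _ d10 d20; have ml := Rmin_l d1 d2; have mr := Rmin_r d1 d2.
exists (Rmin d1 d2 / 2); first lra.
move=> s s01 sd; rewrite !concat_pathE //=.
have [a1 a2] : Rabs ((g (Rmin 1 (2 * s))).1 - (g (Rmin 1 (2 * t))).1) < eps / 2 /\
    Rabs ((g (Rmin 1 (2 * s))).2 - (g (Rmin 1 (2 * t))).2) < eps / 2.
  apply: H1; first exact: u01.
  by move: sd; rewrite /Rmin; do 3 case: Rle_dec; move=> *; split_Rabs; lra.
have [b1 b2] : Rabs ((h (Rmax 0 (2 * s - 1))).1 - (h (Rmax 0 (2 * t - 1))).1) < eps / 2 /\
    Rabs ((h (Rmax 0 (2 * s - 1))).2 - (h (Rmax 0 (2 * t - 1))).2) < eps / 2.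
  apply: H2; first exact: v01.
  by move: sd ml mr; generalize (Rmin d1 d2) => m; rewrite /Rmax; do 2 case: Rle_dec; move=> *; split_Rabs; lra.
by split; [move: a1 b1|move: a2 b2]; split_Rabs; lra.
Qed.

(** * Graphs carried by systems of arcs *)

Section Strands.
(* The nodes on the arc k are the x with on k x, at parameter par k x. *)
Variables (V : finType) (Sg : Type) (on : Sg -> V -> Prop) (par : Sg -> V -> R).
Variables (g : Sg -> R -> pt) (pos : V -> pt).

(** Only the stretch between nodes of a strand matters. A closed curve is thereby cut open, and the
    piece leading from its last node back to its first carries no edge. *)
Definition used k s := exists x y, [/\ on k x, on k y & par k x <= s <= par k y].
Definition cons_on k x y := [/\ on k x, on k y, par k x < par k y &
  forall z, on k z -> ~ par k x < par k z < par k y].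
Definition strand_edge : rel V := fun x y => pb (exists k, cons_on k x y \/ cons_on k y x).

Lemma strand_edge_sym : symmetric strand_edge.
Proof. by move=> x y; apply/pbP/pbP => -[k [H|H]]; exists k; [right|left|right|left]. Qed.

Hypotheses (par01 : forall k x, on k x -> 0 <= par k x <= 1)
  (par_inj : forall k x y, on k x -> on k y -> par k x = par k y -> x = y)
  (cont : forall k x, on k x -> continuous01 (g k))
  (posE : forall k x, on k x -> g k (par k x) = pos x)
  (strand_inj : forall k s s', used k s -> used k s' -> g k s = g k s' -> s = s')
  (meet : forall k k' s s', k <> k' -> used k s -> used k' s' -> g k s = g k' s' ->
     exists z, [/\ on k z, on k' z, par k z = s & par k' z = s']).

Lemma cons_end k x y z : cons_on k x y -> on k z -> par k x <= par k z <= par k y -> z = x \/ z = y.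
Proof.
case=> ox oy lt H oz [h1 h2]; have := H z oz.
have [E|n1] := Req_dec (par k z) (par k x); first by left; apply: par_inj E.
have [E|n2] := Req_dec (par k z) (par k y); first by right; apply: par_inj E.
by case; lra.
Qed.

Lemma cons_disjoint k k' x y x' y' s s' : cons_on k x y -> cons_on k' x' y' ->
  x <> x' -> x <> y' -> y <> x' -> y <> y' ->
  par k x <= s <= par k y -> par k' x' <= s' <= par k' y' -> g k s <> g k' s'.
Proof.
move=> c c' n1 n2 n3 n4 i i' E.
have [ox oy lt H] := c; have [ox' oy' lt' H'] := c'.
have u : used k s by exists x, y.
have u' : used k' s' by exists x', y'.
have [K|K] := classic (k = k').
  subst k'; have ss := strand_inj u u' E; subst s'.
  have [h|h] := Rle_lt_dec (par k x) (par k x').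
    by case: (cons_end c ox') => [|e|e]; [lra|apply: n1|apply: n3].
  by case: (cons_end c' ox) => [|e|e]; [lra|apply: n1|apply: n2].
have [z [oz oz' e e']] := meet K u u' E; subst s s'.
by case: (cons_end c oz i); case: (cons_end c' oz' i') => h h'; subst; try congruence.
Qed.

Definition on_cons (U : {set V}) (p : pt) := exists k x y s,
  [/\ x \in U, y \in U, cons_on k x y, par k x <= s <= par k y & p = g k s].

Lemma strand_walk (U : {set V}) x y : connect (restr strand_edge U) x y -> x <> y ->
  exists h, [/\ continuous01 h, h 0 = pos x, h 1 = pos y &
    forall t, 0 <= t <= 1 -> on_cons U (h t)].
Proof.
have edge a b : restr strand_edge U a b -> exists h, [/\ continuous01 h, h 0 = pos a, h 1 = pos b &
    forall t, 0 <= t <= 1 -> on_cons U (h t)].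
  case/and3P=> aU bU /pbP[k ab].
  have [oa ob] : on k a /\ on k b by case: ab => -[].
  have a01 := par01 oa; have b01 := par01 ob.
  exists (subpath (g k) (par k a) (par k b)); split.
  - exact: subpath_continuous (cont oa) a01 b01.
  - by rewrite /subpath Rmult_0_l Rplus_0_r posE.
  - by rewrite /subpath Rmult_1_l (_ : _ + _ = par k b) ?posE //; ring.
  - move=> t t01; exists k; case: ab => c; have [_ _ lt _] := c.
      by exists a, b, (par k a + t * (par k b - par k a)); split=> //; split; nra.
    by exists b, a, (par k a + t * (par k b - par k a)); split=> //; split; nra.
case/connectP=> p; elim: p x => [|z p IH] x /=; first by move=> _ ->.
case/andP=> exz pz yl _; have [h [ch h0 h1 hU]] := edge _ _ exz.
have [zy|/eqP zy] := eqVneq z y; first by exists h; rewrite -zy.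
have [h' [ch' h'0 h'1 h'U]] := IH z pz yl zy.
exists (concat_path h h'); split.
- by apply: concat_path_continuous; rewrite // h1.
- by rewrite /concat_path; case: Rle_dec => tl; [rewrite Rmult_0_r|exfalso; lra].
- rewrite /concat_path; case: Rle_dec => tl; first by exfalso; lra.
  by rewrite (_ : 2 * 1 - 1 = 1) //; ring.
- move=> t t01; rewrite /concat_path; case: Rle_dec => tl; first by apply: hU; lra.
  by apply: h'U; lra.
Qed.

(** Representatives of two branch sets are joined by a walk inside their union. For two disjoint
    pairs these walks use edges without common ends, and such edges do not meet in the plane. *)
Theorem strand_graph_K5_free : ~ K5minor strand_edge.
Proof.
case=> B [B0 cB dB tB].
have ss := strand_edge_sym.
have rP i : exists x, x \in B i by apply/set0Pn.
pose r i := proj1_sig (constructive_indefinite_description _ (rP i)).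
have rB i : r i \in B i by apply: (proj2_sig (constructive_indefinite_description _ (rP i))).
pose O i : 'I_5 := inord i.
have Oinj (i j : nat) : (i < 5)%N -> (j < 5)%N -> i <> j -> O i != O j.
  by move=> i5 j5 ij; apply/eqP => /(congr1 val) /=; rewrite !inordK.
have W i j : exists h, (i < j < 5)%N -> [/\ continuous01 h, h 0 = pos (r (O i)), h 1 = pos (r (O j)) &
    forall t, 0 <= t <= 1 -> on_cons (B (O i) :|: B (O j)) (h t)].
  have [ij|] := boolP (i < j < 5)%N; last by exists (fun _ => (0, 0)).
  have ne : O i != O j by apply: Oinj; lia.
  have [||h H] := @strand_walk (B (O i) :|: B (O j)) (r (O i)) (r (O j)).
  - by apply: cset_touch => //; [exact: tB|rewrite in_setU rB|rewrite in_setU rB orbT].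
  - by move=> E; have := rB (O j); rewrite -E (disjointFr (dB _ _ ne)).
  by exists h.
pose h i j := proj1_sig (constructive_indefinite_description _ (W i j)).
have hP i j := proj2_sig (constructive_indefinite_description _ (W i j)).
apply: (@no_planar_K5 (fun i => pos (r (O i))) h) => [i j ij|i j k l ij kl ik il jk jl s t s01 t01].
  by have [] := hP i j ij.
have [_ _ _ /(_ s s01) [k1 [x [y [a [xU yU c ia e1]]]]]] := hP i j ij.
have [_ _ _ /(_ t t01) [k2 [x' [y' [a' [x'U y'U c' ia' e2]]]]]] := hP k l kl.
have dis u v : u \in B (O i) :|: B (O j) -> v \in B (O k) :|: B (O l) -> u <> v.
  have no a0 b0 : (a0 < 5)%N -> (b0 < 5)%N -> a0 <> b0 -> u \in B (O a0) -> u \in B (O b0) -> False.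
    by move=> h1 h2 h3 ua; rewrite (disjointFr (dB _ _ (Oinj _ _ h1 h2 h3)) ua).
  by move=> uU vU E; subst v; case/setUP: uU => u1; case/setUP: vU => u2; apply: no u1 u2 => //; lia.
by rewrite /h e1 e2; apply: cons_disjoint c c' _ _ _ _ ia ia'; apply: dis.
Qed.

Lemma strand_connected (U : {set V}) k x y : on k x -> on k y -> par k x <= par k y ->
  (forall z, on k z -> par k x <= par k z <= par k y -> z \in U) ->
  connect (restr strand_edge U) x y.
Proof.
move=> ox oy; pose N x := #|[set z | pb (on k z /\ par k x < par k z)]|.
elim: {x}(N x).+1 {-2}x (ltnSn (N x)) ox => // n IH x Nx ox xy HU.
have [E|xy'] := Req_dec (par k x) (par k y); first by rewrite (par_inj ox oy E).
have [|z [[oz xz] zmin]] := @fin_argmin V (fun z => on k z /\ par k x < par k z) (par k).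
  by exists y; split=> //; lra.
have zy : par k z <= par k y by apply: zmin; split=> //; lra.
have xU : x \in U by apply: HU => //; lra.
have zU : z \in U by apply: HU => //; lra.
apply: (connect_trans (y := z)).
  apply: connect1; rewrite /restr /= xU zU; apply/pbP; exists k; left; split=> //.
  by move=> u ou [xu uz]; have := zmin u (conj ou xu); lra.
apply: IH => // [|u ou [h1 h2]]; last by apply: HU => //; lra.
apply: leq_trans (_ : (N z < N x)%N) Nx; apply: proper_card; apply/properP; split.
  by apply/subsetP=> u; rewrite !inE => /pbP[ou zu]; apply/pbP; split=> //; lra.
exists z; rewrite inE; first by apply/pbP; split.
by apply/pbP => -[_]; lra.
Qed.
End Strands.

(** * Separators from cluster drawings *)

Section ClusterDrawing.
(* A is a forest under lt: leaves are the vertices of G, other elements are clusters.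
   gam u v draws the edge uv, cur t the boundary of cluster t; the edge uv crosses
   the curve of t at parameter pp u v t of the edge and th u v t of the curve. *)
Variables (A : finType) (lf : pred A) (lt : rel A) (G : rel A).
Variables (pos : A -> pt) (gam : A -> A -> R -> pt) (cur : A -> R -> pt).
Variables (pp th : A -> A -> A -> R).

(** A crossing is named by the orientation of the edge that leaves [t]. *)
Definition cross u v t := [&& G u v, lt u t & ~~ lt v t].
Definition child y t := lt y t && [forall z, lt y z ==> ((t == z) || lt t z)].

(** By [cd_ord] and [cd_ord2] an edge uv leaves the clusters of [u] from the inside outwards before
    it enters any cluster of [v]. By [cd_sparse] a child of [t] accounts for at most one crossing
    with the curve of [t]. *)
Record cluster_drawing : Prop := ClusterDrawing {
  cd_irr : irreflexive lt;
  cd_trans : transitive lt;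
  cd_chain : forall x y z, lt x y -> lt x z -> [|| y == z, lt y z | lt z y];
  cd_leaf : forall x y, lf x -> ~~ lt y x;
  cd_Gsym : symmetric G;
  cd_Girr : irreflexive G;
  cd_Gleaf : forall u v, G u v -> lf u;
  cd_pos : forall u v, lf u -> lf v -> pos u = pos v -> u = v;
  cd_cont : forall u v, G u v -> continuous01 (gam u v);
  cd_gam0 : forall u v, G u v -> gam u v 0 = pos u;
  cd_rev : forall u v s, G u v -> gam v u s = gam u v (1 - s);
  cd_inj : forall u v s s', G u v -> 0 <= s <= 1 -> 0 <= s' <= 1 -> gam u v s = gam u v s' -> s = s';
  cd_open : forall u v u' v' s s', G u v -> G u' v' -> 0 < s < 1 -> 0 <= s' <= 1 ->
    gam u v s = gam u' v' s' -> (u' = u /\ v' = v) \/ (u' = v /\ v' = u);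
  cd_cur : forall t, ~~ lf t -> continuous01 (cur t);
  cd_curinj : forall t a b, ~~ lf t -> 0 <= a < 1 -> 0 <= b < 1 -> cur t a = cur t b -> a = b;
  cd_curdis : forall t t' a b, ~~ lf t -> ~~ lf t' -> t <> t' -> 0 <= a < 1 -> 0 <= b < 1 ->
    cur t a <> cur t' b;
  cd_meet : forall u v t s a, G u v -> ~~ lf t -> 0 <= s <= 1 -> 0 <= a < 1 -> gam u v s = cur t a ->
    (cross u v t /\ s = pp u v t) \/ (cross v u t /\ s = 1 - pp v u t);
  cd_cross : forall u v t, cross u v t ->
    [/\ 0 < pp u v t < 1, 0 <= th u v t < 1 & gam u v (pp u v t) = cur t (th u v t)];
  cd_ord : forall u v t t', cross u v t -> cross u v t' -> pp u v t' < pp u v t -> lt t' t;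
  cd_ord2 : forall u v t t', cross u v t -> cross v u t' -> pp u v t < 1 - pp v u t';
  cd_sparse : forall y t u v u' v', child y t -> cross u v t -> (u == y) || lt u y ->
    cross u' v' t -> (u' == y) || lt u' y -> u = u' /\ v = v' }.

Hypothesis CD : cluster_drawing.

Let irr x : lt x x = false. Proof. exact: cd_irr CD x. Qed.
Let trans x y z : lt x y -> lt y z -> lt x z. Proof. exact: cd_trans CD y x z. Qed.
Let asym x y : lt x y -> lt y x -> False.
Proof. by move=> h1 h2; have := trans h1 h2; rewrite irr. Qed.

Lemma child_above y t : lt y t -> exists2 c, child c t & (y == c) || lt y c.
Proof.
move=> yt; pose P z := ((y == z) || lt y z) && lt z t.
have Py : P y by rewrite /P eqxx.
case: (@arg_minnP _ y P (fun z => #|[set w | lt z w]|) Py) => c /andP[yc ct] cmin.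
exists c => //; rewrite /child ct; apply/forallP => w; apply/implyP => cw.
case/or3P: (cd_chain CD ct cw) => [->//|->|wt]; first by rewrite orbT.
have Pw : P w by rewrite /P wt andbT; case/orP: yc => [/eqP->|/trans ->//]; rewrite ?cw ?orbT.
have := cmin w Pw; rewrite leqNgt => /negP[]; apply: proper_card; apply/properP; split.
  by apply/subsetP=> z; rewrite !inE; apply: trans.
by exists w; rewrite !inE ?irr.
Qed.

Lemma child_unique_parent y t t' : child y t -> child y t' -> t = t'.
Proof.
case/andP=> yt /forallP H /andP[yt' /forallP H'].
have := implyP (H t') yt'; have := implyP (H' t) yt.
by case/orP=> [/eqP//|tt'] /orP[/eqP//|/(asym tt')].
Qed.

Lemma child_unique y c c' t : child c t -> child c' t -> (y == c) || lt y c -> (y == c') || lt y c' -> c = c'.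
Proof.
case/andP=> ct /forallP H /andP[ct' /forallP H'].
have up a b : child a t -> lt a b -> lt b t -> False.
  case/andP=> _ /forallP h ab bt; case/orP: (implyP (h b) ab) => [/eqP E|/(asym bt)//].
  by move: bt; rewrite -E irr.
have Cc : child c t by rewrite /child ct; apply/forallP.
have Cc' : child c' t by rewrite /child ct'; apply/forallP.
case/orP=> [/eqP->|yc] /orP[/eqP|yc'] //.
- by case: (up _ _ Cc yc' ct').
- by move=> E; case: (up c' c Cc' _ ct); rewrite -E.
- case/or3P: (cd_chain CD yc yc') => [/eqP//|h|h].
    by case: (up _ _ Cc h ct').
  by case: (up _ _ Cc' h ct).
Qed.

Definition crossed t := [exists u, exists v, cross u v t].
(** A cluster whose curve is not crossed receives an isolated node, so that every element of [A]
    owns some node. *)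
Definition node_ok (x : A + A * A * A) : bool :=
  match x with inl a => lf a || ~~ crossed a | inr (u, v, t) => cross u v t end.
Definition node : finType := {x : A + A * A * A | node_ok x}.

Definition owner (x : node) : A := match val x with inl a => a | inr (_, _, t) => t end.

Definition on_edge u v (x : node) : Prop :=
  match val x with
  | inl a => a = u \/ a = v
  | inr (u', v', _) => (u' = u /\ v' = v) \/ (u' = v /\ v' = u)
  end.
Definition edge_par (u v : A) (x : node) : R :=
  match val x with
  | inl a => if a == u then 0 else 1
  | inr (u', v', t) => if u' == u then pp u' v' t else 1 - pp u' v' t
  end.
Definition node_pos (x : node) : pt :=
  match val x with inl a => pos a | inr (u, v, t) => gam u v (pp u v t) end.

Definition strand : Type := (A * A + A)%type.
(** Of the two orientations of an edge only the one that increases [enum_rank] is a strand. *)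
Definition on_strand (k : strand) (x : node) : Prop :=
  match k with
  | inl (u, v) => [/\ G u v, (enum_rank u < enum_rank v)%N & on_edge u v x]
  | inr t => match val x with inl _ => False | inr (_, _, t') => t' = t end
  end.
Definition strand_par (k : strand) (x : node) : R :=
  match k with
  | inl (u, v) => edge_par u v x
  | inr t => match val x with inl _ => 0 | inr (u, v, t') => th u v t' end
  end.
Definition strand_path (k : strand) : R -> pt :=
  match k with inl (u, v) => gam u v | inr t => cur t end.

Let Gne u v : G u v -> u != v.
Proof. by apply: contraTneq => ->; rewrite (cd_Girr CD). Qed.

Let cross_nleaf u v t : cross u v t -> ~~ lf t.
Proof. by case/and3P=> _ ut _; apply: contraL ut; apply: cd_leaf. Qed.

Let gam1 u v : G u v -> gam u v 1 = pos v.
Proof.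
move=> Guv; have Gvu : G v u by rewrite (cd_Gsym CD).
by rewrite (cd_rev CD 1 Gvu) (_ : 1 - 1 = 0) ?(cd_gam0 CD) //; ring.
Qed.

Let cross_pp u v t : cross u v t -> 0 < pp u v t < 1.
Proof. by case/(cd_cross CD). Qed.

Lemma edge_par01 u v x : on_edge u v x -> 0 <= edge_par u v x <= 1.
Proof.
rewrite /on_edge /edge_par; case: x => -[a|[[u' v'] t]] /= ok; first by case: eqP => *; lra.
by move=> _; have := cross_pp ok; case: eqP => *; lra.
Qed.

Lemma cross_par_inj u v t t' : cross u v t -> cross u v t' -> pp u v t = pp u v t' -> t = t'.
Proof.
move=> c c' E; have [_ h1 e1] := cd_cross CD c; have [_ h2 e2] := cd_cross CD c'.
apply: NNPP => tt; apply: (cd_curdis CD (cross_nleaf c) (cross_nleaf c') tt h1 h2).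
by rewrite -e1 -e2 E.
Qed.

Lemma edge_par_inj u v x y : G u v -> on_edge u v x -> on_edge u v y ->
  edge_par u v x = edge_par u v y -> x = y.
Proof.
move=> Guv ox oy E; apply: val_inj; move: ox oy E; rewrite /on_edge /edge_par.
have uv := Gne Guv; have vu : (v == u) = false by rewrite eq_sym (negbTE uv).
case: x => -[a|[[u1 v1] t1]] /= ok; case: y => -[b|[[u2 v2] t2]] /= ok'.
- by case=> ->; case=> ->; rewrite ?eqxx ?vu //; lra.
- by have h := cross_pp ok'; case=> ->; case=> -[E1 E2]; subst; rewrite ?eqxx ?vu; lra.
- by have h := cross_pp ok; case=> -[E1 E2]; case=> ->; subst; rewrite ?eqxx ?vu; lra.
- case=> -[E1 E2]; case=> -[E3 E4]; subst; rewrite ?eqxx ?vu => E.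
  + by rewrite (cross_par_inj ok ok' E).
  + by have := cd_ord2 CD ok ok'; lra.
  + by have := cd_ord2 CD ok' ok; lra.
  + by rewrite (cross_par_inj ok ok') //; lra.
Qed.

Lemma edge_posE u v x : G u v -> on_edge u v x -> gam u v (edge_par u v x) = node_pos x.
Proof.
move=> Guv; have uv := Gne Guv; have vu : (v == u) = false by rewrite eq_sym (negbTE uv).
rewrite /on_edge /edge_par /node_pos; case: x => -[a|[[u1 v1] t1]] /= ok.
  by case=> ->; rewrite ?eqxx ?vu ?gam1 ?(cd_gam0 CD).
by case=> -[-> ->]; rewrite ?eqxx ?vu // -(cd_rev CD).
Qed.

Definition graph : rel node := strand_edge on_strand strand_par.

Lemma used_edge u v s : used on_strand strand_par (inl (u, v)) s ->
  [/\ G u v, (enum_rank u < enum_rank v)%N & 0 <= s <= 1].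
Proof.
case=> x [y [[Guv rk ox] [_ _ oy] sxy]]; split=> //.
by have := edge_par01 ox; have := edge_par01 oy; move: sxy => /=; lra.
Qed.

Lemma used_curve t s : used on_strand strand_par (inr t) s -> ~~ lf t /\ 0 <= s < 1.
Proof.
case=> -[[a|[[u v] t1]] ok] [[[b|[[u' v'] t2]] ok'] []] //= E1 E2 sxy; subst.
have [_ h1 _] := cd_cross CD ok; have [_ h2 _] := cd_cross CD ok'.
by split; [apply: cross_nleaf ok|lra].
Qed.

Lemma strand_par_inj k x y : on_strand k x -> on_strand k y -> strand_par k x = strand_par k y -> x = y.
Proof.
case: k => [[u v]|t] /=; first by case=> Guv _ ox [_ _ oy]; apply: edge_par_inj.
case: x => -[a|[[u v] t1]] //= ok E1; case: y => -[b|[[u' v'] t2]] //= ok' E2; subst => E.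
apply: val_inj => /=; have [h1 h2 h3] := cd_cross CD ok; have [h1' h2' h3'] := cd_cross CD ok'.
have [Guv ut vt] := and3P ok; have [Guv' ut' vt'] := and3P ok'.
have EE : gam u v (pp u v t) = gam u' v' (pp u' v' t) by rewrite h3 h3' E.
have := cd_open CD Guv Guv' h1 _ EE; case; first lra.
  by case=> -> ->.
by case=> E1 E2; subst; rewrite ut in vt'.
Qed.

Lemma graph_K5_free : ~ K5minor graph.
Proof.
apply: (@strand_graph_K5_free _ _ on_strand strand_par strand_path node_pos).
- case=> [[u v]|t] x /=; first by case=> _ _; apply: edge_par01.
  by case: x => -[a|[[u v] t1]] //= ok _; have [_ h _] := cd_cross CD ok; lra.
- exact: strand_par_inj.
- case=> [[u v]|t] x /=; first by case=> Guv _ _; apply: (cd_cont CD).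
  by case: x => -[a|[[u v] t1]] //= ok E; subst; apply: (cd_cur CD); apply: cross_nleaf ok.
- case=> [[u v]|t] x /=; first by case=> Guv _; apply: edge_posE.
  by case: x => -[a|[[u v] t1]] //= ok E; subst; rewrite /node_pos /=; have [_ _ ->] := cd_cross CD ok.
- case=> [[u v]|t] s s'.
    by case/used_edge=> Guv _ h /used_edge[_ _ h'] /=; apply: (cd_inj CD).
  by case/used_curve=> nl h /used_curve[_ h'] /=; apply: (cd_curinj CD).
have arc_curve u v t s a : used on_strand strand_par (inl (u, v)) s ->
    used on_strand strand_par (inr t) a -> gam u v s = cur t a ->
    exists z, [/\ on_strand (inl (u, v)) z, on_strand (inr t) z, edge_par u v z = s &
      strand_par (inr t) z = a].
  case/used_edge=> Guv rk h /used_curve[nl h'] E.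
  have uv := Gne Guv; have vu : (v == u) = false by rewrite eq_sym (negbTE uv).
  case: (cd_meet CD Guv nl h h' E) => -[c sE].
    have [_ h2 h3] := cd_cross CD c.
    exists (Sub (inr (u, v, t)) (c : node_ok (inr (u, v, t)))); rewrite /on_strand /on_edge /edge_par /= eqxx.
    split=> //; first by split=> //; left.
    by apply: (cd_curinj CD nl) => //; rewrite -h3 -sE.
  have [_ h2 h3] := cd_cross CD c.
  exists (Sub (inr (v, u, t)) (c : node_ok (inr (v, u, t)))); rewrite /on_strand /on_edge /edge_par /= vu.
  split=> //; first by split=> //; right.
  apply: (cd_curinj CD nl) => //; rewrite -h3 -E (cd_rev CD) // sE; congr gam; ring.
case=> [[u v]|t] [[u' v']|t'] s s' ne /= us us' E; last 3 first.
- exact: arc_curve.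
- by have [z [h1 h2 h3 h4]] := arc_curve _ _ _ _ _ us' us (esym E); exists z.
- have [nl h] := used_curve us; have [nl' h'] := used_curve us'.
  by case: (cd_curdis CD nl nl' _ h h' E) => tt; apply: ne; rewrite tt.
have [Guv rk h] := used_edge us; have [Guv' rk' h'] := used_edge us'.
have uv := Gne Guv; have vu : (v == u) = false by rewrite eq_sym (negbTE uv).
have uv' := Gne Guv'; have vu' : (v' == u') = false by rewrite eq_sym (negbTE uv').
have diff : ~ ((u' = u /\ v' = v) \/ (u' = v /\ v' = u)).
  by case=> -[E1 E2]; subst; [apply: ne|move: rk'; rewrite ltnNge ltnW].
have s01 : s = 0 \/ s = 1.
  by apply: NNPP => n; apply: diff; apply: (cd_open CD Guv Guv' _ h' E); lra.
have s01' : s' = 0 \/ s' = 1.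
  apply: NNPP => n; apply: diff; case: (cd_open CD Guv' Guv _ h (esym E)); first lra.
    by case=> -> ->; left.
  by case=> -> ->; right.
have Gvu : G v u by rewrite (cd_Gsym CD).
have Gvu' : G v' u' by rewrite (cd_Gsym CD).
have [lu lv] := (cd_Gleaf CD Guv, cd_Gleaf CD Gvu); have [lu' lv'] := (cd_Gleaf CD Guv', cd_Gleaf CD Gvu').
have ends a (la : lf a) x y r (Gxy : G x y) : (enum_rank x < enum_rank y)%N -> (a = x /\ r = 0) \/ (a = y /\ r = 1) ->
    on_strand (inl (x, y)) (Sub (inl a) (introT orP (or_introl la) : node_ok (inl a))) /\
    edge_par x y (Sub (inl a) (introT orP (or_introl la) : node_ok (inl a))) = r.
  move=> rxy; rewrite /on_strand /on_edge /edge_par /=.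
  case=> -[E1 E2]; subst; rewrite ?eqxx; first by split=> //; split=> //; left.
  by rewrite eq_sym (negbTE (Gne Gxy)); split=> //; split=> //; right.
have [a [la H1 H2]] : exists a, [/\ lf a, (a = u /\ s = 0) \/ (a = v /\ s = 1) & (a = u' /\ s' = 0) \/ (a = v' /\ s' = 1)].
  case: s01 => ?; case: s01' => ?; subst; rewrite ?gam1 ?(cd_gam0 CD) // in E.
  - by exists u; split; [|left|left; split=> //; apply: (cd_pos CD)].
  - by exists u; split; [|left|right; split=> //; apply: (cd_pos CD)].
  - by exists v; split; [|right|left; split=> //; apply: (cd_pos CD)].
  - by exists v; split; [|right|right; split=> //; apply: (cd_pos CD)].
have [o1 p1] := ends a la u v s Guv rk H1; have [o2 p2] := ends a la u' v' s' Guv' rk' H2.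
by eexists; split; [exact: o1|exact: o2| |].
Qed.

Definition region t : {set node} := [set x | (owner x == t) || child (owner x) t].
(** Seen from the region of [t], a node lies outside [t] or inside one child of [t]; [c] is the
    curve behind which it lies, nodes on the curve included. *)
Definition port t x c := (c = t /\ ~~ lt (owner x) t) \/ (child c t /\ ((owner x == c) || lt (owner x) c)).

Lemma port_exists t x : exists c, port t x c.
Proof.
have [/child_above[c ct xc]|nx] := boolP (lt (owner x) t); first by exists c; right.
by exists t; left.
Qed.

Lemma lt_child x c t : child c t -> (x == c) || lt x c -> lt x t.
Proof. by case/andP=> ct _ /orP[/eqP->|/trans->]. Qed.

Lemma port_unique t x c c' : port t x c -> port t x c' -> c = c'.
Proof.
case=> -[h1 h2]; case=> -[h3 h4].
- by rewrite h1 h3.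
- by rewrite (lt_child h3 h4) in h2.
- by rewrite (lt_child h1 h2) in h4.
- exact: child_unique h1 h3 h2 h4.
Qed.

Lemma region_port t x : x \in region t -> port t x (owner x).
Proof.
rewrite inE => /orP[/eqP E|c]; last by right; rewrite eqxx.
by left; rewrite E irr.
Qed.

(** Passing from behind one curve to behind another is possible only along an edge inside the
    region: the combinatorial form of the curves being separating. *)
Definition port_local (e : rel node) := forall x y, e x y -> forall t c c',
  port t x c -> port t y c' -> c <> c' -> x \in region t /\ y \in region t.

Let Gvu u v : G u v -> G v u. Proof. by rewrite (cd_Gsym CD). Qed.

Definition on_side u v (x : node) : Prop :=
  match val x with inl a => a = u | inr (u', v', _) => u' = u /\ v' = v end.

Lemma on_edge_side u v x : on_edge u v x -> on_side u v x \/ on_side v u x.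
Proof. by rewrite /on_edge /on_side; case: x => -[a|[[u1 v1] t1]] /= _; case; tauto. Qed.

Lemma side_on_edge u v x : on_side u v x -> on_edge u v x.
Proof. by rewrite /on_edge /on_side; case: x => -[a|[[u1 v1] t1]] /= _; tauto. Qed.

Lemma on_edge_sym u v x : on_edge u v x -> on_edge v u x.
Proof. by rewrite /on_edge; case: x => -[a|[[u1 v1] t1]] /= _; tauto. Qed.

Lemma edge_par_sym u v x : G u v -> on_edge u v x -> edge_par v u x = 1 - edge_par u v x.
Proof.
move=> Guv; have uv := Gne Guv; have vu : (v == u) = false by rewrite eq_sym (negbTE uv).
rewrite /on_edge /edge_par; case: x => -[a|[[u1 v1] t1]] /= _.
  by case=> ->; rewrite ?eqxx ?vu ?(negbTE uv); lra.
by case=> -[E1 E2]; subst; rewrite ?eqxx ?vu ?(negbTE uv); lra.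
Qed.

Lemma side_owner u v x : G u v -> on_side u v x ->
  [/\ (u == owner x) || lt u (owner x), ~~ lt v (owner x) & v != owner x].
Proof.
move=> Guv; have uv := Gne Guv; have lv := cd_Gleaf CD (Gvu Guv).
rewrite /on_side /owner; case: x => -[a|[[u1 v1] t1]] /= ok.
  by move=> ->; rewrite eqxx eq_sym uv cd_leaf // (cd_Gleaf CD Guv).
case=> E1 E2; subst; have nl := cross_nleaf ok; case/and3P: ok => _ -> ->.
by rewrite orbT; split=> //; apply: contraNneq nl => <-.
Qed.

Lemma side_node u v t : G u v -> lt u t -> ~~ lt v t -> exists x, on_side u v x /\ owner x = t.
Proof.
move=> Guv ut vt; have c : node_ok (inr (u, v, t)) by rewrite /= /cross Guv ut vt.
by exists (Sub (inr (u, v, t)) c).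
Qed.

Lemma side_lt u v x y : G u v -> on_side u v x -> on_side u v y ->
  lt (owner x) (owner y) -> edge_par u v x < edge_par u v y.
Proof.
move=> Guv sx sy xy; have ox := side_on_edge sx; have oy := side_on_edge sy.
apply: Rnot_le_lt => le.
have ne : edge_par u v y <> edge_par u v x.
  by move/(edge_par_inj Guv oy ox) => E; rewrite E irr in xy.
have {le ne} : edge_par u v y < edge_par u v x by lra.
move: sx sy xy {ox oy}; rewrite /on_side /owner /edge_par.
case: x => -[a|[[u1 v1] t1]] /= ok; case: y => -[b|[[u2 v2] t2]] /= ok'.
- by move=> -> ->; rewrite irr.
- by move=> -> [E1 E2] _; subst; rewrite !eqxx; have := cross_pp ok'; lra.
- by move=> _ E; subst; move=> h; have := cd_leaf CD t1 (cd_Gleaf CD Guv); rewrite h.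
- case=> E1 E2 [E3 E4]; subst; rewrite !eqxx => h1 h2.
  by have := cd_ord CD ok ok' h2 => /(asym h1).
Qed.

Lemma side_side u v x y : G u v -> on_side u v x -> on_side v u y -> edge_par u v x < edge_par u v y.
Proof.
move=> Guv; have uv := Gne Guv; have vu : (v == u) = false by rewrite eq_sym (negbTE uv).
rewrite /on_side /edge_par.
case: x => -[a|[[u1 v1] t1]] /= ok; case: y => -[b|[[u2 v2] t2]] /= ok'.
- by move=> -> ->; rewrite eqxx vu; lra.
- by move=> -> [E1 E2]; subst; rewrite eqxx vu; have := cross_pp ok'; lra.
- by move=> [E1 E2] ->; subst; rewrite eqxx vu; have := cross_pp ok; lra.
- by case=> E1 E2 [E3 E4]; subst; rewrite eqxx vu; apply: (cd_ord2 CD ok ok').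
Qed.

Definition edge_cons u v x y := [/\ on_edge u v x, on_edge u v y, edge_par u v x < edge_par u v y &
  forall z, on_edge u v z -> ~ edge_par u v x < edge_par u v z < edge_par u v y].

Lemma edge_cons_sym u v x y : G u v -> edge_cons u v x y -> edge_cons v u y x.
Proof.
move=> Guv [ox oy lxy H]; split; try exact: on_edge_sym.
  by rewrite !(edge_par_sym Guv) //; lra.
move=> z oz; have ouz := on_edge_sym oz; have := H z ouz; rewrite !(edge_par_sym Guv) //; lra.
Qed.

Lemma leq_above a x t : (a == x) || lt a x -> lt x t -> lt a t.
Proof. by case/orP=> [/eqP->|/trans h] // /h. Qed.

(** A cluster strictly between the two owners would contain [u] but not [v], hence give a crossing
    between consecutive nodes. So a change of port can occur only when [t] is the owner of [y] and
    the owner of [x] is a child of [t]. *)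
Lemma same_side_local u v x y t c c' : G u v -> on_side u v x -> on_side u v y -> edge_cons u v x y ->
  port t x c -> port t y c' -> c <> c' -> x \in region t /\ y \in region t.
Proof.
move=> Guv sx sy [ox oy xy none] Px Py cc.
have [ux nvx nex] := side_owner Guv sx; have [uy nvy ney] := side_owner Guv sy.
have nxy : lt (owner x) (owner y).
  have neq : owner x != owner y.
    apply/eqP => E; have xE : x <> y by move=> e; move: xy; rewrite e; lra.
    apply: xE; apply: val_inj; move: E sx sy; rewrite /owner /on_side.
    case: (x) => -[a|[[u1 v1] t1]] /= ok; case: (y) => -[b|[[u2 v2] t2]] /= ok'.
    - by move=> ->.
    - move=> E1 E2 _; subst; have := cross_nleaf ok'; by rewrite (cd_Gleaf CD Guv).
    - move=> E1 _ E2; subst; have := cross_nleaf ok; by rewrite (cd_Gleaf CD Guv).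
    - by move=> -> [-> ->] [-> ->].
  have bad : ~ lt (owner y) (owner x) by move/(side_lt Guv sy sx); lra.
  case/orP: ux => [/eqP E|ux]; case/orP: uy => [/eqP E'|uy].
  - by rewrite -E -E' eqxx in neq.
  - by rewrite -E.
  - by case: bad; rewrite -E'.
  - by case/or3P: (cd_chain CD ux uy) => // /eqP E; rewrite E eqxx in neq.
have sep s : lt (owner x) s -> ~~ lt v s -> lt s (owner y) -> False.
  move=> xs vs sy'; have [z [sz zE]] := side_node Guv (leq_above ux xs) vs; subst s.
  by apply: (none z (side_on_edge sz)); split; apply: side_lt.
have xt : lt (owner x) t.
  apply/negPn/negP => nxt; have nyt : ~~ lt (owner y) t by apply: contra nxt; apply: trans.
  by apply: cc; rewrite (port_unique Px (or_introl (conj erefl nxt))) (port_unique Py (or_introl (conj erefl nyt))).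
have nyt : ~~ lt (owner y) t.
  apply/negP => yt; have [d dt yd] := child_above yt.
  have xd : (owner x == d) || lt (owner x) d by case/orP: yd => [/eqP<-|/(trans nxy)->]; rewrite ?nxy ?orbT.
  by apply: cc; rewrite (port_unique Px (or_intror (conj dt xd))) (port_unique Py (or_intror (conj dt yd))).
have tE : t = owner y.
  case/or3P: (cd_chain CD xt nxy) => [/eqP//|ty|yt]; last by rewrite yt in nyt.
  by case: (sep t xt _ ty); apply: contra nvy => vt; apply: trans ty.
split; last by rewrite inE tE eqxx.
case: Px => -[h1 h2]; first by rewrite xt in h2.
case/orP: h2 => [/eqP E|xc]; first by rewrite inE E h1 orbT.
have ct : lt c t by case/andP: h1.
case: (sep c xc); last by rewrite -tE.
by apply: contra nvy => vc; rewrite -tE; apply: trans ct.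
Qed.

(** The middle piece of the edge: the two owners lie below exactly the same clusters, for any other
    cluster would be crossed between [x] and [y]. A change of port then makes both owners children
    of [t]. *)
Lemma opposite_side_local u v x y t c c' : G u v -> on_side u v x -> on_side v u y -> edge_cons u v x y ->
  port t x c -> port t y c' -> c <> c' -> x \in region t /\ y \in region t.
Proof.
move=> Guv sx sy [ox oy xy none] Px Py cc.
have [ux nvx nex] := side_owner Guv sx; have [vy nuy ney] := side_owner (Gvu Guv) sy.
have xy_t s : lt (owner x) s -> lt (owner y) s.
  move=> xs; have vs : lt v s.
    apply/negPn/negP => vs; have [z [sz zE]] := side_node Guv (leq_above ux xs) vs.
    apply: (none z (side_on_edge sz)); split; first by apply: side_lt => //; rewrite zE.
    exact: side_side.
  have us := leq_above ux xs.
  case/orP: vy => [/eqP<-//|vy]; case/or3P: (cd_chain CD vs vy) => [/eqP E|sy'|//].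
    by rewrite -E us in nuy.
  by rewrite (trans us sy') in nuy.
have yx_t s : lt (owner y) s -> lt (owner x) s.
  move=> ys; have us : lt u s.
    apply/negPn/negP => us; have [z [sz zE]] := side_node (Gvu Guv) (leq_above vy ys) us.
    apply: (none z (on_edge_sym (side_on_edge sz))); split; first exact: side_side.
    have := side_lt (Gvu Guv) sy sz; rewrite zE => /(_ ys).
    have oz := side_on_edge sz; rewrite !(edge_par_sym (Gvu Guv)) //; first by lra.
    exact: on_edge_sym.
  have vs := leq_above vy ys.
  case/orP: ux => [/eqP<-//|ux]; case/or3P: (cd_chain CD us ux) => [/eqP E|sx'|//].
    by rewrite -E vs in nvx.
  by rewrite (trans vs sx') in nvx.
have xt : lt (owner x) t.
  apply/negPn/negP => nxt; have nyt : ~~ lt (owner y) t by apply: contra nxt; apply: yx_t.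
  by apply: cc; rewrite (port_unique Px (or_introl (conj erefl nxt))) (port_unique Py (or_introl (conj erefl nyt))).
have yt := xy_t t xt.
case: Px => -[c1 c2]; first by rewrite xt in c2.
case: Py => -[c1' c2']; first by rewrite yt in c2'.
split; rewrite inE.
  case/orP: c2 => [/eqP->|xc]; first by rewrite c1 orbT.
  by case: cc; apply: child_unique c1 c1' _ c2'; rewrite xy_t ?orbT.
case/orP: c2' => [/eqP->|yc]; first by rewrite c1' orbT.
by case: cc; apply: child_unique c1 c1' c2 _; rewrite yx_t ?orbT.
Qed.

Lemma edge_cons_local u v x y t c c' : G u v -> edge_cons u v x y ->
  port t x c -> port t y c' -> c <> c' -> x \in region t /\ y \in region t.
Proof.
move=> Guv xy Px Py cc; have [ox oy lxy _] := xy.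
case: (on_edge_side ox) => sx; case: (on_edge_side oy) => sy.
- exact: same_side_local xy Px Py cc.
- exact: opposite_side_local xy Px Py cc.
- by have := side_side Guv sy sx; lra.
- by have [] := same_side_local (Gvu Guv) sy sx (edge_cons_sym Guv xy) Py Px (fun E => cc (esym E)).
Qed.

Lemma graph_local : port_local graph.
Proof.
have main x y k t c c' : cons_on on_strand strand_par k x y -> port t x c -> port t y c' -> c <> c' ->
    x \in region t /\ y \in region t.
  case: k => [[u v]|s] [ox oy lxy none] Px Py cc.
    have [Guv rk ox'] := ox; have [_ _ oy'] := oy.
    move: lxy none => /= lxy none; apply: (edge_cons_local Guv _ Px Py cc); split=> // z oz.
    by apply: none; split.
  have E : owner x = owner y.
    move: ox oy => /=; rewrite /owner.
    by case: (x) => -[a|[[u1 v1] t1]] //= _ ->; case: (y) => -[b|[[u2 v2] t2]] //= _ ->.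
  by case: cc; apply: port_unique (_ : port t y c) Py; move: Px; rewrite /port E.
move=> x y /pbP[k [xy|yx]] t c c' Px Py cc; first exact: main xy Px Py cc.
by have [] := main _ _ _ _ _ _ yx Py Px (fun E => cc (esym E)).
Qed.

(** The nodes of one owner are the crossings along one curve, or just one node. *)
Lemma owner_connected (e : rel node) (y : A) (U : {set node}) : subrel graph e -> symmetric e ->
  (forall x, owner x = y -> x \in U) -> forall a b, owner a = y -> owner b = y -> connect (restr e U) a b.
Proof.
move=> ge se HU.
have str a b : owner a = y -> owner b = y -> on_strand (inr y) a -> on_strand (inr y) b ->
    strand_par (inr y) a <= strand_par (inr y) b -> connect (restr e U) a b.
  move=> ea eb oa ob ab; apply: (connect_restr_mono (e := graph) (U := U)) => //.
  apply: (@strand_connected _ _ on_strand strand_par strand_par_inj U (inr y)) => //.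
  move=> z oz _; apply: HU; move: oz; rewrite /on_strand /owner.
  by case: z => -[b'|[[u2 v2] t2]].
have crs u v : cross u v y -> crossed y by move=> c; apply/existsP; exists u; apply/existsP; exists v.
move=> a b ea eb.
have [[oa ob]|n] := classic (on_strand (inr y) a /\ on_strand (inr y) b).
  have [le|le] := Rle_lt_dec (strand_par (inr y) a) (strand_par (inr y) b); first exact: str.
  rewrite (sym_connect_sym (restr_sym _ se)); apply: str => //; lra.
suff -> : a = b by [].
apply: val_inj; move: ea eb n; rewrite /owner /on_strand.
case: a => -[a'|[[u1 v1] t1]] /= ok; case: b => -[b'|[[u2 v2] t2]] /= ok'.
- by move=> -> ->.
- move=> E1 E2 _; subst; have nl := cross_nleaf ok'; by rewrite (negbTE nl) (crs _ _ ok') in ok.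
- move=> E1 E2 _; subst; have nl := cross_nleaf ok; by rewrite (negbTE nl) (crs _ _ ok) in ok'.
- by move=> E1 E2 n; case: n; split.
Qed.

Lemma owner_exists y : exists x, owner x = y.
Proof.
have [/existsP[u /existsP[v c]]|nc] := boolP (crossed y).
  by exists (Sub (inr (u, v, y)) (c : node_ok (inr (u, v, y)))).
have ok : node_ok (inl y) by rewrite /= nc orbT.
by exists (Sub (inl y) ok).
Qed.

(* An excursion out of a region returns through the curve by which it left. *)
Lemma region_connect (e : rel node) t a b : subrel graph e -> symmetric e -> port_local e ->
  a \in region t -> b \in region t -> connect e a b -> connect (restr e (region t)) a b.
Proof.
move=> ge se loc aR bR con.
have oc c : (c = t \/ child c t) -> forall x y, owner x = c -> owner y = c -> connect (restr e (region t)) x y.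
  move=> ct; apply: owner_connected => // x E; rewrite inE E.
  by case: ct => [->|->]; rewrite ?eqxx ?orbT.
have pc x c : port t x c -> c = t \/ child c t by case=> -[]; [left|right].
have [c [p [Pb pE ap]]] : exists c p, [/\ port t b c, owner p = c & connect (restr e (region t)) a p].
  apply: (connect_inv (P := fun z => exists c p, [/\ port t z c, owner p = c & connect (restr e (region t)) a p])) con _.
    move=> z z' ez [c [p [Pz pE ap]]]; have [c' Pz'] := port_exists t z'.
    have [E|ne] := eqVneq c c'; first by exists c', p; rewrite -E in Pz' *; split.
    have [zR z'R] := loc _ _ ez t c c' Pz Pz' (elimN eqP ne).
    exists c', z'; split=> //; first exact: port_unique (region_port z'R) Pz'.
    apply: connect_trans ap _; apply: (connect_trans (y := z)).
      by apply: (oc c) => //; [apply: pc Pz|apply: port_unique (region_port zR) Pz].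
    by apply: connect1; rewrite /restr /= zR z'R.
  by exists (owner a), a; split=> //; apply: region_port.
apply: connect_trans ap _; apply: (oc c) => //; first exact: pc Pb.
exact: port_unique (region_port bR) Pb.
Qed.

(** By [region_connect] two nodes of a region that are not joined within it are not joined at all,
    so an edge between them is a bridge and creates no K5 minor. The number of non-adjacent pairs
    decreases. *)
Lemma region_completion : exists e : rel node, [/\ subrel graph e, symmetric e, ~ K5minor e,
  port_local e & forall t, cset e (region t)].
Proof.
pose gap (e : rel node) := #|[set x : node * node | ~~ e x.1 x.2]|.
have gs : symmetric graph by apply: strand_edge_sym.
suff H n (e : rel node) : (gap e < n)%N -> subrel graph e -> symmetric e -> ~ K5minor e -> port_local e ->
    exists e : rel node, [/\ subrel graph e, symmetric e, ~ K5minor e, port_local e & forall t, cset e (region t)].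
  apply: (H _ graph (ltnSn _)) => //; [exact: graph_K5_free|exact: graph_local].
elim: n e => // n IH e gn ge se nK loc.
have [[t [a [b [aR bR nab]]]]|none] := classic (exists t a b,
  [/\ a \in region t, b \in region t & ~~ connect (restr e (region t)) a b]); last first.
  exists e; split=> // t a b aR bR; apply/negPn/negP => nab; apply: none; by exists t, a, b.
have nab' : ~~ connect e a b by apply: contra nab; apply: region_connect.
apply: (IH (add_edge e a b)).
- apply: leq_trans (_ : (gap (add_edge e a b) < gap e)%N) gn.
  apply: proper_card; apply/properP; split.
    by apply/subsetP=> x; rewrite !inE; apply: contra => h; rewrite /add_edge h.
  exists (a, b); rewrite inE /=; last by rewrite /add_edge !eqxx orbT.
  by apply: contra nab' => /connect1.
- by move=> x y /ge h; rewrite /add_edge h.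
- exact: add_edge_sym.
- exact: add_bridge_K5_free.
- have ab s c c' : port s a c -> port s b c' -> c <> c' -> a \in region s /\ b \in region s.
    move=> Pa Pb cc; suff E : s = t by rewrite E.
    apply: NNPP => st; apply: cc.
    (* For [s] other than [t] the whole region of [t] lies behind a single curve: that of [s], or
       that of the child of [s] at or above [t]. The new edge changes no port there. *)
    have up x c0 : x \in region t -> port s x c0 -> exists c1, c0 = c1 /\
        ((c1 = s /\ ~~ lt t s) \/ (child c1 s /\ ((t == c1) || lt t c1))).
      rewrite inE => xR Px; exists c0; split=> //.
      have xt : (owner x == t) || lt (owner x) t by case/orP: xR => [->//|/andP[-> _]]; rewrite orbT.
      have [ts|nts] := boolP (lt t s).
        right; have [d ds td] := child_above ts.
        have Px' : port s x d.
          right; split=> //; case/orP: xt => [/eqP->//|xt].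
          by case/orP: td => [/eqP<-|/(trans xt)->]; rewrite ?xt ?orbT.
        by rewrite (port_unique Px Px').
      left; split=> //; apply: port_unique Px _; left; split=> //.
      apply/negP => xs; case/orP: xR => [/eqP E|/andP[_ /forallP h]].
        by rewrite -E xs in nts.
      case/orP: (implyP (h s) xs) => [/eqP E|ts]; first by apply: st.
      by rewrite ts in nts.
    have [c1 [-> h1]] := up _ _ aR Pa; have [c2 [-> h2]] := up _ _ bR Pb.
    case: h1 => -[h1 h1']; case: h2 => -[h2 h2'].
    + by rewrite h1 h2.
    + by rewrite (lt_child h2 h2') in h1'.
    + by rewrite (lt_child h1 h1') in h2'.
    + exact: child_unique h1 h2 h1' h2'.
  move=> x y /or3P[exy|/andP[/eqP-> /eqP->]|/andP[/eqP-> /eqP->]] s c c' Px Py cc.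
  + exact: loc exy s c c' Px Py cc.
  + exact: ab Px Py cc.
  + by have [] := ab _ _ _ Py Px (fun E => cc (esym E)).
Qed.

(** A leaf takes all crossings on its edges, so the areas of two adjacent leaves together cover the
    edge between them. *)
Definition area a : {set node} := if lf a then
  [set x | match val x with inl b => b == a | inr (u, v, _) => (u == a) || (v == a) end] else region a.

(** A crossing with the curve of [t] is charged to the child of [t] at or above its inner end; by
    [cd_sparse] the charge is injective. The other nodes are elements of [A]. *)
Lemma card_node : (#|node| <= 2 * #|A|)%N.
Proof.
have ex u v t : cross u v t -> exists y, child y t /\ ((u == y) || lt u y).
  by case/and3P=> _ ut _; have [c] := child_above ut; exists c.
pose f (x : node) : A + A := match val x with inl a => inl a | inr (u, v, t) =>
  inr (odflt u [pick y | child y t && ((u == y) || lt u y)]) end.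
have fE u v t : cross u v t -> exists y, [/\ [pick y | child y t && ((u == y) || lt u y)] = Some y,
    child y t & (u == y) || lt u y].
  move=> /ex[y [h1 h2]]; case: pickP => [z /andP[]|/(_ y)]; last by rewrite h1 h2.
  by exists z.
have fI : injective f.
  move=> x y E; apply: val_inj; move: E; rewrite /f.
  case: x => -[a|[[u v] t]] /= ok; case: y => -[b|[[u' v'] t']] /= ok' //; first by case=> ->.
  have [y [-> h1 h2]] := fE _ _ _ ok; have [y' [-> h1' h2']] := fE _ _ _ ok' => -[/= E].
  subst y'; have tt := child_unique_parent h1 h1'; subst t'.
  by have [-> ->] := cd_sparse CD h1 ok h2 ok' h2'.
have := leq_card f fI; rewrite card_sum; lia.
Qed.

(** A crossing of uv with the curve of [t] lies at most in the areas of [t], of the parent of [t],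
    of [u] and of [v]. *)
Lemma area_congestion x : (#|[set a | x \in area a]| <= 4)%N.
Proof.
pose par := odflt (owner x) [pick t | child (owner x) t].
pose uv := match val x with inl b => (b, b) | inr (u, v, _) => (u, v) end.
apply: (@leq_trans #|[set owner x; par; uv.1; uv.2]|); last first.
  do 2 (apply: leq_trans (card_setU_le _ _) _; rewrite cards1 addn1 ltnS).
  by apply: leq_trans (card_setU_le _ _) _; rewrite !cards1.
apply: subset_leq_card; apply/subsetP=> a; rewrite inE /area /uv; case: ifP => _.
  rewrite !inE; case: (val x) => [b|[[u v] t]] /=; first by move/eqP->; rewrite eqxx !orbT.
  by case/orP=> /eqP->; rewrite eqxx !orbT.
rewrite !inE => /orP[/eqP->|c]; first by rewrite eqxx.
have -> : par = a.
  rewrite /par; case: pickP => [t ct|/(_ a)]; first exact: child_unique_parent ct c.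
  by rewrite c.
by rewrite eqxx !orbT.
Qed.

Lemma edge_connected (e : rel node) (U : {set node}) u v x y : subrel graph e -> symmetric e ->
  G u v -> on_edge u v x -> on_edge u v y ->
  (forall z, on_edge u v z -> edge_par u v x <= edge_par u v z <= edge_par u v y -> z \in U) ->
  edge_par u v x <= edge_par u v y -> connect (restr e U) x y.
Proof.
move=> ge se Guv ox oy HU xy; apply: (connect_restr_mono (e := graph) (U := U)) => //.
have uv := Gne Guv.
have [rk|rk|/val_inj/enum_rank_inj E] := ltngtP (enum_rank u) (enum_rank v); last by rewrite E eqxx in uv.
  apply: (@strand_connected _ _ on_strand strand_par strand_par_inj U (inl (u, v))) => //.
  by move=> z [_ _ oz]; apply: HU.
rewrite (sym_connect_sym (restr_sym _ (strand_edge_sym _ _))).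
apply: (@strand_connected _ _ on_strand strand_par strand_par_inj U (inl (v, u))) => /=.
- by split; [exact: Gvu|exact: rk|exact: on_edge_sym].
- by split; [exact: Gvu|exact: rk|exact: on_edge_sym].
- by rewrite !(edge_par_sym Guv) //; lra.
- move=> z [_ _ /on_edge_sym oz]; rewrite !(edge_par_sym Guv) // => h; apply: HU => //; lra.
Qed.

Lemma leaf_areaE a x : lf a -> (x \in area a) =
  match val x with inl b => b == a | inr (u, v, _) => (u == a) || (v == a) end.
Proof. by move=> la; rewrite /area la inE. Qed.

Lemma leaf_area (e : rel node) a : subrel graph e -> symmetric e -> lf a ->
  exists2 h, val h = inl a & forall x, x \in area a -> connect (restr e (area a)) h x.
Proof.
move=> ge se la; have ok : node_ok (inl a) by rewrite /= la.
exists (Sub (inl a) ok) => // x xa; have := xa; rewrite leaf_areaE //.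
case E : (val x) => [b|[[u v] t]].
  by move/eqP => ba; rewrite (_ : x = Sub (inl a) ok) //; apply: val_inj; rewrite E ba.
have c : cross u v t by have := valP x; rewrite E.
have [Guv _ _] := and3P c; have uv := Gne Guv; have vu : (v == u) = false by rewrite eq_sym (negbTE uv).
have pr := cross_pp c.
case/orP=> /eqP ea; subst a.
  apply: (edge_connected (u := u) (v := v)) => //.
  - by left.
  - by rewrite /on_edge E; left.
  - move=> z oz; rewrite {1}/edge_par /= eqxx => -[_]; rewrite /edge_par E eqxx => h.
    move: oz h; rewrite leaf_areaE // /on_edge /edge_par; case: (val z) => [b|[[u1 v1] t1]] /=.
      by case=> ->; rewrite ?eqxx ?vu //= => h; exfalso; lra.
    by case=> -[-> ->]; rewrite !eqxx ?orbT.
  - by rewrite /edge_par /= eqxx E eqxx; lra.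
apply: (edge_connected (u := v) (v := u)) => //.
- exact: Gvu.
- by left.
- by rewrite /on_edge E; right.
- move=> z oz; rewrite {1}/edge_par /= eqxx => -[_]; rewrite /edge_par E (negbTE uv) => h.
  move: oz h; rewrite leaf_areaE // /on_edge /edge_par; case: (val z) => [b|[[u1 v1] t1]] /=.
    by case=> ->; rewrite ?eqxx ?(negbTE uv) //= => h; exfalso; lra.
  by case=> -[-> ->]; rewrite !eqxx ?orbT.
- by rewrite /edge_par /= eqxx E (negbTE uv); lra.
Qed.

(** The map [gm] may be two-to-one because a singleton cluster will be identified with its vertex.
    Congestion is therefore 4 * 2 = 8, and 8 times [5 * q] gives [40 * q]. *)
Theorem cluster_separator n (E : rel 'I_n) (D : {set 'I_n}) (gm : 'I_n -> A) q :
  (#|A| <= n)%N -> (10 * n <= q * q)%N ->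
  (forall a, (#|[set i | (i \notin D) && (gm i == a)]| <= 2)%N) ->
  (forall i j, i \notin D -> j \notin D -> E i j ->
     [\/ gm i = gm j, G (gm i) (gm j), child (gm i) (gm j) | child (gm j) (gm i)]) ->
  exists2 S : {set 'I_n}, (#|S| <= #|D| + 40 * q)%N &
    forall v, v \notin S -> (2 * #|component E S v| <= n)%N.
Proof.
move=> An nq H2 HE; have [e [ge se nK loc creg]] := region_completion.
have carea a : area a != set0 /\ cset e (area a).
  have [la|nla] := boolP (lf a).
    have [h hE hub] := leaf_area ge se la; split.
      by apply/set0Pn; exists h; rewrite leaf_areaE // hE.
    exact: cset_hub hub.
  rewrite /area (negbTE nla); split; last exact: creg.
  by have [x xE] := owner_exists a; apply/set0Pn; exists x; rewrite inE xE eqxx.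
have own_area x y : owner x = y -> x \in area y.
  move=> E'; have [ly|ly] := boolP (lf y); last by rewrite /area (negbTE ly) inE E' eqxx.
  rewrite leaf_areaE //; move: E'; rewrite /owner; case E1 : (val x) => [b|[[u v] t]]; first by move->.
  by move=> ty; have := valP x; rewrite E1 => /cross_nleaf; rewrite ty ly.
have cchild y t : child y t -> cset e (area y :|: area t).
  move=> yt; have [x xE] := owner_exists y.
  apply: (cset_union (x := x)) => //; [by case: (carea y)|by case: (carea t)|exact: own_area|].
  rewrite /area ifF; first by rewrite inE xE yt orbT.
  by case/andP: yt => yt _; apply/negP => /(cd_leaf CD) h; have := h y; rewrite yt.
have cedge u v : G u v -> cset e (area u :|: area v).
  move=> Guv; have lu := cd_Gleaf CD Guv; have lv := cd_Gleaf CD (Gvu Guv).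
  have [h hE hub] := leaf_area ge se lu; have [k kE kub] := leaf_area ge se lv.
  have uv := Gne Guv; have vu : (v == u) = false by rewrite eq_sym (negbTE uv).
  have hk : connect (restr e (area u :|: area v)) h k.
    apply: (edge_connected (u := u) (v := v)) => //.
    - by rewrite /on_edge hE; left.
    - by rewrite /on_edge kE; right.
    - move=> z oz _; rewrite in_setU !leaf_areaE //; move: oz; rewrite /on_edge.
      case: (val z) => [b|[[u1 v1] t1]]; first by case=> ->; rewrite eqxx ?orbT.
      by case=> -[-> ->]; rewrite !eqxx ?orbT.
    - by rewrite /edge_par hE kE eqxx vu; lra.
  apply: (cset_hub (h := h)) => // x /setUP[/hub|/kub] c.
    by apply: connect_restr_mono c => //; apply: subsetUl.
  by apply: connect_trans hk _; apply: connect_restr_mono c => //; apply: subsetUr.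
have qN : (5 * #|node| <= q * q)%N by have := card_node; lia.
have -> : (40 * q = 8 * (5 * q))%N by lia.
apply: (@region_separator n E node e D (fun i => area (gm i)) 8 q) => //.
- move=> i j iD jD Eij; case: (HE i j iD jD Eij) => [->|/cedge//|/cchild//|/cchild].
  + by rewrite setUid; case: (carea (gm j)).
  + by rewrite setUC.
- move=> x; pose F := [set a | x \in area a].
  have -> : [set i | (i \notin D) && (x \in area (gm i))] = \bigcup_(a in F) [set i | (i \notin D) && (gm i == a)].
    apply/setP=> i; apply/idP/bigcupP => [|[a]]; rewrite !inE.
      by case/andP=> iD xa; exists (gm i); rewrite inE // iD eqxx.
    by move=> xa /andP[-> /eqP->].
  apply: (@leq_trans (#|F| * 2)); last by have := area_congestion x; rewrite -/F; lia.
  rewrite -sum_nat_const; elim/big_rec2: _ => [|a m U aF IH]; first by rewrite cards0.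
  by apply: leq_trans (card_setU_le _ _) (leq_add (H2 a) IH).
Qed.
End ClusterDrawing.

(** * Paths off a curve and nested interiors *)

Lemma path_avoiding_trans J p q r : path_avoiding J p q -> path_avoiding J q r -> path_avoiding J p r.
Proof.
case=> h [ch [h0 [h1 hJ]]] [k [ck [k0 [k1 kJ]]]]; exists (concat_path h k); split.
  by apply: concat_path_continuous; rewrite // h1.
rewrite /concat_path; split; first by case: Rle_dec => hl; [rewrite Rmult_0_r|exfalso; lra].
split; first by case: Rle_dec => hl; [exfalso; lra|rewrite (_ : 2 * 1 - 1 = 1) //; ring].
by move=> t t01; case: Rle_dec => hl; [apply: hJ; lra|apply: kJ; lra].
Qed.

Lemma subpath_avoiding (J : pt -> Prop) g s s' : continuous01 g -> 0 <= s <= 1 -> 0 <= s' <= 1 ->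
  (forall t, Rmin s s' <= t <= Rmax s s' -> ~ J (g t)) -> path_avoiding J (g s) (g s').
Proof.
move=> cg s01 s'01 H; exists (subpath g s s'); split; first exact: subpath_continuous.
rewrite /subpath; split; first by congr g; ring.
split; first by congr g; ring.
move=> t t01; apply: H; rewrite /Rmin /Rmax; case: Rle_dec => le; nra.
Qed.

Lemma interior_path g p q : interior g p -> path_avoiding (on_curve g) p q -> interior g q.
Proof.
case=> _ [M HM] pq; split.
  by case: pq => h [_ [_ [<- H]]]; apply: H; lra.
by exists M => r qr; apply: HM; apply: path_avoiding_trans pq qr.
Qed.

(** If [w] were not interior to [c1], a path off [c1] would lead from [w] beyond every bound. It has
    to meet [c2], and from there [c2] itself leads, off [c1], to [z], which is interior to [c1]. *)
Lemma interior_nested c1 c2 z w : continuous01 c2 ->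
  (forall p, on_curve c2 p -> ~ on_curve c1 p) -> on_curve c2 z -> interior c1 z ->
  ~ on_curve c1 w -> interior c2 w -> interior c1 w.
Proof.
move=> cc2 dis [a [a01 az]] iz w1 [w2 [M HM]].
apply: NNPP => niw.
have [q [wq Mq]] : exists q, path_avoiding (on_curve c1) w q /\ M < pdist q (0, 0).
  apply: NNPP => nq; apply: niw; split=> //; exists M => q wq.
  by apply: Rnot_lt_le => Mq; apply: nq; exists q.
have [h [ch [h0 [h1 hJ]]]] := wq.
have [t [t01 ht]] : exists t, 0 <= t <= 1 /\ on_curve c2 (h t).
  apply: NNPP => nt; have : path_avoiding (on_curve c2) w q.
    by exists h; split=> //; split=> //; split=> // t t01 ht; apply: nt; exists t.
  by move/HM; lra.
have [b [b01 bt]] := ht.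
apply: niw; apply: interior_path (_ : interior c1 (h t)) _.
  apply: interior_path iz _; rewrite -az -bt.
  apply: subpath_avoiding => // s sab; apply: dis; exists s; split=> //.
  by move: sab; rewrite /Rmin /Rmax; case: Rle_dec; lra.
rewrite -h0; apply: subpath_avoiding => //; first lra.
by move=> s sab; apply: hJ; move: sab; rewrite /Rmin /Rmax; case: Rle_dec; lra.
Qed.

(** * Drawings of sparse clusterings *)

Section SparseClustering.
Variables (m : nat) (E0 : rel 'I_m) (C : {set {set 'I_m}}).
Hypotheses (HC : clustering E0 C) (HS : sparse_condition E0 C).
Variables (vpos : 'I_m -> pt) (arc : 'I_m -> 'I_m -> R -> pt) (ccur : {set 'I_m} -> R -> pt).
Hypothesis (pos_inj : injective vpos).
Hypothesis arc_simple : forall u v : 'I_m, (u < v)%N -> E0 u v ->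
       simple_arc (arc u v) (vpos u) (vpos v) /\
       forall t w, 0 < t < 1 -> arc u v t <> vpos w.
Hypothesis arc_disjoint : forall u v u' v' : 'I_m, (u < v)%N -> (u' < v')%N -> E0 u v -> E0 u' v' ->
       (u, v) <> (u', v') ->
       forall s t, 0 < s < 1 -> 0 < t < 1 -> arc u v s <> arc u' v' t.
Hypothesis cur_simple : forall X, X \in C -> X != setT ->
       simple_closed_curve (ccur X) /\
       (forall w, ~ on_curve (ccur X) (vpos w)) /\
       (forall w, interior (ccur X) (vpos w) <-> w \in X).
Hypothesis cur_disjoint : forall X Y, X \in C -> Y \in C -> X != setT -> Y != setT -> X != Y ->
       forall p, on_curve (ccur X) p -> ~ on_curve (ccur Y) p.
Hypothesis arc_cur : forall (u v : 'I_m) X, (u < v)%N -> E0 u v -> X \in C -> X != setT ->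
       (forall s t, 0 <= s <= 1 -> 0 <= t <= 1 ->
          on_curve (ccur X) (arc u v s) -> on_curve (ccur X) (arc u v t) -> s = t) /\
       ((exists t, 0 <= t <= 1 /\ on_curve (ccur X) (arc u v t)) ->
          (u \in X) != (v \in X)).

Let Esym : symmetric E0. Proof. by case: HC => -[]. Qed.
Let Eirr : irreflexive E0. Proof. by case: HC => -[]. Qed.

Definition dart (u v : 'I_m) : R -> pt := if (u < v)%N then arc u v else fun s => arc v u (1 - s).

Lemma dart_rev u v s : E0 u v -> dart v u s = dart u v (1 - s).
Proof.
move=> uv; rewrite /dart; case: ltngtP => // [_|/val_inj E]; first by congr arc; ring.
by rewrite E Eirr in uv.
Qed.

Lemma dart_lt (u v : 'I_m) : (u < v)%N -> dart u v = arc u v. Proof. by rewrite /dart => ->. Qed.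
Lemma dart_gt (u v : 'I_m) : (v < u)%N -> dart u v = fun s => arc v u (1 - s).
Proof. by move=> vu; rewrite /dart ltnNge (ltnW vu). Qed.

Lemma dart_cases (u v : 'I_m) : E0 u v -> (u < v)%N \/ ((v < u)%N /\ E0 v u).
Proof.
move=> uv; case: (ltngtP u v) => [|vu|/val_inj E]; [by left|by right; rewrite Esym|].
by rewrite E Eirr in uv.
Qed.

Lemma flip s : 0 <= s <= 1 -> 0 <= 1 - s <= 1. Proof. by lra. Qed.

Lemma dart_continuous u v : E0 u v -> continuous01 (dart u v).
Proof.
move=> uv; case: (dart_cases uv) => [lt|[gt vu]].
  by rewrite dart_lt //; case: (arc_simple lt uv) => -[].
rewrite dart_gt //; case: (arc_simple gt vu) => -[c _] _.
have := subpath_continuous c (ltac:(lra) : 0 <= 1 <= 1) (ltac:(lra) : 0 <= 0 <= 1).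
have fE t : subpath (arc v u) 1 0 t = arc v u (1 - t) by rewrite /subpath; congr arc; ring.
move=> H t t01 eps e0; have [d [d0 h]] := H t t01 eps e0; exists d; split=> // s s01 sd.
by rewrite -!fE; apply: h.
Qed.

Lemma dart0 u v : E0 u v -> dart u v 0 = vpos u.
Proof.
move=> uv; case: (dart_cases uv) => [lt|[gt vu]].
  by rewrite dart_lt //; case: (arc_simple lt uv) => -[_ []].
by rewrite dart_gt // Rminus_0_r; case: (arc_simple gt vu) => -[_ [_ []]].
Qed.

Lemma dart1 u v : E0 u v -> dart u v 1 = vpos v.
Proof.
move=> uv; have vu : E0 v u by rewrite Esym.
by rewrite (dart_rev 1 vu) (_ : 1 - 1 = 0) ?dart0 //; ring.
Qed.

Lemma dart_inj u v s s' : E0 u v -> 0 <= s <= 1 -> 0 <= s' <= 1 -> dart u v s = dart u v s' -> s = s'.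
Proof.
move=> uv s01 s'01; case: (dart_cases uv) => [lt|[gt vu]].
  by rewrite dart_lt //; case: (arc_simple lt uv) => -[_ [_ [_ H]]] _; apply: H.
rewrite dart_gt //; case: (arc_simple gt vu) => -[_ [_ [_ H]]] _ E.
by have := H _ _ (flip s01) (flip s'01) E; lra.
Qed.

Lemma dart_avoids u v w s : E0 u v -> 0 < s < 1 -> dart u v s <> vpos w.
Proof.
move=> uv s01; case: (dart_cases uv) => [lt|[gt vu]].
  by rewrite dart_lt //; case: (arc_simple lt uv) => _; apply.
by rewrite dart_gt //; case: (arc_simple gt vu) => _; apply; lra.
Qed.

Lemma dart_open u v u' v' s s' : E0 u v -> E0 u' v' -> 0 < s < 1 -> 0 <= s' <= 1 ->
  dart u v s = dart u' v' s' -> (u' = u /\ v' = v) \/ (u' = v /\ v' = u).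
Proof.
move=> uv uv' s01 s'01 E.
have i' : 0 < s' < 1.
  have n0 : s' <> 0 by move=> e; apply: (dart_avoids (w := u') uv s01); rewrite E e dart0.
  have n1 : s' <> 1 by move=> e; apply: (dart_avoids (w := v') uv s01); rewrite E e dart1.
  lra.
apply: NNPP => ne; move: E.
case: (dart_cases uv) => [lt|[gt vu]]; case: (dart_cases uv') => [lt'|[gt' vu']].
- by rewrite !dart_lt //; apply: arc_disjoint => // -[? ?]; apply: ne; left.
- by rewrite dart_lt // dart_gt //; apply: arc_disjoint => //; [move=> [? ?]; apply: ne; right|lra].
- by rewrite dart_gt // dart_lt //; apply: arc_disjoint => //; [move=> [? ?]; apply: ne; right|lra].
- by rewrite !dart_gt //; apply: arc_disjoint => //; [move=> [? ?]; apply: ne; left|lra|lra].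
Qed.

Definition proper_cluster X := (X \in C) && (X != setT).

Lemma dart_once u v X s t : E0 u v -> proper_cluster X -> 0 <= s <= 1 -> 0 <= t <= 1 ->
  on_curve (ccur X) (dart u v s) -> on_curve (ccur X) (dart u v t) -> s = t.
Proof.
move=> uv /andP[XC XT] s01 t01; case: (dart_cases uv) => [lt|[gt vu]].
  by rewrite dart_lt //; have [H _] := arc_cur lt uv XC XT; apply: H.
rewrite dart_gt // => h1 h2; have [H _] := arc_cur gt vu XC XT.
by have := H _ _ (flip s01) (flip t01) h1 h2; lra.
Qed.

Lemma dart_separates u v X s : E0 u v -> proper_cluster X -> 0 <= s <= 1 ->
  on_curve (ccur X) (dart u v s) -> (u \in X) != (v \in X).
Proof.
move=> uv /andP[XC XT] s01; case: (dart_cases uv) => [lt|[gt vu]].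
  by rewrite dart_lt // => h; have [_ H] := arc_cur lt uv XC XT; apply: H; exists s.
rewrite dart_gt // => h; have [_ H] := arc_cur gt vu XC XT; rewrite eq_sym; apply: H.
by exists (1 - s); split=> //; lra.
Qed.

(** An edge that missed the curve would be a path carrying the interior from [u] to [v]. A hit at
    curve parameter 1 is moved to 0 to stay in the half-open range. *)
Lemma dart_crosses u v X : E0 u v -> proper_cluster X -> u \in X -> v \notin X ->
  exists sa : R * R, [/\ 0 < sa.1 < 1, 0 <= sa.2 < 1 & dart u v sa.1 = ccur X sa.2].
Proof.
move=> uv pX uX vX; have /andP[XC XT] := pX; have [[_ [c01 _]] [nv iv]] := cur_simple XC XT.
have [s [s01 [a [a01 aE]]]] : exists s, 0 <= s <= 1 /\ on_curve (ccur X) (dart u v s).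
  apply: NNPP => ns; case/negP: vX; apply/iv.
  have /iv iu := uX; apply: interior_path iu _; exists (dart u v); split; first exact: dart_continuous.
  split; first exact: dart0.
  split; first exact: dart1.
  by move=> t t01 h; apply: ns; exists t.
have s0 : s <> 0 by move=> e; apply: (nv u); rewrite -(dart0 uv) -e; exists a.
have s1 : s <> 1 by move=> e; apply: (nv v); rewrite -(dart1 uv) -e; exists a.
have [e|ne] := Req_dec a 1.
  by exists (s, 0); split=> /=; [lra|lra|rewrite -aE e c01].
by exists (s, a); split=> //=; lra.
Qed.

(* Up to the crossing with the curve of X the edge stays inside X, so any curve it has met
   by then is nested in X. *)
Lemma early_crossing_nested u v X Y s t : E0 u v -> proper_cluster X -> proper_cluster Y -> X != Y ->
  u \in X -> 0 <= s <= 1 -> on_curve (ccur X) (dart u v s) -> 0 <= t <= 1 ->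
  on_curve (ccur Y) (dart u v t) -> t <= s -> Y \subset X.
Proof.
move=> uv pX pY XY uX s01 sX t01 tY ts; have /andP[XC XT] := pX; have /andP[YC YT] := pY.
have [_ [nX iX]] := cur_simple XC XT; have [[cY _] [_ iY]] := cur_simple YC YT.
have ne : t <> s by move=> e; apply: (cur_disjoint XC YC XT YT XY sX); rewrite -e.
apply/subsetP=> w /iY wY; apply/iX.
have dis p : on_curve (ccur Y) p -> ~ on_curve (ccur X) p by apply: cur_disjoint; rewrite // eq_sym.
apply: (interior_nested cY dis tY _ (nX w) wY).
have /iX iu := uX; apply: interior_path iu _; rewrite -(dart0 uv).
apply: subpath_avoiding => //; [exact: dart_continuous|lra|].
move=> r; rewrite Rmin_left ?Rmax_right; try lra.
move=> r01 rX; have := dart_once uv pX _ s01 rX sX; lra.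
Qed.

(** [Q] will keep just the nodes that the subgraph uses, so that the forest is counted by the size
    of the subgraph and not of the whole clustering. Clusters with one element are excluded in order
    that a vertex below a cluster is a proper subset of it. *)
Variable Q : pred (cnode m).
Hypothesis HQ : forall X, Q (inr X) -> proper_cluster X && (1 < #|X|)%N.
Let A : finType := {x : cnode m | Q x}.

Definition tree_leaf (x : A) : bool := if val x is inl _ then true else false.
Definition tree_lt (x y : A) : bool :=
  match val x, val y with
  | inl v, inr X => v \in X
  | inr X, inr Y => X \proper Y
  | _, _ => false
  end.
Definition leaf_edge (x y : A) : bool :=
  match val x, val y with inl u, inl v => E0 u v | _, _ => false end.
Definition leaf_pos (x : A) : pt := if val x is inl v then vpos v else (0, 0).
Definition leaf_arc (x y : A) : R -> pt :=
  match val x, val y with inl u, inl v => dart u v | _, _ => fun _ => (0, 0) end.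
Definition tree_cur (x : A) : R -> pt := if val x is inr X then ccur X else fun _ => (0, 0).
Definition crossing (x y t : A) : R * R := epsilon (inhabits (0, 0)) (fun sa =>
  [/\ 0 < sa.1 < 1, 0 <= sa.2 < 1 & leaf_arc x y sa.1 = tree_cur t sa.2]).
Definition crossing_arc x y t := (crossing x y t).1.
Definition crossing_cur x y t := (crossing x y t).2.

Let HX X : Q (inr X) -> [/\ X \in C, X != setT & proper_cluster X].
Proof. by case/HQ/andP=> pX _; case/andP: (pX). Qed.

Let lam X Y v : X \in C -> Y \in C -> v \in X -> v \in Y -> (X \subset Y) || (Y \subset X).
Proof.
case: HC => _ [_ [_ [L _]]] XC YC vX vY; case/or3P: (L X Y XC YC) => [->//|->|d]; first by rewrite orbT.
by rewrite (disjointFr d vX) in vY.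
Qed.

Let ppr (X Y : {set 'I_m}) : X <> Y -> X \subset Y -> X \proper Y.
Proof. by move=> /eqP ne s; rewrite properEneq ne. Qed.

Lemma crossP (x y t : A) : cross tree_lt leaf_edge x y t ->
  exists u v X, [/\ val x = inl u, val y = inl v & val t = inr X] /\ [/\ E0 u v, u \in X & v \notin X].
Proof.
rewrite /cross /leaf_edge /tree_lt; case: (val x) => [u|?]; last by [].
case: (val y) => [v|?]; last by [].
case: (val t) => [?|X]; first by rewrite andbF.
by case/and3P=> h1 h2 h3; exists u, v, X.
Qed.

Lemma crossingP (x y t : A) : cross tree_lt leaf_edge x y t ->
  [/\ 0 < crossing_arc x y t < 1, 0 <= crossing_cur x y t < 1 &
     leaf_arc x y (crossing_arc x y t) = tree_cur t (crossing_cur x y t)].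
Proof.
move=> c; have [u [v [X [[xE yE tE] [uv uX vX]]]]] := crossP c.
have QX : Q (inr X) by rewrite -tE; apply: valP.
have [_ _ pX] := HX QX.
rewrite /crossing_arc /crossing_cur; apply: (epsilon_spec (inhabits (0, 0)) (fun sa : R * R => [/\ 0 < sa.1 < 1, 0 <= sa.2 < 1 & leaf_arc x y sa.1 = tree_cur t sa.2])).
by rewrite /leaf_arc /tree_cur xE yE tE; apply: dart_crosses.
Qed.

Lemma crossing_on (x y t : A) u v X : val x = inl u -> val y = inl v -> val t = inr X ->
  cross tree_lt leaf_edge x y t -> 0 <= crossing_arc x y t <= 1 /\
  on_curve (ccur X) (dart u v (crossing_arc x y t)).
Proof.
move=> xE yE tE c; have [h1 h2 h3] := crossingP c; split; first lra.
exists (crossing_cur x y t); split; first lra.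
by move: h3; rewrite /leaf_arc /tree_cur xE yE tE.
Qed.

(** Produces the set to be played against the complement of [Y] in the sparsity condition; its
    properness ensures that the two do not cover everything. *)
Lemma below_ltn (y t : A) Y : val t = inr Y -> tree_lt y t -> exists Z : {set 'I_m}, [/\ Z \proper Y, special_set C Z &
  forall x u, val x = inl u -> (x == y) || tree_lt x y -> u \in Z].
Proof.
move=> tE; rewrite /tree_lt tE; have QY : Q (inr Y) by rewrite -tE; apply: valP.
case yE : (val y) => [w|Z] h.
  exists [set w]; split.
  - rewrite properEcard sub1set h cards1 /=; by case/andP: (HQ QY).
  - by rewrite /special_set cards1 eqxx !orbT.
  - move=> x u xE; rewrite xE orbF => /eqP E; rewrite -E xE in yE; case: yE => ->; exact: set11.
have QZ : Q (inr Z) by rewrite -yE; apply: valP.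
have [ZC _ _] := HX QZ.
exists Z; split=> //; first by rewrite /special_set ZC.
by move=> x u xE; rewrite xE => /orP[/eqP E|//]; rewrite -E xE in yE.
Qed.

Lemma sparse_cluster_drawing : cluster_drawing tree_leaf tree_lt leaf_edge leaf_pos leaf_arc tree_cur
  crossing_arc crossing_cur.
Proof.
have QV (x : A) X : val x = inr X -> [/\ X \in C, X != setT & proper_cluster X].
  by move=> xE; apply: HX; rewrite -xE; apply: valP.
split.
- by move=> x; rewrite /tree_lt; case: (val x) => // X; apply: properxx.
- move=> y x z; rewrite /tree_lt; case: (val x) => [u|X]; case: (val y) => [v|Y]; case: (val z) => [w|Z] //.
    by move=> uY /proper_sub/subsetP; apply.
  exact: proper_trans.
- move=> x y z; rewrite /tree_lt -val_eqE.
  case yE : (val y) => [v|Y]; case zE : (val z) => [w|Z]; case xE : (val x) => [u|X] //.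
    move=> uY uZ; have [YC _ _] := QV _ _ yE; have [ZC _ _] := QV _ _ zE.
    case/orP: (lam YC ZC uY uZ) => s.
      by have [->|/eqP ne] := eqVneq Y Z; [rewrite eqxx|rewrite (ppr ne s) orbT].
    by have [->|/eqP/nesym ne] := eqVneq Y Z; [rewrite eqxx|rewrite (ppr ne s) !orbT].
  move=> XY XZ; have [YC _ _] := QV _ _ yE; have [ZC _ _] := QV _ _ zE; have [XC XT _] := QV _ _ xE.
  have [_ [_ [ne0 _]]] := HC; case/set0Pn: (ne0 _ XC XT) => u uX.
  have uY := subsetP (proper_sub XY) _ uX; have uZ := subsetP (proper_sub XZ) _ uX.
  case/orP: (lam YC ZC uY uZ) => s.
    by have [->|/eqP ne] := eqVneq Y Z; [rewrite eqxx|rewrite (ppr ne s) orbT].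
  by have [->|/eqP/nesym ne] := eqVneq Y Z; [rewrite eqxx|rewrite (ppr ne s) !orbT].
- move=> x y; rewrite /tree_leaf /tree_lt; case: (val x) => // u _; by case: (val y).
- by move=> x y; rewrite /leaf_edge; case: (val x) => [u|?]; case: (val y) => [v|?].
- by move=> x; rewrite /leaf_edge; case: (val x).
- by move=> x y; rewrite /leaf_edge /tree_leaf; case: (val x).
- move=> x y; rewrite /tree_leaf /leaf_pos; case xE : (val x) => [u|?] // _; case yE : (val y) => [v|?] // _.
  by move=> /pos_inj E; apply: val_inj; rewrite xE yE E.
- move=> x y; rewrite /leaf_edge /leaf_arc; case: (val x) => [u|?] //; case: (val y) => [v|?] //.
  exact: dart_continuous.
- move=> x y; rewrite /leaf_edge /leaf_arc /leaf_pos; case: (val x) => [u|?] //; case: (val y) => [v|?] //.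
  exact: dart0.
- move=> x y s; rewrite /leaf_edge /leaf_arc; case: (val x) => [u|?] //; case: (val y) => [v|?] //.
  exact: dart_rev.
- move=> x y s s'; rewrite /leaf_edge /leaf_arc; case: (val x) => [u|?] //; case: (val y) => [v|?] //.
  exact: dart_inj.
- move=> x y x' y' s s'; rewrite /leaf_edge /leaf_arc.
  case xE : (val x) => [u|?] //; case yE : (val y) => [v|?] //.
  case x'E : (val x') => [u'|?] //; case y'E : (val y') => [v'|?] // h1 h2 h3 h4 h5.
  by case: (dart_open h1 h2 h3 h4 h5) => -[E1 E2]; [left|right]; split; apply: val_inj; congruence.
- move=> t; rewrite /tree_leaf /tree_cur; case tE : (val t) => [?|X] // _.
  by have [XC XT _] := QV _ _ tE; have [[]] := cur_simple XC XT.
- move=> t a b; rewrite /tree_leaf /tree_cur; case tE : (val t) => [?|X] // _.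
  by have [XC XT _] := QV _ _ tE; have [[_ [_ H]] _] := cur_simple XC XT => ia ib; apply: H.
- move=> t t' a b; rewrite /tree_leaf /tree_cur; case tE : (val t) => [?|X] // _; case t'E : (val t') => [?|Y] // _.
  move=> tt a01 b01 E; have [XC XT _] := QV _ _ tE; have [YC YT _] := QV _ _ t'E.
  have XY : X != Y by apply/eqP => e; apply: tt; apply: val_inj; rewrite tE t'E e.
  apply: (cur_disjoint XC YC XT YT XY (p := ccur X a)); first by exists a; split=> //; lra.
  by exists b; split=> //; lra.
- move=> x y t s a Gxy nl s01 a01 E.
  move: Gxy nl E; rewrite /leaf_edge /tree_leaf /leaf_arc /tree_cur.
  case xE : (val x) => [u|?] //; case yE : (val y) => [v|?] //; case tE : (val t) => [?|X] // uv _ E.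
  have [_ _ pX] := QV _ _ tE.
  have on : on_curve (ccur X) (dart u v s) by exists a; split=> //; lra.
  have := dart_separates uv pX s01 on.
  have vu : E0 v u by rewrite Esym.
  have cr (x' y' : A) u' v' : val x' = inl u' -> val y' = inl v' -> E0 u' v' -> u' \in X -> v' \notin X ->
      cross tree_lt leaf_edge x' y' t.
    by move=> x'E y'E uv' u'X v'X; rewrite /cross /leaf_edge /tree_lt x'E y'E tE uv' u'X v'X.
  case uX : (u \in X); case vX : (v \in X) => // _; [left|right].
    have c : cross tree_lt leaf_edge x y t by apply: cr xE yE uv uX _; rewrite vX.
    by split=> //; have [h1 h2] := crossing_on xE yE tE c; apply: dart_once on h2.
  have c : cross tree_lt leaf_edge y x t by apply: cr yE xE vu vX _; rewrite uX.
  split=> //; have [h1 h2] := crossing_on yE xE tE c.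
  have on' : on_curve (ccur X) (dart v u (1 - s)).
    by rewrite (dart_rev _ uv) (_ : 1 - (1 - s) = s) //; ring.
  by have := dart_once vu pX (flip s01) h1 on' h2; lra.
- exact: crossingP.
- move=> x y t t' c c' lt; have [u [v [X [[xE yE tE] [uv uX vX]]]]] := crossP c.
  have [u' [v' [Y [[xE' yE' t'E] [_ uY vY]]]]] := crossP c'.
  rewrite xE in xE'; rewrite yE in yE'; case: xE' yE' => ? [?]; subst u' v'.
  have [_ _ pX] := QV _ _ tE; have [_ _ pY] := QV _ _ t'E.
  have [h1 h2] := crossing_on xE yE tE c; have [h1' h2'] := crossing_on xE yE t'E c'.
  have XY : X != Y.
    apply/eqP => E; subst Y; have := dart_once uv pX h1 h1' h2 h2'; lra.
  rewrite /tree_lt tE t'E properEneq eq_sym XY.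
  by apply: (early_crossing_nested uv pX pY XY uX h1 h2 h1' h2'); lra.
- move=> x y t t' c c'; have [u [v [X [[xE yE tE] [uv uX vX]]]]] := crossP c.
  have [v' [u' [Y [[yE' xE' t'E] [vu vY uY]]]]] := crossP c'.
  rewrite xE in xE'; rewrite yE in yE'; case: xE' yE' => ? [?]; subst u' v'.
  have [_ _ pX] := QV _ _ tE; have [_ _ pY] := QV _ _ t'E.
  have [h1 h2] := crossing_on xE yE tE c; have [h1' h2'] := crossing_on yE xE t'E c'.
  have XY : X != Y by apply: contraNneq vX => ->.
  (* If a curve around [v] were met no later than that of [X], its cluster would be nested in [X]
     and bring [v] into [X]. *)
  apply: Rnot_le_lt => le; case/negP: vX.
  apply: (subsetP (early_crossing_nested uv pX pY XY uX h1 h2 (flip h1') _ le)) => //.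
  by rewrite -dart_rev.
- move=> y t x1 x2 x3 x4 /andP[yt _] c h c' h'.
  have [u [v [X [[xE yE tE] [uv uX vX]]]]] := crossP c.
  have [u' [v' [X' [[xE' yE' tE'] [uv' uX' vX']]]]] := crossP c'.
  rewrite tE in tE'; case: tE' => ?; subst X'.
  (* Both crossing edges run between [Z] and the complement of [X], where sparsity allows only
     one. *)
  have [Z [ZX sZ HZ]] := below_ltn tE yt.
  have [uZ u'Z] := (HZ _ _ xE h, HZ _ _ xE' h').
  have [XC _ _] := QV _ _ tE.
  have dis : [disjoint Z & ~: X].
    by rewrite disjoints_subset setCK; apply: proper_sub.
  have nT : Z :|: ~: X != setT.
    case/properP: ZX => _ [w wX wZ]; apply/eqP => /setP/(_ w).
    by rewrite !inE (negbTE wZ) wX.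
  have sX : special_set C (~: X) by rewrite /special_set setCK XC orbT.
  have := HS sZ sX dis nT; set F := [set _ | _] => F1.
  (* The sparsity condition counts an edge with its smaller end in front, so darts are sorted before
     they are compared. *)
  pose srt (a b : 'I_m) := if (a < b)%N then (a, b) else (b, a).
  have inF a b : E0 a b -> a \in Z -> b \notin X -> srt a b \in F.
    move=> ab aZ bX; rewrite /srt; case: ltngtP => [lt|gt|/val_inj e]; last by rewrite e Eirr in ab.
      by rewrite inE /= lt ab aZ /= !in_setC bX.
    by rewrite inE /= gt Esym ab aZ /= !in_setC bX orbT.
  have E : srt u v = srt u' v'.
    by apply: (card_le1_eqP F1); apply: inF.
  have [e1 e2] : u = u' /\ v = v'.
    have ZXs := subsetP (proper_sub ZX).
    move: E; rewrite /srt; case: ifP => _; case: ifP => _ [a b]; subst => //.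
      by case/negP: vX; apply: ZXs.
    by case/negP: vX; apply: ZXs.
  by split; apply: val_inj; congruence.
Qed.
End SparseClustering.

(** With [s] the integer root of [10 * n] and [q] = [s.+1], the bound [s <= 4 * sqrt n] (from 10 <=
    16) gives at most 43 + 160 * sqrt n vertices, below 300 * sqrt n for positive [n]. *)
Lemma has_separator_intro n (E : rel 'I_n) :
  (forall q, (10 * n <= q * q)%N -> exists2 S : {set 'I_n}, (#|S| <= 3 + 40 * q)%N &
     forall v, v \notin S -> (2 * #|component E S v| <= n)%N) ->
  has_separator E 300 (/ 2).
Proof.
move=> H; have [n0|n0] := posnP n.
  subst n; exists set0; split; last by case.
  rewrite cards0 /= sqrt_0; lra.
pose s := Nat.sqrt (10 * n); have [s1 s2] := Nat.sqrt_spec' (10 * n); rewrite -/s in s1 s2.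
have [S SH comp] := H s.+1 ltac:(lia).
have r1 : 1 <= sqrt (INR n).
  rewrite -sqrt_1; apply: sqrt_le_1_alt; rewrite -[1]/(INR 1); apply: le_INR; lia.
have rn : sqrt (INR n) * sqrt (INR n) = INR n by apply: sqrt_sqrt; apply: pos_INR.
have sr : INR s <= 4 * sqrt (INR n).
  apply: Rsqr_incr_0_var; last by lra.
  rewrite /Rsqr; have : INR (s * s) <= INR (10 * n) by apply: le_INR; lia.
  rewrite -!multE !mult_INR [INR 10]/= ; nra.
exists S; split.
  have : INR #|S| <= INR (3 + 40 * s.+1) by apply: le_INR; apply/leP.
  rewrite -plusE -multE plus_INR mult_INR (S_INR s).
  have -> : INR 3 = 3 by rewrite /=; ring.
  have -> : INR 40 = 40 by rewrite INR_IZR_INZ.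
  lra.
move=> v vS; have : INR (2 * #|component E S v|) <= INR n by apply: le_INR; apply/leP; apply: comp.
rewrite -multE mult_INR; have -> : INR 2 = 2 by rewrite /=; ring.
lra.
Qed.

Theorem sparse_cluster_separator n (E : rel 'I_n) : subgraph_of_sparse_cluster_graph E ->
  has_separator E 300 (/ 2).
Proof.
case=> m [E0 [C [[HC [[vpos [arc [ccur [h1 [h2 [h3 [h4 [h5 h6]]]]]]]] HS]] [f [fI [fv fE]]]]]].
apply: has_separator_intro => q nq.
(* The root cluster has no curve; its node goes straight into the separator. *)
pose D := [set i | f i == inr setT].
have D1 : (#|D| <= 1)%N.
  by apply/card_le1_eqP => i j; rewrite !inE => /eqP fi /eqP fj; apply: fI; rewrite fi fj.
have [/forallP allD|/forallPn[i0 i0D]] := boolP [forall i, i \in D].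
  by exists D; [apply: (leq_trans D1); apply: (@leq_trans 3) => //; apply: leq_addr|move=> v; rewrite allD].
(* A singleton cluster is identified with its vertex. *)
pose g (x : cnode m) : cnode m := match x with inl v => inl v | inr X =>
  if #|X| == 1%N then (if [pick v in X] is Some v then inl v else inr X) else inr X end.
have g1 (X : {set 'I_m}) : #|X| = 1%N -> exists2 v : 'I_m, X = [set v] & g (inr X) = inl v.
  move=> /eqP/cards1P[v ->]; exists v => //; rewrite /g cards1 eqxx.
  by case: pickP => [w /set1P->//|/(_ v)]; rewrite set11.
have gn (X : {set 'I_m}) : #|X| != 1%N -> g (inr X) = inr X by move=> h; rewrite /g (negbTE h).
pose Q (x : cnode m) := x \in [set g (f i) | i in ~: D].
have clus i (X : {set 'I_m}) : i \notin D -> f i = inr X -> [/\ X \in C, X != setT & X != set0].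
  rewrite inE => iD fi; have XT : X != setT by apply: contraNneq iD => <-; rewrite fi.
  have XC : X \in C by have := fv i; rewrite fi.
  by have [_ [_ [ne _]]] := HC; split=> //; apply: ne.
have HQ (X : {set 'I_m}) : Q (inr X) -> proper_cluster C X && (1 < #|X|)%N.
  case/imsetP=> i; rewrite in_setC => iD; case fi : (f i) => [v|Y] //.
  have [YC YT Y0] := clus _ _ iD fi.
  have [/g1[v _ ->]//|Y1] := eqVneq #|Y| 1%N.
  rewrite gn // => -[->]; rewrite /proper_cluster YC YT /=.
  by rewrite ltn_neqAle eq_sym Y1 card_gt0.
have CD := sparse_cluster_drawing HC HS h1 h2 h3 h4 h5 h6 HQ.
pose A : finType := {x : cnode m | Q x}.
have Qg i : i \notin D -> Q (g (f i)) by move=> iD; apply: imset_f; rewrite in_setC.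
pose gm i : A := insubd (Sub (g (f i0)) (Qg i0 i0D) : A) (g (f i)).
have gmE i : i \notin D -> val (gm i) = g (f i) by move=> iD; rewrite /gm val_insubd (Qg i iD).
have An : (#|A| <= n)%N.
  rewrite card_sig; apply: leq_trans (_ : #|[set g (f i) | i in ~: D]| <= n)%N.
    by apply: subset_leq_card; apply/subsetP=> x; rewrite inE.
  by apply: leq_trans (leq_imset_card _ _) _; rewrite -[X in (_ <= X)%N]card_ord max_card.
have [] := cluster_separator CD (E := E) (D := D) (gm := gm) An nq.
- move=> a.
  have fib i : i \notin D -> gm i = a -> g (f i) = val a by move=> iD <-; rewrite gmE.
  case aE : (val a) => [v|X].
    apply: (@leq_trans #|[set i | f i \in [set inl v; inr [set v]]]|).
      apply: subset_leq_card; apply/subsetP=> i; rewrite !inE => /andP[iD /eqP/fib]; rewrite inE aE => /(_ iD).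
      case: (f i) => [u|X]; first by move=> /= ->; rewrite eqxx.
      have [/g1[u -> ->] [->]|X1] := eqVneq #|X| 1%N; first by rewrite eqxx orbT.
      by rewrite gn.
    apply: leq_trans (_ : #|[set (inl v : cnode m); inr [set v]]| <= 2)%N; last by rewrite cards2; case: (_ != _).
    by rewrite -(card_imset _ fI); apply: subset_leq_card; apply/subsetP=> x /imsetP[i]; rewrite inE => h ->.
  apply: leq_trans (_ : _ <= 1)%N _ => //; apply/card_le1_eqP => i j; rewrite !in_set => /andP[iD /eqP/fib gi] /andP[jD /eqP/fib gj].
  have {}iD : i \notin D by rewrite in_set.
  have {}jD : j \notin D by rewrite in_set.
  apply: fI; move: (gi iD) (gj jD); rewrite aE.
  have back k : g (f k) = inr X -> f k = inr X.
    case: (f k) => [//|Y]; have [/g1[u _ ->]//|Y1] := eqVneq #|Y| 1%N; by rewrite gn.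
  by move=> /back-> /back->.
- move=> i j iD jD /fE.
  have QA (z : A) (X : {set 'I_m}) : val z = inr X -> [/\ X \in C, X != setT & (1 < #|X|)%N].
    by move=> zE; have := valP z; rewrite zE => /HQ/andP[/andP[-> ->] ->].
  (* The smallest cluster of [C] around a vertex is also the smallest among those kept, so edges of
     the cluster graph remain child relations in the smaller forest. *)
  have leafchild (i1 j1 : 'I_n) v X : i1 \notin D -> j1 \notin D -> f i1 = inl v -> f j1 = inr X ->
      min_cluster C v X -> gm i1 = gm j1 \/ child (@tree_lt m Q) (gm i1) (gm j1).
    move=> i1D j1D fi fj /and3P[XC vX /forallP Xmin].
    have [X1|X1] := eqVneq #|X| 1%N.
      have [u XE gE] := g1 X X1; left; apply: val_inj; rewrite !gmE // fi fj gE.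
      by move: vX; rewrite XE => /set1P->.
    have vi : val (gm i1) = inl v by rewrite gmE // fi.
    have vj : val (gm j1) = inr X by rewrite gmE // fj gn.
    right; rewrite /child /tree_lt vi vj vX; apply/forallP => z; rewrite -val_eqE vj.
    case zE : (val z) => [w|Z] //; apply/implyP => vZ; have [ZC _ _] := QA _ _ zE.
    have := Xmin Z; rewrite ZC vZ /= => XZ.
    by have [->|/eqP ne] := eqVneq X Z; [rewrite eqxx|apply/orP; right; rewrite properEneq XZ andbT; apply/eqP].
  have cchild (i1 j1 : 'I_n) X Y : i1 \notin D -> j1 \notin D -> f i1 = inr X -> f j1 = inr Y ->
      parent_cluster C X Y -> child (@tree_lt m Q) (gm i1) (gm j1).
    move=> i1D j1D fi fj /and4P[XC YC XY /forallP Ymin].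
    have [_ XT X0] := clus _ _ i1D fi.
    have Y1 : #|Y| != 1%N by apply/eqP => e; have := proper_card XY; rewrite e ltnS leqn0 cards_eq0 (negbTE X0).
    have vj : val (gm j1) = inr Y by rewrite gmE // fj gn.
    have up (Z : {set 'I_m}) : Z \in C -> X \proper Z -> (inr Y == inr Z :> cnode m) || (Y \proper Z).
      move=> ZC XZ; have := Ymin Z; rewrite ZC XZ /= => YZ.
      by have [->|/eqP ne] := eqVneq Y Z; [rewrite eqxx|apply/orP; right; rewrite properEneq YZ andbT; apply/eqP].
    have [X1|X1] := eqVneq #|X| 1%N.
      have [u XE gE] := g1 X X1.
      have vi : val (gm i1) = inl u by rewrite gmE // fi gE.
      rewrite /child /tree_lt vi vj; apply/andP; split.
        by apply: (subsetP (proper_sub XY)); rewrite XE set11.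
      apply/forallP => z; rewrite -val_eqE vj; case zE : (val z) => [w|Z] //; apply/implyP => uZ.
      have [ZC _ Z1] := QA _ _ zE; apply: up => //.
      by rewrite properEcard XE sub1set uZ cards1.
    have vi : val (gm i1) = inr X by rewrite gmE // fi gn.
    rewrite /child /tree_lt vi vj XY; apply/forallP => z; rewrite -val_eqE vj.
    case zE : (val z) => [w|Z] //; apply/implyP => XZ; have [ZC _ _] := QA _ _ zE; exact: up.
  case fi : (f i) => [u|X]; case fj : (f j) => [v|Y] /=.
  + by move=> uv; constructor 2; rewrite /leaf_edge !gmE // fi fj.
  + by case/(leafchild i j u Y iD jD fi fj) => h; [constructor 1|constructor 3].
  + by case/(leafchild j i v X jD iD fj fi) => h; [constructor 1|constructor 4].
  + by case/orP=> [/(cchild i j X Y iD jD fi fj)|/(cchild j i Y X jD iD fj fi)] h; [constructor 3|constructor 4].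
- by move=> S SH comp; exists S => //; apply: leq_trans SH _; rewrite leq_add2r; apply: leq_trans D1 _.
Qed.

(** * The forest above the base of a treetope *)

Definition vec3 : Type := (R * R * R)%type.
Definition dot3 (a b : vec3) : R := a.1.1 * b.1.1 + a.1.2 * b.1.2 + a.2 * b.2.
Definition add3 (a b : vec3) : vec3 := (a.1.1 + b.1.1, a.1.2 + b.1.2, a.2 + b.2).
Definition scl3 (k : R) (a : vec3) : vec3 := (k * a.1.1, k * a.1.2, k * a.2).
Definition zero3 : vec3 := (0, 0, 0).

Lemma add3_scl0 a b : add3 a (scl3 0 b) = a.
Proof. by case: a => [[? ?] ?]; rewrite /add3 /scl3 /=; congr (_, _, _); ring. Qed.

Section Shadow.
(* Vertex i of the polytope sits at height h i above the base, over the point x i. *)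
Variables (n : nat) (x : 'I_n -> vec3) (h : 'I_n -> R).
Definition L (w : vec3) i := dot3 w (x i).
Definition vl w s i := L w i + s * h i.
Definition is_max w s i := forall j, vl w s j <= vl w s i.
Definition uniq_max w s i := forall j, j <> i -> vl w s j < vl w s i.
Definition nontop i := exists j, h i < h j.
Definition base i := h i = 0.

Lemma LD w w' i : L (add3 w w') i = L w i + L w' i.
Proof. rewrite /L /dot3 /add3 /=; ring. Qed.
Lemma LZ k w i : L (scl3 k w) i = k * L w i.
Proof. rewrite /L /dot3 /scl3 /=; ring. Qed.

(** What remains of a treetope in coordinates: [sh_strict] says that every index is a vertex,
    [sh_tree] is the treetope condition on faces with three vertices, [sh_span] the full dimension
    of the base and [sh_apex] that not everything lies in the base. *)
Record shadow : Prop := Shadow {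
  sh_ge0 : forall i, 0 <= h i;
  sh_strict : forall i, exists w s, uniq_max w s i;
  sh_tree : forall w s i j k, i <> j -> j <> k -> i <> k ->
    is_max w s i -> is_max w s j -> is_max w s k ->
    exists p q, [/\ p <> q, base p, base q, is_max w s p & is_max w s q];
  sh_span : forall w, (forall i j, base i -> base j -> L w i = L w j) -> w = zero3;
  sh_base : exists v w, [/\ v <> w, base v & base w];
  sh_apex : exists z, 0 < h z }.

Hypothesis SH : shadow.
Let h_ge0 := sh_ge0 SH.
Let strict := sh_strict SH.
Let tree := sh_tree SH.
Let has_base := sh_base SH.
Let has_apex := sh_apex SH.

Lemma uniq_is_max w s i : uniq_max w s i -> is_max w s i.
Proof. by move=> u j; have [->|/u] := classic (j = i); lra. Qed.

(* How far the functional must be tilted upwards before z catches up with t. *)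
Definition rate w s t z := (vl w s t - vl w s z) / (h z - h t).

Lemma rate_mul w s t z : h t < h z -> rate w s t z * (h z - h t) = vl w s t - vl w s z.
Proof. by move=> tz; rewrite /rate; field; lra. Qed.

Lemma vl_tilt w s d i : vl w (s + d) i = vl w s i + d * h i.
Proof. rewrite /vl; ring. Qed.

Lemma rate_pos w s t z : uniq_max w s t -> h t < h z -> 0 < rate w s t z.
Proof.
move=> u tz; have zt : z <> t by move=> E; move: tz; rewrite E; lra.
have := u z zt; have := rate_mul w s tz => e lt; nra.
Qed.

(** In case of a tie the tilt by the common rate maximises [t], [p] and [z] together, so two base
    vertices are maximal as well. But every vertex no higher than [t], other than [t], has fallen
    strictly behind. *)
Lemma rate_min_unique w s t p z : uniq_max w s t -> h t < h p -> h t < h z -> p <> z ->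
  (forall y, h t < h y -> rate w s t p <= rate w s t y) -> rate w s t z <= rate w s t p -> False.
Proof.
move=> u tp tz pz mn zp.
have r0 := rate_pos u tp; set r := rate w s t p in mn zp r0.
have E : rate w s t z = r by have := mn z tz; lra.
have vE y : vl w (s + r) y = vl w s y + r * h y := vl_tilt w s r y.
have lowmax y : h y <= h t -> y <> t -> vl w (s + r) y < vl w (s + r) t.
  by move=> yt /u lt; rewrite !vE; nra.
have mt : is_max w (s + r) t.
  move=> y; have [yt|ty] := Rle_lt_dec (h y) (h t).
    by have [->|/(lowmax _ yt)] := classic (y = t); lra.
  by have := mn y ty; have := rate_mul w s ty; rewrite !vE; nra.
have tie y : h t < h y -> rate w s t y = r -> is_max w (s + r) y.
  move=> ty ry k; have := mt k; suff : vl w (s + r) y = vl w (s + r) t by lra.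
  by have := rate_mul w s ty; rewrite ry !vE; lra.
have nt y : h t < h y -> t <> y by move=> ty E'; move: ty; rewrite E'; lra.
have [a [b [ab ba bb ma mb]]] := tree (nt p tp) pz (nt z tz) mt (tie p tp erefl) (tie z tz E).
have bad y : base y -> is_max w (s + r) y -> y = t.
  move=> by0 my; apply: NNPP => yt; have ht := h_ge0 t.
  by have := lowmax y; rewrite by0 => /(_ ht yt); have := my t; lra.
by apply: ab; rewrite (bad a) // (bad b).
Qed.

Definition mixw a b w w' := add3 (scl3 a w) (scl3 b w').
Lemma vl_mix a b w w' s s' i : vl (mixw a b w w') (a * s + b * s') i = a * vl w s i + b * vl w' s' i.
Proof. rewrite /vl /mixw LD !LZ; ring. Qed.

Lemma rate_mix a b w w' s s' t z : h t < h z ->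
  rate (mixw a b w w') (a * s + b * s') t z = a * rate w s t z + b * rate w' s' t z.
Proof. by move=> tz; rewrite /rate !vl_mix; field; lra. Qed.

Lemma uniq_mix a b w w' s s' t : 0 <= a -> 0 <= b -> 0 < a + b -> uniq_max w s t -> uniq_max w' s' t ->
  uniq_max (mixw a b w w') (a * s + b * s') t.
Proof.
move=> a0 b0 ab u u' j jt; rewrite !vl_mix; have := u j jt; have := u' j jt => l1 l2.
by have [a1|a1] := Rle_lt_dec a 0; [have -> : a = 0 by lra|]; nra.
Qed.

Lemma uniq_mix_max a b w w' s s' t : 0 <= a -> 0 < b -> is_max w s t -> uniq_max w' s' t ->
  uniq_max (mixw a b w w') (a * s + b * s') t.
Proof.
move=> a0 b0 u u' j jt; rewrite !vl_mix; have l1 := u j; have l2 := u' j jt.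
by have := Rmult_le_compat_l a _ _ a0 l1; have := Rmult_lt_compat_l b _ _ b0 l2; lra.
Qed.

(* The vertex reached next does not depend on the functional: the functionals maximised
   exactly at t form a convex set, on which a change of successor would produce a tie. *)
Lemma next_exists t : nontop t -> exists p, h t < h p /\
  forall w s z, uniq_max w s t -> h t < h z -> p <> z -> rate w s t p < rate w s t z.
Proof.
move=> nt; have [w0 [s0 u0]] := strict t.
have [p [tp pmin]] := fin_argmin (rate w0 s0 t) nt.
exists p; split=> // w s z u tz pz; apply: Rnot_le_lt => le.
pose D y := rate w0 s0 t y - rate w0 s0 t p; pose D1 y := rate w s t y - rate w s t p.
have D0 y : h t < h y -> p <> y -> 0 < D y.
  move=> ty py; apply: Rnot_le_lt => le'.
  by apply: (rate_min_unique u0 tp ty py pmin); rewrite /D in le'; lra.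
(* The point on the segment between the two functionals at which [y] ties with [p]; [z0] is the
   vertex with the earliest such tie. *)
pose lam y := D y / (D y - D1 y).
have [z0 [[tz0 [pz0 neg0]] zmin]] : exists z0, (h t < h z0 /\ p <> z0 /\ D1 z0 <= 0) /\
    forall y, h t < h y /\ p <> y /\ D1 y <= 0 -> lam z0 <= lam y.
  by apply: fin_argmin; exists z; rewrite /D1; split=> //; split=> //; lra.
have d0 := D0 _ tz0 pz0.
have lz : lam z0 * (D z0 - D1 z0) = D z0 by rewrite /lam; field; lra.
have l0 : 0 < lam z0 <= 1 by split; nra.
have um : uniq_max (mixw (1 - lam z0) (lam z0) w0 w) ((1 - lam z0) * s0 + lam z0 * s) t.
  by apply: uniq_mix => //; lra.
apply: (rate_min_unique um tp tz0 pz0).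
  move=> y ty; rewrite !rate_mix //.
  have [->|py] := classic (p = y); first lra.
  suff : 0 <= (1 - lam z0) * D y + lam z0 * D1 y by rewrite /D /D1; lra.
  have dy := D0 _ ty py.
  have [n1|p1] := Rle_lt_dec (D1 y) 0; last by nra.
  have ly : lam y * (D y - D1 y) = D y by rewrite /lam; field; lra.
  have := zmin y (conj ty (conj py n1)); nra.
by rewrite !rate_mix //; move: lz; rewrite /D /D1; nra.
Qed.

Definition next t := epsilon (inhabits t) (fun p => if pb (nontop t) then h t < h p /\
  forall w s z, uniq_max w s t -> h t < h z -> p <> z -> rate w s t p < rate w s t z else p = t).

Lemma nextP t : nontop t -> h t < h (next t) /\
  forall w s z, uniq_max w s t -> h t < h z -> next t <> z -> rate w s t (next t) < rate w s t z.
Proof.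
move=> nt; have [p pP] := next_exists nt; rewrite /next; have nt' : pb (nontop t) by apply/pbP.
rewrite nt'; apply: (epsilon_spec (inhabits t) (fun p => h t < h p /\
  forall w s z, uniq_max w s t -> h t < h z -> p <> z -> rate w s t p < rate w s t z)).
by exists p.
Qed.

Lemma next_top t : ~ nontop t -> next t = t.
Proof.
move=> nt; rewrite /next; have -> : pb (nontop t) = false by apply/negbTE/negP => /pbP.
by apply: (epsilon_spec (inhabits t) (fun p => p = t)); exists t.
Qed.

(** The closed form of [nextP]: otherwise adding the multiple [b] of a functional strictly maximal
    at [t] makes the rates of [z] and [next t] equal, against strictness. *)
Lemma next_rate_le w s t z : nontop t -> is_max w s t -> h t < h z -> rate w s t (next t) <= rate w s t z.
Proof.
move=> nt m tz; have [tp H] := nextP nt; have [w0 [s0 u0]] := strict t.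
have [E|ne] := classic (next t = z); first by rewrite E; lra.
apply: Rnot_lt_le => lt.
have := H w0 s0 z u0 tz ne => l0.
pose b := (rate w s t (next t) - rate w s t z) / (rate w0 s0 t z - rate w0 s0 t (next t)).
have b0 : 0 < b by apply: Rdiv_lt_0_compat; lra.
have bE : b * (rate w0 s0 t z - rate w0 s0 t (next t)) = rate w s t (next t) - rate w s t z.
  by rewrite /b; field; lra.
have um := uniq_mix_max (ltac:(lra) : 0 <= 1) b0 m u0.
by have := H _ _ z um tz ne; rewrite !rate_mix //; nra.
Qed.

Definition above_eq x y := fconnect next x y.

Lemma above_height a b : above_eq a b -> a = b \/ h a < h b.
Proof.
move=> ab; apply: (connect_inv (P := fun b => a = b \/ h a < h b)) ab _; last by left.
move=> y z /eqP <- ay; have [nt|nt] := classic (nontop y).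
  by have [lt _] := nextP nt; right; case: ay => [->|]; lra.
by rewrite next_top.
Qed.

Lemma above_total a b c : above_eq a b -> above_eq a c -> above_eq b c \/ above_eq c b.
Proof.
move=> /iter_findex <- /iter_findex <-; move: (findex _ _ _) (findex _ _ _) => i j.
by case: (leqP i j) => [/subnK <-|/ltnW/subnK <-]; rewrite iterD /above_eq; [right|left]; apply: fconnect_iter.
Qed.

Lemma above_next a b : above_eq a b -> a <> b -> above_eq (next a) b.
Proof.
case/connectP=> -[|c p] /=; first by move=> _ ->.
by case/andP=> /eqP-> pc lc _; apply/connectP; exists p.
Qed.

Definition visible w t := exists s, uniq_max w s t.

Lemma finite_vl_small w w' s s' t : uniq_max w s t ->
  exists2 d, 0 < d & forall e, 0 <= e <= d -> uniq_max (add3 w (scl3 e w')) (s + e * s') t.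
Proof.
move=> u.
have [||d d0 H] := @fin_small 'I_n (fun j d => forall e, 0 <= e <= d -> j <> t ->
  vl (add3 w (scl3 e w')) (s + e * s') j < vl (add3 w (scl3 e w')) (s + e * s') t).
- by move=> j d d' dd H e e0 jt; apply: H => //; lra.
- move=> j; have vE e i : vl (add3 w (scl3 e w')) (s + e * s') i = vl w s i + e * vl w' s' i.
    by rewrite /vl LD LZ; ring.
  have [->|jt] := classic (j = t); first by exists 1; [lra|].
  have gap := u j jt; set g := vl w s t - vl w s j.
  set k := Rabs (vl w' s' j - vl w' s' t) + 1.
  have k0 : 0 < k by have := Rabs_pos (vl w' s' j - vl w' s' t); rewrite /k; lra.
  exists (g / (2 * k)); first by apply: Rdiv_lt_0_compat; rewrite /g; lra.
  move=> e [e0 ed] _; rewrite !vE.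
  have : e * (2 * k) <= g.
    by have := Rmult_le_compat_r (2 * k) _ _ ltac:(lra) ed; rewrite /Rdiv Rmult_assoc Rinv_l; lra.
  have := Rle_abs (vl w' s' j - vl w' s' t); rewrite /k /g in k0 *; nra.
by exists d => // e e0 j jt; apply: H.
Qed.

Lemma uniq_tilt w s t d : 0 <= d -> uniq_max w s t ->
  (forall z, h t < h z -> d < rate w s t z) -> uniq_max w (s + d) t.
Proof.
move=> d0 u H j jt; rewrite !vl_tilt; have := u j jt => lt.
have [le|gt] := Rle_lt_dec (h j) (h t); first by nra.
have := H j gt; have := rate_mul w s gt; nra.
Qed.

Lemma next_visible_after w s t eps : nontop t -> uniq_max w s t -> 0 < eps ->
  exists2 e, 0 < e <= eps & uniq_max w (s + rate w s t (next t) + e) (next t).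
Proof.
move=> nt u eps0; have [tp H] := nextP nt; set p := next t in tp H *.
set r := rate w s t p; have r0 : 0 < r by apply: rate_pos.
have vp : vl w (s + r) p = vl w (s + r) t by have := rate_mul w s tp; rewrite !vl_tilt -/r; lra.
have low j : j <> t -> j <> p -> vl w (s + r) j < vl w (s + r) t.
  move=> jt jp; rewrite !vl_tilt; have := u j jt => lt.
  have [le|gt] := Rle_lt_dec (h j) (h t); first by nra.
  have := H w s j u gt (fun E => jp (esym E)); rewrite -/r; have := rate_mul w s gt; nra.
have [||d d0 D] := @fin_small 'I_n (fun j d => forall e, 0 < e <= d -> j <> p ->
  vl w (s + r + e) j < vl w (s + r + e) p).
- by move=> j d d' dd D e e0 jp; apply: D => //; lra.
- move=> j; have [->|jp] := classic (j = p); first by exists 1; [lra|].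
  have [jt|jt] := classic (j = t).
    by subst j; exists 1; [lra|] => e e0 _; rewrite (vl_tilt w (s + r) e t) (vl_tilt w (s + r) e p) vp; nra.
  have gap := low j jt jp; set k := h j + 1; have k0 : 0 < k by have := h_ge0 j; rewrite /k; lra.
  set g := vl w (s + r) t - vl w (s + r) j.
  exists (g / k); first by apply: Rdiv_lt_0_compat; rewrite /g; lra.
  move=> e [e0 ed] _; rewrite !(vl_tilt w (s + r) e) vp.
  have : e * k <= g.
    by have := Rmult_le_compat_r k _ _ ltac:(lra) ed; rewrite /Rdiv Rmult_assoc Rinv_l; lra.
  have := h_ge0 p; have := h_ge0 t; have := h_ge0 j; rewrite /k /g; nra.
have m0 := Rmin_pos _ _ d0 eps0; have ml := Rmin_l d eps; have mr := Rmin_r d eps.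
by exists (Rmin d eps); [lra|] => j jp; apply: D => //; lra.
Qed.

(** A tilt just past the moment when the successor catches up leaves the successor alone at the
    maximum; hence the cones of visibility grow along the forest. *)
Lemma visible_above w a b : visible w a -> above_eq a b -> visible w b.
Proof.
move=> va ab; apply: (connect_inv (P := visible w)) ab va => y z /eqP <- [s u].
have [nt|nt] := classic (nontop y); last by rewrite next_top //; exists s.
by have [e _ u'] := next_visible_after nt u Rlt_0_1; exists (s + rate w s y (next y) + e).
Qed.

Lemma uniq_max_eq w s i j : uniq_max w s i -> is_max w s j -> i = j.
Proof. by move=> u m; apply: NNPP => ne; have := u j (fun E => ne (esym E)); have := m i; lra. Qed.

(** While the tilt grows from [s] to [s'] the maximum passes from a vertex only to its successor.
    The induction is on the number of higher vertices. *)
Lemma visible_later w s s' a t : uniq_max w s a -> uniq_max w s' t -> s <= s' -> above_eq a t.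
Proof.
pose N a := #|[set z | pb (h a < h z)]|.
elim: {a}(N a).+1 {-2}a s (ltnSn (N a)) => // m IH a s Na u u' ss.
have [E|ne] := classic (a = t); first by rewrite E; apply: connect0.
have [nt|nt] := classic (nontop a); last first.
  case: ne; apply: (@uniq_max_eq w s') => [|j]; last exact: uniq_is_max u' j.
  rewrite (_ : s' = s + (s' - s)); last by ring.
  by apply: uniq_tilt => //; [lra|move=> z az; case: nt; exists z].
have [tp H] := nextP nt; set r := rate w s a (next a).
have r0 : 0 < r by apply: rate_pos.
have [lt|ge] := Rlt_le_dec (s' - s) r.
  case: ne; apply: (@uniq_max_eq w s') => [|j]; last exact: uniq_is_max u' j.
  rewrite (_ : s' = s + (s' - s)); last by ring.
  apply: uniq_tilt => //; first lra.
  move=> z az; have [<-//|np] := classic (next a = z).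
  by have := H w s z u az np; rewrite -/r; lra.
have [E|gt] : s' = s + r \/ s + r < s' by lra.
  have vE : vl w s' (next a) = vl w s' a by rewrite E !vl_tilt; have := rate_mul w s tp; rewrite -/r; lra.
  have na : next a <> a by move=> E'; rewrite E' in tp; lra.
  have [ta|nta] := classic (next a = t).
    by have := u' a ne; rewrite -ta; lra.
  have := u' a ne; have := u' _ nta; move=> l1 l2.
  have b1 : vl w s' t <= vl w s' a; last lra.
  have [le|gt] := Rle_lt_dec (h t) (h a).
    by have := u t (fun E' => ne (esym E')); rewrite E !vl_tilt; nra.
  have := H w s t u gt nta; have := rate_mul w s gt; rewrite -/r E !vl_tilt; nra.
have [e e0 ue] := @next_visible_after w s a (s' - (s + r)) nt u ltac:(lra).
apply: (connect_trans (y := next a)); first by apply: connect1 => /=.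
apply: IH ue u' _; last by rewrite -/r; lra.
apply: leq_trans (_ : (N (next a) < N a)%N) Na; apply: proper_card; apply/properP; split.
  by apply/subsetP=> z; rewrite !inE => /pbP lt; apply/pbP; lra.
by exists (next a); rewrite inE; [apply/pbP|apply/negP => /pbP; lra].
Qed.

Lemma base_uniq_lower w s s' v : base v -> uniq_max w s v -> s' <= s -> uniq_max w s' v.
Proof.
move=> bv u ss j jv; have := u j jv; have hj := h_ge0 j; rewrite /vl bv; nra.
Qed.

Lemma visible_base_above w v t : base v -> visible w v -> visible w t -> above_eq v t.
Proof.
move=> bv [s u] [s' u']; apply: (visible_later (s := Rmin s s') _ u'); last exact: Rmin_r.
by apply: base_uniq_lower u (Rmin_l _ _).
Qed.

Definition base_max w v := base v /\ forall j, base j -> j <> v -> L w j < L w v.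

(** A sufficiently negative tilt pushes every vertex off the base below [v]. *)
Lemma base_max_visible w v : base_max w v -> visible w v.
Proof.
case=> bv bm.
have [||d d0 D] := @fin_small 'I_n (fun j d => forall s, s <= - / d -> j <> v -> vl w s j < vl w s v).
- move=> j d d' [d'0 dd] H s sd jv; apply: H => //.
  by have := Rinv_le_contravar _ _ d'0 dd; lra.
- move=> j; have [bj|nbj] := Req_dec (h j) 0.
    exists 1; first lra.
    by move=> s _ jv; rewrite /vl bj bv; have := bm j bj jv; lra.
  have hj : 0 < h j by have := h_ge0 j; lra.
  set k := Rabs (L w j - L w v) + 1; have k0 : 0 < k by have := Rabs_pos (L w j - L w v); rewrite /k; lra.
  exists (h j / k); first exact: Rdiv_lt_0_compat.
  move=> s; rewrite Rinv_div => sd _; rewrite /vl bv.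
  have : s * h j <= - k.
    have := Rmult_le_compat_r (h j) _ _ ltac:(lra) sd.
    by rewrite (_ : - (k / h j) * h j = - k) //; field; lra.
  have := Rle_abs (L w j - L w v); rewrite /k; lra.
by exists (- / d) => j jv; apply: D => //; lra.
Qed.

Lemma visible_base_max w v : base v -> visible w v -> base_max w v.
Proof.
move=> bv [s u]; split=> // j bj jv; have := u j jv; rewrite /vl bj bv; lra.
Qed.

Lemma visible_add a b w w' t : 0 <= a -> 0 <= b -> 0 < a + b -> visible w t -> visible w' t ->
  visible (mixw a b w w') t.
Proof. by move=> a0 b0 ab [s u] [s' u']; exists (a * s + b * s'); apply: uniq_mix. Qed.

Lemma visible_open w w' t : visible w t -> exists2 d, 0 < d & forall e, 0 <= e <= d -> visible (add3 w (scl3 e w')) t.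
Proof.
case=> s /(finite_vl_small w' 0) [d d0 H]; exists d => // e e0; exists (s + e * 0); exact: H.
Qed.

(** A small perturbation keeps both vertices visible and makes some base vertex the only maximum on
    the base; both vertices then lie on the chain above it. *)
Lemma visible_comparable w t t' : visible w t -> visible w t' -> above_eq t t' \/ above_eq t' t.
Proof.
move=> vt vt'.
have [b0 [_ [_ bb0 _]]] := has_base.
have [v [bv vmax]] : exists v, base v /\ forall j, base j -> - L w v <= - L w j by apply: fin_argmin; exists b0.
have [w0 [s0 u0]] := strict v.
have [d d0 H] := visible_open w0 vt; have [d' d'0 H'] := visible_open w0 vt'.
have m0 := Rmin_pos _ _ d0 d'0; have ml := Rmin_l d d'; have mr := Rmin_r d d'.
have vv : visible (add3 w (scl3 (Rmin d d') w0)) v.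
  apply: base_max_visible; split=> // j bj jv; rewrite !LD !LZ.
  have := vmax j bj; have := u0 j jv; rewrite /vl bj bv; nra.
have a := visible_base_above bv vv (H (Rmin d d') ltac:(lra)); have a' := visible_base_above bv vv (H' (Rmin d d') ltac:(lra)).
exact: above_total a a'.
Qed.

Definition base_edge w u v := [/\ u <> v, base u, base v, L w u = L w v &
  forall j, base j -> j <> u -> j <> v -> L w j < L w u].

Lemma base_edge_sym w u v : base_edge w u v -> base_edge w v u.
Proof. by case=> uv bu bv E H; split=> // [|j bj j1 j2]; [move=> e; apply: uv|rewrite -E; apply: H]. Qed.

Lemma base_edge_visible w u v t : base_edge w u v -> visible w t -> above_eq u t.
Proof.
case=> uv bu bv E H vt; have [w0 [s0 u0]] := strict u.
have [d d0 D] := visible_open w0 vt.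
apply: (visible_base_above (w := add3 w (scl3 d w0)) bu _ (D d ltac:(lra))).
apply: base_max_visible; split=> // j bj ju; rewrite !LD !LZ.
have := u0 j ju; rewrite /vl bj bu => lt.
by have [->|jv] := classic (j = v); [rewrite E; have := u0 v (fun e => uv (esym e)); rewrite /vl bu bv; nra|have := H j bj ju jv; nra].
Qed.

(** [w] is the midpoint of two functionals whose only base maxima are [u] and [v]. Both see [t], and
    the functionals that see [t] form a convex cone. *)
Lemma base_edge_below w u v t : base_edge w u v -> above_eq u t -> above_eq v t -> visible w t.
Proof.
case=> uv bu bv E H ut vt; have [w0 [s0 u0]] := strict u.
have gap : L w0 v < L w0 u by have := u0 v (fun e => uv (esym e)); rewrite /vl bu bv; lra.
have [||d d0 D] := @fin_small 'I_n (fun j d => forall e, 0 < e <= d -> base j -> j <> u -> j <> v ->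
    L w j - e * L w0 j < L w v - e * L w0 v).
- by move=> j d d' dd D e e0; apply: D; lra.
- move=> j; have [[bj [ju jv]]|nj] := classic (base j /\ j <> u /\ j <> v); last first.
    by exists 1; [lra|] => e _ bj ju jv; case: nj.
  set g := L w v - L w j; have g0 : 0 < g by have := H j bj ju jv; rewrite /g; lra.
  set k := Rabs (L w0 v - L w0 j) + 1; have k0 : 0 < k by have := Rabs_pos (L w0 v - L w0 j); rewrite /k; lra.
  exists (g / (2 * k)); first by apply: Rdiv_lt_0_compat; lra.
  move=> e [e0 ed] _ _ _.
  have : e * (2 * k) <= g.
    by have := Rmult_le_compat_r (2 * k) _ _ ltac:(lra) ed; rewrite /Rdiv Rmult_assoc Rinv_l; lra.
  have := Rle_abs (L w0 v - L w0 j); rewrite /k /g in k0 *; nra.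
have vu : visible (add3 w (scl3 d w0)) u.
  apply: base_max_visible; split=> // j bj ju; rewrite !LD !LZ.
  have := u0 j ju; rewrite /vl bj bu => lt.
  by have [->|jv] := classic (j = v); [rewrite E; nra|have := H j bj ju jv; nra].
have vv : visible (add3 w (scl3 (- d) w0)) v.
  apply: base_max_visible; split=> // j bj jv; rewrite !LD !LZ.
  have [->|ju] := classic (j = u); first by rewrite E; nra.
  by have := D j d ltac:(lra) bj ju jv; lra.
have := visible_add (ltac:(lra) : 0 <= / 2) (ltac:(lra) : 0 <= / 2) (ltac:(lra) : 0 < / 2 + / 2) (visible_above vu ut) (visible_above vv vt).
case=> s um; exists s => j jt; have := um j jt; rewrite /vl /mixw !LD !LZ !LD !LZ; lra.
Qed.

Lemma rate_ge0 w s t z : is_max w s t -> h t < h z -> 0 <= rate w s t z.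
Proof. by move=> m tz; have := rate_mul w s tz; have := m z; nra. Qed.

Lemma next_is_max w s t : nontop t -> is_max w s t ->
  is_max w (s + rate w s t (next t)) t /\ is_max w (s + rate w s t (next t)) (next t).
Proof.
move=> nt m; have [tp _] := nextP nt; have r0 := rate_ge0 m tp; set r := rate w s t (next t) in r0 *.
have e := rate_mul w s tp; rewrite -/r in e.
suff mt : is_max w (s + r) t.
  by split=> // k; have := mt k; rewrite !vl_tilt; lra.
move=> k; rewrite !vl_tilt; have mk := m k.
have [le|gt] := Rle_lt_dec (h k) (h t); first nra.
have := next_rate_le nt m gt; rewrite -/r; have := rate_mul w s gt; nra.
Qed.

(** A higher vertex on the same face has rate 0, and the successor of [t] has the least rate. *)
Lemma next_max_of_higher w s t z : is_max w s t -> is_max w s z -> h t < h z -> is_max w s (next t).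
Proof.
move=> mt mz tz; have nt : nontop t by exists z.
have [tp _] := nextP nt; have := next_rate_le nt mt tz; have := rate_ge0 mt tp.
have -> : rate w s t z = 0.
  by rewrite /rate (_ : vl w s t - vl w s z = 0); [rewrite /Rdiv Rmult_0_l|have := mt z; have := mz t; lra].
move=> r0 r1; have [_] := next_is_max nt mt.
by rewrite (_ : rate w s t (next t) = 0) ?Rplus_0_r //; lra.
Qed.

(** Under further tilting [i] and [j] stay level and are caught together by [next i]. The resulting
    face with three vertices contains a base vertex, which is lower than [i] and so would have been
    maximal before the tilt. *)
Lemma no_level_edge w s i j : is_max w s i -> is_max w s j -> i <> j -> h i = h j -> 0 < h i -> nontop i ->
  (forall q, base q -> ~ is_max w s q) -> False.
Proof.
move=> mi mj ij hij hi nt nb; have [tp _] := nextP nt.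
have [mi' mp] := next_is_max nt mi; have r0 := rate_ge0 mi tp.
set r := rate w s i (next i) in mi' mp r0.
have mj' : is_max w (s + r) j.
  by move=> k; have := mi' k; rewrite !vl_tilt; have := mj i; rewrite hij; lra.
have ni : i <> next i by move=> e; rewrite -e in tp; lra.
have nj : j <> next i by move=> e; rewrite -e in tp; lra.
have [p [q [_ bp _ mp' _]]] := tree ij nj ni mi' mj' mp.
apply: (nb p bp) => k; have := mp' i; rewrite !vl_tilt bp; have := mi k; nra.
Qed.

(** With [edge_level] this classifies the edges of the polytope: an edge between different heights
    joins a vertex to its successor, and a level edge below the top lies in the base. *)
Lemma edge_next w s i j : is_max w s i -> is_max w s j -> (forall k, is_max w s k -> k = i \/ k = j) ->
  h i < h j -> next i = j.
Proof.
move=> mi mj H ij; have nt : nontop i by exists j.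
have [tp _] := nextP nt; case: (H _ (next_max_of_higher mi mj ij)) => // E.
by rewrite E in tp; lra.
Qed.

Lemma edge_level w s i j : i <> j -> is_max w s i -> is_max w s j ->
  (forall k, is_max w s k -> k = i \/ k = j) -> h i = h j -> nontop i -> base_edge w i j.
Proof.
move=> ij mi mj H hij nt.
have [bi|nbi] := Req_dec (h i) 0; last first.
  have hi := h_ge0 i; case: (@no_level_edge w s i j) => //; first lra.
  by move=> q bq /H[E|E]; rewrite E in bq; apply: nbi; rewrite // hij.
have bj : base j by rewrite /base -hij.
have E : L w i = L w j by have := mi j; have := mj i; rewrite /vl bi bj; lra.
split=> // k bk ki kj; apply: Rnot_le_lt => le.
have : is_max w s k by move=> l; have := mi l; rewrite /vl bi bk; lra.
by case/H.
Qed.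

(** The tilt is chosen so that the maximum on the base is just reached by vertices off the base;
    among base vertices only [u] and [v] stay maximal. *)
Lemma base_edge_face w u v : base_edge w u v -> exists s, [/\ is_max w s u, is_max w s v,
  exists z, 0 < h z /\ is_max w s z & forall q, base q -> is_max w s q -> q = u \/ q = v].
Proof.
case=> uv bu bv E H.
have [z [z0 zmin]] := fin_argmin (rate w 0 u) has_apex.
have uz y : 0 < h y -> h u < h y by rewrite bu.
set s := rate w 0 u z in zmin.
have ez := rate_mul w 0 (uz z z0); rewrite -/s in ez.
have vE y : vl w s y = vl w 0 y + s * h y by rewrite /vl; lra.
have mu : is_max w s u.
  move=> y; have [by0|nby] := Req_dec (h y) 0.
    rewrite /vl by0 bu; have [->|yu] := classic (y = u); first lra.
    by have [->|yv] := classic (y = v); [rewrite E; lra|have := H y by0 yu yv; lra].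
  have y0 : 0 < h y by have := h_ge0 y; lra.
  have := zmin y y0; have := rate_mul w 0 (uz y y0); rewrite !vE bu; nra.
exists s; split=> //.
- by move=> y; have := mu y; rewrite /vl bu bv; lra.
- by exists z; split=> // y; have := mu y; rewrite !vE bu in ez *; lra.
- move=> q bq mq; apply: NNPP => nq; have := H q bq (fun e => nq (or_introl e)) (fun e => nq (or_intror e)).
  by have := mq u; rewrite /vl bu bq; lra.
Qed.

Lemma tilt_from_face w s t : is_max w s t -> (forall y, is_max w s y -> h y <= h t) ->
  exists2 e, 0 < e & forall k, vl w (s + e) k < vl w (s + e) t \/ (is_max w s k /\ h k = h t).
Proof.
move=> mt top.
have [||d d0 D] := @fin_small 'I_n (fun k d => forall e, 0 < e <= d ->
  vl w (s + e) k < vl w (s + e) t \/ (is_max w s k /\ h k = h t)).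
- by move=> k d d' dd D e e0; apply: D; lra.
- move=> k; have [mk|nk] := classic (is_max w s k).
    exists 1; first lra.
    move=> e e0; have hk := top k mk; have [E|ne] := Req_dec (h k) (h t); first by right.
    by left; rewrite !vl_tilt; have := mt k; nra.
  set g := vl w s t - vl w s k; have g0 : 0 < g.
    apply: Rnot_le_lt => le; apply: nk => l; have := mt l; rewrite /g in le; lra.
  set m := h k + 1; have m0 : 0 < m by have := h_ge0 k; rewrite /m; lra.
  exists (g / m); first by apply: Rdiv_lt_0_compat.
  move=> e [e0 ed]; left; rewrite !vl_tilt.
  have : e * m <= g.
    by have := Rmult_le_compat_r m _ _ ltac:(lra) ed; rewrite /Rdiv Rmult_assoc Rinv_l; lra.
  have := h_ge0 t; have := h_ge0 k; rewrite /m /g; nra.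
by exists d => // k; apply: D; lra.
Qed.

(** If the face held no vertex higher than [t], a slight tilt would expose its top level. Were [t]
    alone there it would be visible from [w], hence above [v]; a companion at the same height is
    excluded by [no_level_edge]. *)
Lemma face_next w s u v t : base_edge w u v -> (exists z, 0 < h z /\ is_max w s z) ->
  nontop t -> is_max w s t -> ~ above_eq v t -> is_max w s (next t).
Proof.
move=> uv [z [z0 mz]] nt mt nvt.
have [[y [my ty]]|top] := classic (exists y, is_max w s y /\ h t < h y).
  exact: next_max_of_higher mt my ty.
exfalso; have top' y : is_max w s y -> h y <= h t.
  by move=> my; apply: Rnot_lt_le => lt; apply: top; exists y.
have t0 : 0 < h t by have := top' z mz; lra.
have [e e0 D] := tilt_from_face mt top'.
have mte : is_max w (s + e) t.
  by move=> k; case: (D k) => [|[mk hk]]; [lra|rewrite !vl_tilt hk; have := mt k; lra].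
have [[y [yt [my hy]]]|alone] := classic (exists y, y <> t /\ is_max w s y /\ h y = h t).
  apply: (@no_level_edge w (s + e) t y) => //.
  - by move=> k; have := mte k; rewrite !vl_tilt hy; have := my t; lra.
  - by move=> E; apply: yt.
  - by move=> q bq mq; have := mq t; rewrite !vl_tilt bq; have := mt q; nra.
apply: nvt; apply: base_edge_visible (base_edge_sym uv) _; exists (s + e) => j jt.
by case: (D j) => // -[mj hj]; case: alone; exists j.
Qed.

Lemma chain_in_face w s u v t : base_edge w u v -> is_max w s u -> (exists z, 0 < h z /\ is_max w s z) ->
  above_eq u t -> ~ above_eq v t -> is_max w s t.
Proof.
move=> uv mu ex ut.
apply: (connect_inv (P := fun z => ~ above_eq v z -> is_max w s z)) ut _ => // a b /eqP <- Ha nvb.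
have nva : ~ above_eq v a by move=> va; apply: nvb; apply: connect_trans va _; apply: connect1 => /=.
have [nt|nt] := classic (nontop a); last by rewrite next_top //; apply: Ha.
exact: face_next uv ex nt (Ha nva) nva.
Qed.

(* Two base edges leaving the cluster of t from the same child y would span a common face
   containing y, t and next t, hence two base vertices. *)
Lemma base_edges_sparse w w' u v u' v' y : base_edge w u v -> base_edge w' u' v' ->
  nontop y -> nontop (next y) -> above_eq u y -> above_eq u' y ->
  ~ above_eq v (next y) -> ~ above_eq v' (next y) -> u = u' /\ v = v'.
Proof.
move=> uv uv' ny nt uy uy' nv nv'.
have [s [mu mv ex only]] := base_edge_face uv; have [s' [mu' mv' ex' only']] := base_edge_face uv'.
have yt : above_eq y (next y) by apply: connect1 => /=.
have up a : ~ above_eq a (next y) -> ~ above_eq a y by move=> na ay; apply: na; apply: connect_trans ay yt.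
have tri w0 s0 u0 v0 : base_edge w0 u0 v0 -> is_max w0 s0 u0 -> (exists z, 0 < h z /\ is_max w0 s0 z) ->
    above_eq u0 y -> ~ above_eq v0 (next y) -> [/\ is_max w0 s0 y, is_max w0 s0 (next y) & is_max w0 s0 (next (next y))].
  move=> e m x0 a na; have mt : is_max w0 s0 (next y) by apply: chain_in_face e m x0 (connect_trans a yt) na.
  split=> //; first exact: chain_in_face e m x0 a (up _ na).
  exact: face_next e x0 nt mt na.
have [m1 m2 m3] := tri _ _ _ _ uv mu ex uy nv; have [m1' m2' m3'] := tri _ _ _ _ uv' mu' ex' uy' nv'.
(* The sum of the two functionals exposes the intersection of the two faces; its two base vertices
   must be the ends of both base edges. *)
have msum k : is_max w s k -> is_max w' s' k -> is_max (mixw 1 1 w w') (1 * s + 1 * s') k.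
  by move=> a b l; rewrite !vl_mix; have := a l; have := b l; lra.
have [l1 _] := nextP ny; have [l2 _] := nextP nt.
have ne a b : h a < h b -> a <> b by move=> lt E; rewrite E in lt; lra.
have [p [q [pq bp bq mp mq]]] := tree (ne _ _ l1) (ne _ _ l2) (ne y (next (next y)) ltac:(lra))
  (msum _ m1 m1') (msum _ m2 m2') (msum _ m3 m3').
have back k : is_max (mixw 1 1 w w') (1 * s + 1 * s') k -> is_max w s k /\ is_max w' s' k.
  move=> mk; have e1 : vl w s k = vl w s y by have := mk y; rewrite !vl_mix; have := m1 k; have := m1' k; lra.
  have e2 : vl w' s' k = vl w' s' y by have := mk y; rewrite !vl_mix; have := m1 k; have := m1' k; lra.
  by split=> l; rewrite ?e1 ?e2.
have [p1 p2] := back p mp; have [q1 q2] := back q mq.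
have bad : v = u' -> False by move=> e; apply: nv; rewrite e; apply: connect_trans uy' yt.
have bad' : u = v' -> False by move=> e; apply: nv'; rewrite -e; apply: connect_trans uy yt.
by case: (only p bp p1) => e1; case: (only' p bp p2) => e2; case: (only q bq q1) => e3; case: (only' q bq q2) => e4;
  subst; try (by split); try (by case: pq); try (by case: bad); case: bad'.
Qed.
End Shadow.

(** * Stereographic projection *)

Definition norm3 (c : vec3) : R := sqrt (dot3 c c).

(* Stereographic projection from (0,0,1) of the ray through c; it is undefined exactly on
   the ray through the pole. *)
Definition proj (c : vec3) : pt := (c.1.1 / (norm3 c - c.2), c.1.2 / (norm3 c - c.2)).
Definition on_pole (c : vec3) := c.1.1 = 0 /\ c.1.2 = 0 /\ 0 <= c.2.

Lemma dot3_ge0 c : 0 <= dot3 c c. Proof. rewrite /dot3; nra. Qed.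
Lemma norm3_sq c : norm3 c * norm3 c = dot3 c c. Proof. exact: sqrt_sqrt (dot3_ge0 c). Qed.
Lemma norm3_ge0 c : 0 <= norm3 c. Proof. exact: sqrt_pos. Qed.

Lemma proj_den c : ~ on_pole c -> 0 < norm3 c - c.2.
Proof.
move=> np; have := norm3_sq c; have := norm3_ge0 c; rewrite /dot3; move: (norm3 c) => r r0 e.
apply: Rnot_le_lt => le; apply: np; have z0 : 0 <= c.2 by lra.
have : c.1.1 * c.1.1 + c.1.2 * c.1.2 <= 0 by nra.
by move=> h; split; [nra|split; [nra|]].
Qed.

Lemma scl3K k k' c : scl3 k (scl3 k' c) = scl3 (k * k') c.
Proof. by rewrite /scl3 /=; congr (_, _, _); ring. Qed.

Lemma scl31 c : scl3 1 c = c.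
Proof. by case: c => [[? ?] ?]; rewrite /scl3 /=; congr (_, _, _); ring. Qed.

(** The inverse of stereographic projection, up to a positive factor. *)
Lemma proj_param c : ~ on_pole c -> c = scl3 (norm3 c - c.2)
  ((proj c).1, (proj c).2, ((proj c).1 * (proj c).1 + (proj c).2 * (proj c).2 - 1) / 2).
Proof.
move=> np; have D0 := proj_den np; have e := norm3_sq c; rewrite /dot3 in e.
rewrite /proj /scl3 /=; move: e D0; move: (norm3 c); case: c {np} => [[a b] z] /= r e D0.
congr (_, _, _); first by field; lra.
  by field; lra.
have -> : (r - z) * ((a / (r - z) * (a / (r - z)) + b / (r - z) * (b / (r - z)) - 1) / 2) =
  ((a * a + b * b) / (r - z) - (r - z)) / 2 by field; lra.
have -> : a * a + b * b = (r - z) * (r + z) by lra.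
by field; lra.
Qed.

Lemma proj_inj c c' : ~ on_pole c -> ~ on_pole c' -> proj c = proj c' -> exists2 k, 0 < k & c = scl3 k c'.
Proof.
move=> np np' E; have D := proj_den np; have D' := proj_den np'.
exists ((norm3 c - c.2) / (norm3 c' - c'.2)); first exact: Rdiv_lt_0_compat.
rewrite {1}(proj_param np) {3}(proj_param np') scl3K E; congr (scl3 _ _).
by field; lra.
Qed.

Lemma norm3_scl k c : 0 <= k -> norm3 (scl3 k c) = k * norm3 c.
Proof.
move=> k0; rewrite /norm3 (_ : dot3 (scl3 k c) (scl3 k c) = (k * k) * dot3 c c).
  by rewrite sqrt_mult ?sqrt_square //; [nra|exact: dot3_ge0].
rewrite /dot3 /scl3 /=; ring.
Qed.

Lemma proj_scl k c : 0 < k -> ~ on_pole c -> proj (scl3 k c) = proj c.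
Proof.
move=> k0 np; have D := proj_den np; rewrite /proj norm3_scl; last lra.
rewrite /scl3 /= -Rmult_minus_distr_l; congr pair; field; lra.
Qed.

Definition cont3 (c : R -> vec3) := forall t,
  [/\ continuity_pt (fun s => (c s).1.1) t, continuity_pt (fun s => (c s).1.2) t
    & continuity_pt (fun s => (c s).2) t].

Lemma continuity_pt_near f t : continuity_pt f t -> forall eps, 0 < eps ->
  exists2 d, 0 < d & forall s, Rabs (s - t) < d -> Rabs (f s - f t) < eps.
Proof.
move=> H eps e0; have [d [d0 hd]] := H eps e0; exists d => // s sd.
have [->|ne] := Req_dec s t; first by rewrite Rminus_diag Rabs_R0.
by apply: hd; split=> //; split=> //; apply: nesym.
Qed.

Lemma continuous01_pair f1 f2 :
  (forall t, 0 <= t <= 1 -> continuity_pt f1 t) -> (forall t, 0 <= t <= 1 -> continuity_pt f2 t) ->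
  continuous01 (fun t => (f1 t, f2 t)).
Proof.
move=> c1 c2; apply: continuous01_intro => t t01 eps e0 /=.
have [d1 d10 H1] := continuity_pt_near (c1 t t01) e0.
have [d2 d20 H2] := continuity_pt_near (c2 t t01) e0.
have ml := Rmin_l d1 d2; have mr := Rmin_r d1 d2.
by exists (Rmin d1 d2); [exact: Rmin_pos|move=> s _ sd; split; [apply: H1|apply: H2]; lra].
Qed.

Lemma proj_continuous c : cont3 c -> (forall t, 0 <= t <= 1 -> ~ on_pole (c t)) ->
  continuous01 (fun t => proj (c t)).
Proof.
move=> cc np.
have cn t : continuity_pt (fun s => norm3 (c s)) t.
  have [c1 c2 c3] := cc t.
  apply: (continuity_pt_comp (fun s => dot3 (c s) (c s)) sqrt).
    by rewrite /dot3; do 2 (apply: continuity_pt_plus; last exact: continuity_pt_mult); apply: continuity_pt_mult.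
  exact: continuity_pt_sqrt (dot3_ge0 _).
have cd t : continuity_pt (fun s => norm3 (c s) - (c s).2) t.
  by have [_ _ c3] := cc t; apply: continuity_pt_minus.
apply: continuous01_pair => t t01; have := proj_den (np t t01) => D; have [c1 c2 c3] := cc t.
  by apply: (continuity_pt_div (fun s => (c s).1.1) (fun s => norm3 (c s) - (c s).2)) => //; lra.
by apply: (continuity_pt_div (fun s => (c s).1.2) (fun s => norm3 (c s) - (c s).2)) => //; lra.
Qed.

Lemma continuity_pt_abs f t : continuity_pt f t -> continuity_pt (fun s => Rabs (f s)) t.
Proof. by move=> cf; apply: (continuity_pt_comp f Rabs) cf (Rcontinuity_abs _). Qed.

Lemma Rmax_abs a b : Rmax a b = (a + b + Rabs (a - b)) / 2.
Proof. by rewrite /Rmax; case: Rle_dec => ?; [rewrite Rabs_left1|rewrite Rabs_right]; lra. Qed.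

Lemma continuity_pt_max f g t : continuity_pt f t -> continuity_pt g t ->
  continuity_pt (fun s => Rmax (f s) (g s)) t.
Proof.
move=> cf cg; have -> : (fun s => Rmax (f s) (g s)) = (fun s => (f s + g s + Rabs (f s - g s)) * / 2).
  by apply: functional_extensionality => s; rewrite Rmax_abs.
apply: continuity_pt_mult; last exact: continuity_pt_const.
apply: continuity_pt_plus; first exact: continuity_pt_plus.
by apply: continuity_pt_abs; apply: continuity_pt_minus.
Qed.

Lemma continuity_pt_affine a b t : continuity_pt (fun s => a * s + b) t.
Proof.
apply: continuity_pt_plus; last exact: continuity_pt_const.
by apply: continuity_pt_mult; [exact: continuity_pt_const|exact: (derivable_continuous_pt _ _ (derivable_pt_id t))].
Qed.

(* The boundary of the square |a| + |b| = 1, run through once by the unit interval. *)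
Definition diamond_x s := Rabs (4 * s + - 2) - 1.
Definition diamond_y s := Rmax 0 (1 - Rabs (4 * s + - 1)) - Rmax 0 (1 - Rabs (4 * s + - 3)).

Lemma diamond_x_cont t : continuity_pt diamond_x t.
Proof.
apply: continuity_pt_minus; last exact: continuity_pt_const.
by apply: continuity_pt_abs; apply: continuity_pt_affine.
Qed.

Lemma diamond_y_cont t : continuity_pt diamond_y t.
Proof.
have H a : continuity_pt (fun s => Rmax 0 (1 - Rabs (4 * s + a))) t.
  apply: continuity_pt_max; first exact: continuity_pt_const.
  apply: continuity_pt_minus; first exact: continuity_pt_const.
  by apply: continuity_pt_abs; apply: continuity_pt_affine.
exact: continuity_pt_minus.
Qed.

Ltac unfold_abs := rewrite /Rmax; repeat case: Rle_dec; intros; split_Rabs; first [lra|nra].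

Lemma diamond_cases s : 0 <= s < 1 ->
  [\/ 0 <= s <= / 4 /\ diamond_x s = 1 - 4 * s /\ diamond_y s = 4 * s,
      / 4 <= s <= / 2 /\ diamond_x s = 1 - 4 * s /\ diamond_y s = 2 - 4 * s,
      / 2 <= s <= 3 / 4 /\ diamond_x s = 4 * s - 3 /\ diamond_y s = 2 - 4 * s
    | 3 / 4 <= s < 1 /\ diamond_x s = 4 * s - 3 /\ diamond_y s = 4 * s - 4].
Proof.
move=> s01; rewrite /diamond_x /diamond_y.
have [h1|h1] := Rle_lt_dec s (/ 2); have [h2|h2] := Rle_lt_dec s (/ 4); have [h3|h3] := Rle_lt_dec s (3 / 4); try lra.
- by constructor 1; unfold_abs.
- by constructor 2; unfold_abs.
- by constructor 3; unfold_abs.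
- by constructor 4; unfold_abs.
Qed.

Lemma diamond_nonzero s : 0 <= s < 1 -> diamond_x s <> 0 \/ diamond_y s <> 0.
Proof. by case/diamond_cases => -[i [-> ->]]; apply: NNPP => n; apply: n; [have [e|] := Req_dec (1 - 4 * s) 0|have [e|] := Req_dec (1 - 4 * s) 0|have [e|] := Req_dec (4 * s - 3) 0|have [e|] := Req_dec (4 * s - 3) 0]; (try by left); right; lra. Qed.

Lemma diamond_inj s s' k : 0 <= s < 1 -> 0 <= s' < 1 -> 0 < k ->
  diamond_x s = k * diamond_x s' -> diamond_y s = k * diamond_y s' -> s = s'.
Proof. by move=> /diamond_cases[] [i [-> ->]] /diamond_cases[] [i' [-> ->]] k0 e1 e2; nra. Qed.

Lemma diamond_surj a b : a <> 0 \/ b <> 0 -> exists s k, [/\ 0 <= s < 1, 0 < k, a = k * diamond_x s & b = k * diamond_y s].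
Proof.
move=> ab; pose k := Rabs a + Rabs b.
have k0 : 0 < k.
  by rewrite /k; have := Rabs_pos a; have := Rabs_pos b; case: ab => /Rabs_pos_lt; lra.
have use s : 0 <= s < 1 -> a = k * diamond_x s -> b = k * diamond_y s ->
  exists s k, [/\ 0 <= s < 1, 0 < k, a = k * diamond_x s & b = k * diamond_y s] by exists s, k.
pose u := Rabs b / k.
have u01 : 0 <= u <= 1.
  have e : u * k = Rabs b by rewrite /u; field; lra.
  by have := Rabs_pos a; have := Rabs_pos b; rewrite /k in e k0 *; split; nra.
have ub : k * u = Rabs b by rewrite /u; field; lra.
have ua : k * (1 - u) = Rabs a by rewrite Rmult_minus_distr_l ub /k; ring.
have [a0|a0] := Rle_lt_dec 0 a; have [b0|b0] := Rle_lt_dec 0 b.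
- rewrite Rabs_right in ua; last lra. rewrite Rabs_right in ub; last lra.
  by apply: (use (u / 4)); rewrite /diamond_x /diamond_y; [lra|unfold_abs|unfold_abs].
- rewrite Rabs_right in ua; last lra. rewrite Rabs_left in ub; last lra.
  have u0 : 0 < u by nra.
  by apply: (use (1 - u / 4)); rewrite /diamond_x /diamond_y; [lra|unfold_abs|unfold_abs].
- rewrite Rabs_left in ua; last lra. rewrite Rabs_right in ub; last lra.
  by apply: (use (/ 2 - u / 4)); rewrite /diamond_x /diamond_y; [lra|unfold_abs|unfold_abs].
- rewrite Rabs_left in ua; last lra. rewrite Rabs_left in ub; last lra.
  by apply: (use (/ 2 + u / 4)); rewrite /diamond_x /diamond_y; [lra|unfold_abs|unfold_abs].
Qed.

(** * The cluster drawing of a treetope *)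

Section SphereDrawing.
Variables (n : nat) (x : 'I_n -> vec3) (h : 'I_n -> R).
Hypothesis SH : shadow x h.
Local Notation LL := (L x).
Local Notation nx := (next x h).
Local Notation ab := (above_eq x h).
Local Notation vis := (visible x h).

(* t is visible from c exactly when c is maximised at t alone on the slice of the polytope
   at height h t; that slice is spanned by the vertices at this height and by the crossings
   of the segments joining a higher to a lower vertex. *)
Definition tri_form t (z : 'I_n * 'I_n) c :=
  if Req_EM_T (h z.1) (h t) then LL c t - LL c z.1
  else (h t - h z.2) * (LL c t - LL c z.1) + (h z.1 - h t) * (LL c t - LL c z.2).
Definition tri_ok t (z : 'I_n * 'I_n) := (h t < h z.1 /\ h z.2 < h t) \/ (h z.1 = h t /\ z.1 <> t).

Lemma tri_form_mix t z a b c c' : tri_form t z (mixw a b c c') = a * tri_form t z c + b * tri_form t z c'.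
Proof. by rewrite /tri_form /mixw !LD !LZ; case: Req_EM_T => e /=; ring. Qed.

Lemma base_exists : exists v, base h v.
Proof. by have [v [_ [_ bv _]]] := sh_base SH; exists v. Qed.

Definition inner t := 0 < h t /\ nontop h t.

(** Elimination of the tilt: lower vertices bound it from below and higher ones from above, and the
    forms say that every lower bound is smaller than every upper bound. The midpoint of the sharpest
    bounds is a suitable tilt. *)
Lemma visible_tri t c : inner t -> vis c t <-> forall z, tri_ok t z -> 0 < tri_form t z c.
Proof.
case=> t0 nt; split.
  case=> s u z; rewrite /tri_ok /tri_form => -[[h1 h2]|[h1 h2]]; case: Req_EM_T => e /=; try lra.
    have u1 := u z.1 (fun E => ltac:(rewrite E in h1; lra)).
    have u2 := u z.2 (fun E => ltac:(rewrite E in h2; lra)).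
    rewrite /vl in u1 u2; have m1 := Rmult_lt_compat_l (h t - h z.2) _ _ ltac:(lra) u1.
    have m2 := Rmult_lt_compat_l (h z.1 - h t) _ _ ltac:(lra) u2.
    nra.
  by have := u z.1 h2; rewrite /vl h1; lra.
move=> H; have [b bb] := base_exists.
have [lo [lolt lomax]] : exists lo, h lo < h t /\ forall j, h j < h t ->
    - ((LL c lo - LL c t) / (h t - h lo)) <= - ((LL c j - LL c t) / (h t - h j)).
  by apply: fin_argmin; exists b; rewrite bb.
have [up [uplt upmin]] := fin_argmin (fun j => (LL c t - LL c j) / (h j - h t)) nt.
set l := (LL c lo - LL c t) / (h t - h lo) in lomax.
set r := (LL c t - LL c up) / (h up - h t) in upmin.
have le : l * (h t - h lo) = LL c lo - LL c t by rewrite /l; field; lra.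
have re : r * (h up - h t) = LL c t - LL c up by rewrite /r; field; lra.
have lr : l < r.
  have := H (up, lo) (or_introl (conj uplt lolt)); rewrite /tri_form /=; case: Req_EM_T => e /=; first lra.
  have -> : LL c t - LL c up = r * (h up - h t) by lra.
  have -> : LL c t - LL c lo = - (l * (h t - h lo)) by lra.
  move=> f; apply: Rnot_le_lt => rl.
  have p1 : 0 < (h t - h lo) * (h up - h t) by nra.
  nra.
exists ((l + r) / 2) => j jt; rewrite /vl.
have [jl|[jl|jl]] := Rtotal_order (h j) (h t).
- have e : (LL c j - LL c t) / (h t - h j) * (h t - h j) = LL c j - LL c t by field; lra.
  have := lomax j jl; nra.
- have := H (j, j) (or_intror (conj jl jt)); rewrite /tri_form /=; case: Req_EM_T => e //=; rewrite jl; lra.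
- have e : (LL c t - LL c j) / (h j - h t) * (h j - h t) = LL c t - LL c j by field; lra.
  have := upmin j jl; nra.
Qed.

(** An index of a wall: an ancestor of [t], a pair for [tri_form], and two base vertices whose
    values measure the width of the base. *)
Definition idx : finType := ('I_n * ('I_n * 'I_n) * ('I_n * 'I_n))%type.
Definition idx_ok t (i : idx) := [/\ ab t i.1.1, nontop h i.1.1, tri_ok i.1.1 i.1.2, base h i.2.1 & base h i.2.2].
Definition eta t := INR #|[set a | ab t a]|.
(* The cone of t cut down by eps * eta t times the width of the base; the factor eta, the
   number of ancestors, makes the cut cones strictly nested. *)
Definition form e t (i : idx) c := tri_form i.1.1 i.1.2 c - e * eta t * (LL c i.2.1 - LL c i.2.2).
Definition inside e t c := forall i, idx_ok t i -> 0 < form e t i c.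
Definition rim e t c := [/\ c <> zero3, forall i, idx_ok t i -> 0 <= form e t i c &
  exists i, idx_ok t i /\ form e t i c = 0].

Lemma form_mix e t i a b c c' : form e t i (mixw a b c c') = a * form e t i c + b * form e t i c'.
Proof. rewrite /form tri_form_mix /mixw !LD !LZ; ring. Qed.

Lemma above_trans a b c : ab a b -> ab b c -> ab a c. Proof. exact: connect_trans. Qed.

Lemma inner_above t a : inner t -> ab t a -> 0 < h a.
Proof. by case=> t0 _ /(above_height SH)[<-|]; lra. Qed.

Lemma nonzero_spread c : c <> zero3 -> exists v w, [/\ base h v, base h w & LL c w < LL c v].
Proof.
move=> c0; apply: NNPP => n0; apply: c0; apply: (sh_span SH) => i j bi bj.
apply: NNPP => ne; apply: n0.
by have [lt|lt] := Rtotal_order (LL c i) (LL c j); [exists j, i|case: lt => lt //; exists i, j].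
Qed.

Lemma eta_pos t : 0 < eta t.
Proof. by apply: lt_0_INR; apply/ltP; apply/card_gt0P; exists t; rewrite inE; apply: connect0. Qed.

Lemma eta_lt t t' : ab t t' -> t <> t' -> eta t' < eta t.
Proof.
move=> tt ne; apply: lt_INR; apply/ltP; apply: proper_card; apply/properP; split.
  by apply/subsetP=> a; rewrite !inE; apply: above_trans.
exists t; rewrite inE; first exact: connect0.
apply/negP => tt'; case: (above_height SH tt) => // l1; case: (above_height SH tt') => [e|l2]; [exact: ne|lra].
Qed.

(** A nonzero functional is not constant on the base, so for a suitable pair of base vertices the
    amount cut off is positive: the closed cut cone, without the origin, lies in the open cone. *)
Lemma closed_tri e t c : 0 < e -> c <> zero3 -> (forall i, idx_ok t i -> 0 <= form e t i c) ->
  forall a z, ab t a -> nontop h a -> tri_ok a z -> 0 < tri_form a z c.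
Proof.
move=> e0 c0 H a z ta na az; have [v [w [bv bw lt]]] := nonzero_spread c0.
have := H (a, z, (v, w)) (And5 ta na az bv bw); rewrite /form /=.
have := eta_pos t; have : 0 < LL c v - LL c w by lra.
move=> p q; have := Rmult_lt_0_compat _ _ (Rmult_lt_0_compat _ _ e0 q) p; lra.
Qed.

Lemma rim_visible e t c : 0 < e -> inner t -> rim e t c -> vis c t.
Proof.
move=> e0 it [c0 H _]; apply/(visible_tri c it) => z tz; have [_ nt] := it.
exact: closed_tri e0 c0 H t z (connect0 _ _) nt tz.
Qed.

Lemma inside_visible e t c : inner t -> inside e t c -> vis c t.
Proof.
move=> it H; apply/(visible_tri c it) => z tz; have [_ nt] := it; have [b bb] := base_exists.
by have := H (t, z, (b, b)) (And5 (connect0 _ _) nt tz bb bb); rewrite /form /=; lra.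
Qed.

Lemma visible_inside t c : inner t -> vis c t -> exists2 d, 0 < d & forall e, 0 < e <= d -> inside e t c.
Proof.
move=> it vc.
have [||d d0 D] := @fin_small idx (fun i d => forall e, 0 < e <= d -> idx_ok t i -> 0 < form e t i c).
- by move=> i d d' dd D e e0; apply: D; lra.
- move=> i; have [ok|nok] := classic (idx_ok t i); last by exists 1; [lra|].
  have [ta na az _ _] := ok.
  have g0 : 0 < tri_form i.1.1 i.1.2 c.
    have ia : inner i.1.1 by split=> //; apply: inner_above ta.
    by apply: (proj1 (visible_tri c ia)) az; apply: (visible_above SH) vc ta.
  have eta0 := eta_pos t; set k := eta t * (Rabs (LL c i.2.1 - LL c i.2.2) + 1).
  have k0 : 0 < k by apply: Rmult_lt_0_compat => //; have := Rabs_pos (LL c i.2.1 - LL c i.2.2); lra.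
  exists (tri_form i.1.1 i.1.2 c / (2 * k)); first by apply: Rdiv_lt_0_compat; lra.
  move=> e [e0 ed] _; have ek : e * (2 * k) <= tri_form i.1.1 i.1.2 c.
    by have := Rmult_le_compat_r (2 * k) _ _ ltac:(lra) ed; rewrite /Rdiv Rmult_assoc Rinv_l; lra.
  rewrite /form; have := Rle_abs (LL c i.2.1 - LL c i.2.2) => la.
  have : e * eta t * (LL c i.2.1 - LL c i.2.2) <= e * k.
    rewrite Rmult_assoc /k; apply: Rmult_le_compat_l; first lra.
    by apply: Rmult_le_compat_l; lra.
  have := Rmult_lt_0_compat _ _ e0 k0; lra.
by exists d => // e e0 i ok; apply: D.
Qed.

Lemma rim_inside_above e t t' c : 0 < e -> rim e t c -> ab t t' -> t <> t' -> inside e t' c.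
Proof.
move=> e0 [c0 H _] tt ne i [ta na az bv bw].
have ok : idx_ok t i by split=> //; apply: above_trans tt ta.
have pos : 0 < tri_form i.1.1 i.1.2 c by case: ok => a1 a2 a3 _ _; apply: closed_tri e0 c0 H _ _ a1 a2 a3.
have f0 := H i ok; have e2 := eta_lt tt ne; have e1 := eta_pos t'; rewrite /form in f0 *.
set d := LL c i.2.1 - LL c i.2.2 in f0 *.
have [d0|d0] := Rle_lt_dec d 0.
  have : 0 <= e * eta t' * - d by apply: Rmult_le_pos; [apply: Rmult_le_pos; lra|lra].
  lra.
have : e * d * eta t' < e * d * eta t by apply: Rmult_lt_compat_l => //; apply: Rmult_lt_0_compat.
lra.
Qed.

Lemma inside_not_rim e t c : inside e t c -> rim e t c -> False.
Proof. by move=> H [_ _ [i [ok E]]]; have := H i ok; lra. Qed.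

(** Both vertices are visible from [c], hence comparable, and the rim of the lower one lies strictly
    inside the cut cone of the higher one. *)
Lemma rim_unique e t t' c : 0 < e -> inner t -> inner t' -> rim e t c -> rim e t' c -> t = t'.
Proof.
move=> e0 it it' r r'; apply: NNPP => ne.
case: (visible_comparable SH (rim_visible e0 it r) (rim_visible e0 it' r')) => a.
  exact: inside_not_rim (rim_inside_above e0 r a ne) r'.
by apply: inside_not_rim (rim_inside_above e0 r' a _) r => E; apply: ne.
Qed.

Lemma inside_mix e t a b c c' : 0 < a -> 0 <= b -> inside e t c -> (forall i, idx_ok t i -> 0 <= form e t i c') ->
  inside e t (mixw a b c c').
Proof. by move=> a0 b0 H H' i ok; rewrite form_mix; have := H i ok; have := H' i ok; nra. Qed.

Lemma form_scl e t i k c : form e t i (scl3 k c) = k * form e t i c.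
Proof.
have -> : scl3 k c = mixw k 0 c c by rewrite /mixw add3_scl0.
rewrite form_mix; ring.
Qed.

Lemma rim_scl e t k c : 0 < k -> rim e t (scl3 k c) -> rim e t c.
Proof.
move=> k0 [c0 H [i [ok E]]]; split.
- by move=> E'; apply: c0; rewrite E' /scl3 /zero3 /=; congr (_, _, _); ring.
- by move=> j /H; rewrite form_scl => f; apply: Rnot_lt_le => lt; nra.
- by exists i; split=> //; move: E; rewrite form_scl; case/Rmult_integral; lra.
Qed.

Definition eye t := epsilon (inhabits zero3) (fun w => vis w t).
Lemma eyeP t : vis (eye t) t.
Proof.
by apply: (epsilon_spec (inhabits zero3) (fun w => vis w t)); have [w [s u]] := sh_strict SH t; exists w, s.
Qed.

Definition edge u v := exists w, base_edge x h w u v.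
(** The comparison of indices makes the choice the same for both orientations of the edge. *)
Definition mid (u v : 'I_n) := if (u < v)%N then epsilon (inhabits zero3) (fun w => base_edge x h w u v)
  else epsilon (inhabits zero3) (fun w => base_edge x h w v u).

Lemma edge_sym u v : edge u v -> edge v u.
Proof. by case=> w /base_edge_sym; exists w. Qed.

Lemma midP u v : edge u v -> base_edge x h (mid u v) u v.
Proof.
move=> uv; rewrite /mid; case: ifP => _; first exact: (epsilon_spec (inhabits zero3) (fun w => base_edge x h w u v)).
apply: base_edge_sym; apply: (epsilon_spec (inhabits zero3) (fun w => base_edge x h w v u)); exact: edge_sym.
Qed.

Lemma mid_sym u v : u <> v -> mid u v = mid v u.
Proof. by move=> uv; rewrite /mid; case: ltngtP => // /val_inj. Qed.

(** The broken line from [eye u] over [mid u v] to [eye v], written with hat functions so that one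
    formula serves for continuity. *)
Definition arcv u v s := add3 (add3 (scl3 (Rmax 0 (-2 * s + 1)) (eye u)) (scl3 (1 - Rabs (2 * s + -1)) (mid u v)))
  (scl3 (Rmax 0 (2 * s + -1)) (eye v)).

Lemma arcv_rev u v s : u <> v -> arcv v u s = arcv u v (1 - s).
Proof.
move=> uv; rewrite /arcv (mid_sym uv).
have -> : -2 * (1 - s) + 1 = 2 * s + -1 by ring.
have -> : 2 * (1 - s) + -1 = -2 * s + 1 by ring.
have -> : Rabs (-2 * s + 1) = Rabs (2 * s + -1) by rewrite -Rabs_Ropp; congr Rabs; ring.
by rewrite /add3 /=; congr (_, _, _); ring.
Qed.

Lemma arcv_left u v s : s <= / 2 -> arcv u v s = mixw (1 - 2 * s) (2 * s) (eye u) (mid u v).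
Proof.
move=> s2; rewrite /arcv Rmax_right ?Rabs_left1 ?Rmax_left; try lra.
by rewrite /mixw /add3 /scl3 /=; congr (_, _, _); ring.
Qed.

Lemma arcv_cont u v : cont3 (arcv u v).
Proof.
have c1 t : continuity_pt (fun s => Rmax 0 (-2 * s + 1)) t.
  by apply: continuity_pt_max; [exact: continuity_pt_const|exact: continuity_pt_affine].
have c2 t : continuity_pt (fun s => 1 - Rabs (2 * s + -1)) t.
  apply: continuity_pt_minus; first exact: continuity_pt_const.
  by apply: continuity_pt_abs; apply: continuity_pt_affine.
have c3 t : continuity_pt (fun s => Rmax 0 (2 * s + -1)) t.
  by apply: continuity_pt_max; [exact: continuity_pt_const|exact: continuity_pt_affine].
have lin f a t : continuity_pt f t -> continuity_pt (fun s => f s * a) t.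
  by move=> cf; apply: continuity_pt_mult => //; exact: continuity_pt_const.
by move=> t; split; rewrite /arcv /add3 /scl3 /=;
  (apply: continuity_pt_plus; first apply: continuity_pt_plus; apply: lin).
Qed.

Lemma eye_base_max v : base h v -> base_max x h (eye v) v.
Proof. by move=> bv; apply: (visible_base_max bv (eyeP v)). Qed.

Lemma arcv_base_max u v s : edge u v -> 0 <= s < / 2 -> base_max x h (arcv u v s) u.
Proof.
move=> uv s2; have [ne bu bv E H] := midP uv; have [_ M] := eye_base_max bu.
split=> // j bj ju; rewrite arcv_left; last lra.
have := M j bj ju => m; have : LL (mid u v) j <= LL (mid u v) u.
  by have [->|jv] := classic (j = v); [rewrite E; lra|have := H j bj ju jv; lra].
by move=> m2; rewrite /mixw !LD !LZ; nra.
Qed.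

Lemma arcv_mid u v : arcv u v (/ 2) = mid u v.
Proof.
rewrite arcv_left; last lra.
have -> : 2 * / 2 = 1 by lra.
rewrite /mixw Rminus_diag scl31; case: (mid u v) => [[? ?] ?]; rewrite /add3 /scl3 /=; congr (_, _, _); ring.
Qed.

Lemma arcv0 u v : arcv u v 0 = eye u.
Proof. by rewrite arcv_left; [rewrite /mixw Rmult_0_r Rminus_0_r scl31 add3_scl0|lra]. Qed.

Lemma base_max_scl k c u : 0 < k -> base_max x h (scl3 k c) u -> base_max x h c u.
Proof.
by move=> k0 [bu H]; split=> // j bj ju; have := H j bj ju; rewrite !LZ => lt; apply: (Rmult_lt_reg_l k).
Qed.

Lemma base_max_unique c u v : base_max x h c u -> base_max x h c v -> u = v.
Proof.
by case=> bu H [bv H']; apply: NNPP => ne; have := H v bv (fun e => ne (esym e)); have := H' u bu ne; lra.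
Qed.

Lemma base_max_edge c u v w : base_max x h c u -> base_edge x h c v w -> False.
Proof.
case=> bu H [vw bv bw E H'].
have [uv|uv] := classic (u = v); first by subst; have := H w bw (fun e => vw (esym e)); lra.
have [uw|uw] := classic (u = w); first by subst; have := H v bv vw; lra.
by have := H v bv (fun e => uv (esym e)); have := H' u bu uv uw; lra.
Qed.

Lemma base_edge_scl k c u v : 0 < k -> base_edge x h (scl3 k c) u v -> base_edge x h c u v.
Proof.
move=> k0 [uv bu bv E H]; split=> //.
  by move: E; rewrite !LZ => E; apply: (Rmult_eq_reg_l k) => //; lra.
by move=> j bj ju jv; have := H j bj ju jv; rewrite !LZ => lt; apply: (Rmult_lt_reg_l k).
Qed.

(** Otherwise every functional orthogonal to [x u - x v] would be constant on the base and hence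
    zero, but in dimension three nonzero ones exist. *)
Lemma third_base u v : base h u -> base h v -> exists2 z, base h z & z <> u /\ z <> v.
Proof.
move=> bu bv; apply: NNPP => no.
pose d : vec3 := ((x u).1.1 - (x v).1.1, (x u).1.2 - (x v).1.2, (x u).2 - (x v).2).
have LE c i : LL c i = dot3 c (x i) by [].
have orth c : dot3 c d = 0 -> c = zero3.
  move=> c0; have E : LL c u = LL c v by move: c0; rewrite !LE /d /dot3 /=; lra.
  have all i : base h i -> LL c i = LL c u.
    move=> bi; have [->//|iu] := classic (i = u); have [->//|iv] := classic (i = v).
    by case: no; exists i.
  by apply: (sh_span SH) => i j bi bj; rewrite all // all.
have z1 : (- d.1.2, d.1.1, 0) = zero3 :> vec3 by apply: orth; rewrite /dot3 /=; ring.
have z2 : (- d.2, 0, d.1.1) = zero3 :> vec3 by apply: orth; rewrite /dot3 /=; ring.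
case: z1 => e1 e2; case: z2 => e3 _.
have : (1, 0, 0) = zero3 :> vec3 by apply: orth; rewrite /dot3 /= e2; lra.
by case; lra.
Qed.

Variables (v0 : 'I_n) (e : R).
Definition pole : vec3 := (0, 0, 1).
Hypothesis pole_max : forall j, base h j -> LL pole j <= LL pole v0.
Hypothesis base_v0 : base h v0.
Hypothesis e0 : 0 < e.
(** The cut is so thin that none of the finitely many distinguished functionals loses sight of a
    vertex: where it lies in the cone it lies in the cut cone. *)
Hypothesis e_eye : forall t v, inner t -> vis (eye v) t -> inside e t (eye v).
Hypothesis e_mid : forall t u v, inner t -> vis (mid u v) t -> inside e t (mid u v).
Hypothesis e_pole : forall t, inner t -> vis pole t -> inside e t pole.

Lemma on_poleE c : on_pole c -> c = scl3 c.2 pole.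
Proof. by case: c => [[a b] z] [/= -> [-> _]]; rewrite /scl3 /=; congr (_, _, _); ring. Qed.

Lemma on_pole_max c j : on_pole c -> base h j -> LL c j <= LL c v0.
Proof.
move=> pc bj; rewrite (on_poleE pc) !LZ; apply: Rmult_le_compat_l; last exact: pole_max.
by case: pc => _ [].
Qed.

Lemma base_max_off_pole c u : u <> v0 -> base_max x h c u -> ~ on_pole c.
Proof.
move=> uv [bu H] pc; have := on_pole_max pc bu.
by have := H v0 base_v0 (fun E => uv (esym E)); lra.
Qed.

Lemma base_edge_off_pole c u v : u <> v0 -> v <> v0 -> base_edge x h c u v -> ~ on_pole c.
Proof.
move=> uv vv [_ bu bv E H] pc; have := on_pole_max pc bu.
by have := H v0 base_v0 (fun E => uv (esym E)) (fun E => vv (esym E)); lra.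
Qed.

(** A vertex whose rim passed through the pole would be visible from the pole, and then [e_pole]
    puts the pole strictly inside. *)
Lemma rim_off_pole t c : inner t -> rim e t c -> ~ on_pole c.
Proof.
move=> it r pc; have [c0 _ _] := r; have c2 : 0 < c.2.
  case: (pc) => h1 [h2 h3]; apply: Rnot_le_lt => le; apply: c0.
  by move: h1 h2 h3 le; case: (c) => [[? ?] ?] /= -> -> *; congr (_, _, _); lra.
rewrite (on_poleE pc) in r; have rp := rim_scl c2 r.
exact: inside_not_rim (e_pole it (rim_visible e0 it rp)) rp.
Qed.

Definition live u := [/\ base h u & u <> v0].
Definition live_edge u v := [/\ live u, live v & edge u v].

Lemma live_edge_sym u v : live_edge u v -> live_edge v u.
Proof. by case=> lu lv uv; split=> //; apply: edge_sym. Qed.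

Lemma live_edge_neq u v : live_edge u v -> u <> v.
Proof. by case=> _ _ [w []]. Qed.

Lemma arcv_flip u v s : live_edge u v -> arcv u v s = arcv v u (1 - s).
Proof. by move=> uv; rewrite (arcv_rev (1 - s) (live_edge_neq uv)); congr arcv; ring. Qed.

Lemma arcv_off_pole u v s : live_edge u v -> 0 <= s <= 1 -> ~ on_pole (arcv u v s).
Proof.
move=> uv s01; have [[bu nu] [bv nv] ed] := uv.
have [lt|[->|gt]] := Rtotal_order s (/ 2).
- by apply: base_max_off_pole nu (arcv_base_max ed _); lra.
- by rewrite arcv_mid; apply: base_edge_off_pole nu nv (midP ed).
- by rewrite arcv_flip //; apply: base_max_off_pole nv (arcv_base_max (edge_sym ed) _); lra.
Qed.

Lemma arcv_half u v s : live_edge u v -> 0 <= s <= 1 ->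
  [\/ s < / 2 /\ base_max x h (arcv u v s) u, s = / 2 /\ base_edge x h (arcv u v s) u v
    | / 2 < s /\ base_max x h (arcv u v s) v].
Proof.
move=> uv s01; have [_ _ ed] := uv.
have [lt|[E|gt]] := Rtotal_order s (/ 2).
- by constructor 1; split=> //; apply: arcv_base_max => //; lra.
- by constructor 2; split=> //; rewrite E arcv_mid; apply: midP.
- by constructor 3; split=> //; rewrite arcv_flip //; apply: arcv_base_max; [apply: edge_sym|lra].
Qed.

Lemma LL_arcv u v s i : s <= / 2 -> LL (arcv u v s) i = (1 - 2 * s) * LL (eye u) i + 2 * s * LL (mid u v) i.
Proof. by move=> s2; rewrite arcv_left // /mixw LD !LZ. Qed.

(** Values are compared at [u] with those at [v] and at [v']. On each edge the functional [mid]
    takes equal values at the two ends, so for distinct [v] and [v'] the coefficient [m] would be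
    both nonnegative and negative. For equal ends a third base vertex fixes the parameter. *)
Lemma near_arc_inj u v v' s s' k : live_edge u v -> live_edge u v' -> 0 < k -> 0 < s < / 2 -> 0 <= s' < / 2 ->
  arcv u v s = scl3 k (arcv u v' s') -> v = v' /\ s = s'.
Proof.
move=> uv uv' k0 s2 s2' E.
have [[bu nu] [bv nv] ed] := uv; have [_ [bv' nv'] ed'] := uv'.
have [ne _ _ eE eH] := midP ed; have [ne' _ _ eE' eH'] := midP ed'.
have [_ M] := eye_base_max bu.
have EL i : (1 - 2 * s) * LL (eye u) i + 2 * s * LL (mid u v) i =
    k * ((1 - 2 * s') * LL (eye u) i + 2 * s' * LL (mid u v') i).
  by rewrite -!LL_arcv ?E ?LZ //; lra.
have Mv := M v bv (fun e => ne (esym e)); have Mv' := M v' bv' (fun e => ne' (esym e)).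
have Eu := EL u; have Ev := EL v; have Ev' := EL v'.
have vv : v = v'.
  apply: NNPP => vv; have H1 := eH v' bv' (fun e => ne' (esym e)) (fun e => vv (esym e)).
  have H2 := eH' v bv (fun e => ne (esym e)) vv.
  pose m := (1 - 2 * s) - k * (1 - 2 * s').
  have a1 : m * (LL (eye u) u - LL (eye u) v) = k * (2 * s') * (LL (mid u v') u - LL (mid u v') v) by rewrite /m; nra.
  have a2 : m * (LL (eye u) u - LL (eye u) v') = - (2 * s * (LL (mid u v) u - LL (mid u v) v')) by rewrite /m; nra.
  have p1 : 0 <= k * (2 * s') * (LL (mid u v') u - LL (mid u v') v).
    by apply: Rmult_le_pos; [apply: Rmult_le_pos|]; lra.
  have p2 : 0 < 2 * s * (LL (mid u v) u - LL (mid u v) v') by apply: Rmult_lt_0_compat; lra.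
  have m0 : 0 <= m by apply: Rnot_lt_le => lt; nra.
  nra.
split=> //; subst v'.
have a1 : 1 - 2 * s = k * (1 - 2 * s').
  apply: (Rmult_eq_reg_r (LL (eye u) u - LL (eye u) v)); last lra.
  rewrite -eE in Ev; nra.
have [z bz [zu zv]] := third_base bu bv.
have Hz := eH z bz zu zv; have Ez := EL z.
have a2 : s = k * s'.
  apply: (Rmult_eq_reg_r (2 * (LL (mid u v) u - LL (mid u v) z))); last lra.
  rewrite a1 in Eu Ez; lra.
have k1 : k = 1 by nra.
by rewrite a2 k1; ring.
Qed.

Lemma arcv_ray u v u' v' s s' k : live_edge u v -> live_edge u' v' -> 0 < k -> 0 < s < 1 -> 0 <= s' <= 1 ->
  arcv u v s = scl3 k (arcv u' v' s') -> (u' = u /\ v' = v /\ s' = s) \/ (u' = v /\ v' = u /\ s' = 1 - s).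
Proof.
move=> uv uv' k0 s01 s01' E.
have near a b a' b' r r' : live_edge a b -> live_edge a' b' -> 0 < r < / 2 -> 0 <= r' <= 1 ->
    arcv a b r = scl3 k (arcv a' b' r') -> (a' = a /\ b' = b /\ r' = r) \/ (a' = b /\ b' = a /\ r' = 1 - r).
  move=> e1 e2 r0 r0' Er; have [_ _ ed1] := e1.
  have bm : base_max x h (arcv a' b' r') a.
    by apply: (base_max_scl k0); rewrite -Er; apply: arcv_base_max => //; lra.
  have [_ _ ed2] := e2.
  case: (arcv_half e2 r0') => -[rr bm'].
  - have E' := base_max_unique bm bm'; subst a'; left.
    by have [|-> ->] := near_arc_inj e1 e2 k0 r0 _ Er; first lra.
  - by case: (base_max_edge bm bm').
  - have E' := base_max_unique bm bm'; subst b'; right; rewrite (arcv_flip _ e2) in Er.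
    by have [|-> ->] := near_arc_inj e1 (live_edge_sym e2) k0 r0 _ Er; [lra|split=> //; split=> //; ring].
have [lt|[E2|gt]] := Rtotal_order s (/ 2).
- exact: near uv uv' (conj (proj1 s01) lt) s01' E.
- subst s; rewrite arcv_mid in E; have [_ _ ed] := uv.
  have me : base_edge x h (arcv u' v' s') u v by apply: (base_edge_scl k0); rewrite -E; apply: midP.
  case: (arcv_half uv' s01') => -[rr bm'].
  + by case: (base_max_edge bm' me).
  + have [ne bu bv eE eH] := me; have [ne' bu' bv' eE' eH'] := bm'.
    have mem z : base h z -> LL (arcv u' v' s') z = LL (arcv u' v' s') u -> z = u \/ z = v.
      by move=> bz Ez; apply: NNPP => nz; have := eH z bz (fun q => nz (or_introl q)) (fun q => nz (or_intror q)); lra.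
    have top : LL (arcv u' v' s') u' = LL (arcv u' v' s') u.
      have [->//|uu] := classic (u = u'); have [->//|uv2] := classic (u = v').
      have := eH' u bu uu uv2; have [q|n1] := classic (u' = v); first by move=> _; rewrite [X in LL _ X = _]q.
      by have := eH u' bu' (fun q => uu (esym q)) n1; lra.
    case: (mem u' bu' top) => E1; case: (mem v' bv' ltac:(lra)) => E3; subst; try by case: ne'.
      by left.
    by right; split=> //; split=> //; lra.
  + by case: (base_max_edge bm' me).
- have vu := live_edge_sym uv; rewrite arcv_flip // in E.
  have r : 0 < 1 - s < / 2 by lra.
  case: (near _ _ _ _ _ _ vu uv' r s01' E) => -[-> [-> ->]]; first by right.
  by left; split=> //; split=> //; ring.
Qed.

(** On the half next to [u] the base maximum is [u], so a vertex visible there lies above [u]. If it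
    lay above [v] as well, both ends of this half would be inside the convex cut cone, away from its
    rim. *)
Lemma rim_arc u v t s : live_edge u v -> inner t -> 0 <= s <= 1 -> rim e t (arcv u v s) ->
  (ab u t /\ ~ ab v t /\ 0 < s < / 2) \/ (ab v t /\ ~ ab u t /\ 0 < 1 - s < / 2).
Proof.
move=> uv it s01 r.
have near a b q : live_edge a b -> 0 <= q < / 2 -> rim e t (arcv a b q) -> ab a t /\ ~ ab b t /\ 0 < q < / 2.
  move=> e1 q0 rq; have [[ba _] [bb _] ed] := e1.
  have at' : ab a t.
    apply: (visible_base_above SH ba _ (rim_visible e0 it rq)).
    by apply: (base_max_visible SH); apply: arcv_base_max.
  have ie : inside e t (eye a) by apply: e_eye => //; apply: (visible_above SH) (eyeP a) at'.
  split=> //; split.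
    move=> bt; apply: inside_not_rim rq; rewrite arcv_left; last lra.
    apply: inside_mix => //; [lra|lra|].
    have im : inside e t (mid a b) by apply: e_mid => //; apply: (base_edge_below SH (midP ed) at' bt).
    by move=> i ok; apply: Rlt_le; apply: im.
  split; last lra.
  apply: Rnot_le_lt => q0'; apply: inside_not_rim ie _.
  by rewrite -(arcv0 a b) (_ : 0 = q) //; lra.
have [lt|[E|gt]] := Rtotal_order s (/ 2).
- by left; apply: near => //; lra.
- subst s; rewrite arcv_mid in r; have vt := rim_visible e0 it r; exfalso.
  by apply: inside_not_rim (e_mid it vt) r.
- by right; apply: near; [exact: live_edge_sym|lra|rewrite -arcv_flip].
Qed.

Lemma inside_before u v t s s' : live_edge u v -> inner t -> ab u t -> 0 <= s < s' -> s' <= / 2 ->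
  (forall i, idx_ok t i -> 0 <= form e t i (arcv u v s')) -> inside e t (arcv u v s).
Proof.
move=> uv it ut ss s2 H; have s0' : 0 < s' by lra.
have ie : inside e t (eye u) by apply: e_eye => //; apply: (visible_above SH) (eyeP u) ut.
have -> : arcv u v s = mixw (1 - s / s') (s / s') (eye u) (arcv u v s').
  rewrite !arcv_left; try lra.
  by rewrite /mixw /add3 /scl3 /=; congr (_, _, _); field; lra.
have p : 0 <= s / s' < 1.
  have E : s / s' * s' = s by field; lra.
  by split; nra.
by apply: inside_mix => //; lra.
Qed.

Lemma rim_arc_unique u v t s s' : live_edge u v -> inner t -> ab u t -> 0 <= s <= / 2 -> 0 <= s' <= / 2 ->
  rim e t (arcv u v s) -> rim e t (arcv u v s') -> s = s'.
Proof.
move=> uv it ut s1 s2 r r'; have [_ H _] := r; have [_ H' _] := r'.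
have [lt|[//|gt]] := Rtotal_order s s'; exfalso.
  by apply: inside_not_rim (inside_before uv it ut _ _ H') r; lra.
by apply: inside_not_rim (inside_before uv it ut _ _ H) r'; lra.
Qed.

Lemma rim_arc_exists u v t : live_edge u v -> inner t -> ab u t -> ~ ab v t ->
  exists2 s, 0 < s < / 2 & rim e t (arcv u v s).
Proof.
move=> uv it ut vt; have [[bu nu] [bv nv] ed] := uv.
have ie : inside e t (eye u) by apply: e_eye => //; apply: (visible_above SH) (eyeP u) ut.
have nm : ~ vis (mid u v) t.
  by move=> vm; apply: vt; apply: (base_edge_visible SH (base_edge_sym (midP ed))) vm.
(* The point of the segment from [eye u] to [mid u v] at which wall [i] is reached; the earliest one
   is the exit from the cone. *)
pose lam i := form e t i (eye u) / (form e t i (eye u) - form e t i (mid u v)).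
have [i0 [[ok0 f0] imin]] : exists i, (idx_ok t i /\ form e t i (mid u v) <= 0) /\
    forall j, idx_ok t j /\ form e t j (mid u v) <= 0 -> lam i <= lam j.
  apply: fin_argmin; apply: NNPP => no; apply: nm; apply: (inside_visible it (e := e)) => i ok.
  by apply: Rnot_le_lt => le; apply: no; exists i.
have p0 := ie i0 ok0; have lE : lam i0 * (form e t i0 (eye u) - form e t i0 (mid u v)) = form e t i0 (eye u).
  by rewrite /lam; field; lra.
have l01 : 0 < lam i0 <= 1 by split; nra.
have r : rim e t (arcv u v (lam i0 / 2)).
  have aE : arcv u v (lam i0 / 2) = mixw (1 - lam i0) (lam i0) (eye u) (mid u v).
    rewrite arcv_left; last lra.
    by congr mixw; field.
  split.
  - move=> E; have off : ~ on_pole (arcv u v (lam i0 / 2)) by apply: arcv_off_pole => //; lra.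
    by apply: off; rewrite E /on_pole /zero3 /=; lra.
  - move=> i ok; rewrite aE form_mix; have pi := ie i ok.
    have [ni|pi'] := Rle_lt_dec (form e t i (mid u v)) 0; last nra.
    have liE : lam i * (form e t i (eye u) - form e t i (mid u v)) = form e t i (eye u) by rewrite /lam; field; lra.
    have := imin i (conj ok ni); nra.
  - by exists i0; split=> //; rewrite aE form_mix; lra.
exists (lam i0 / 2) => //.
by case: (rim_arc uv it _ r) => [|[_ [_ //]]|[vt' _]]; [lra|case: vt].
Qed.

Lemma basis_exists c : c <> zero3 -> exists b1 b2 : vec3,
  (forall d, exists a b g, d = add3 (scl3 a c) (add3 (scl3 b b1) (scl3 g b2))) /\
  (forall a b g, add3 (scl3 a c) (add3 (scl3 b b1) (scl3 g b2)) = zero3 -> [/\ a = 0, b = 0 & g = 0]).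
Proof.
case: c => [[c1 c2] c3] c0.
have [E1|n1] := Req_dec c1 0; last first.
  exists (0, 1, 0), (0, 0, 1); split.
    move=> [[d1 d2] d3]; exists (d1 / c1), (d2 - d1 / c1 * c2), (d3 - d1 / c1 * c3).
    by rewrite /add3 /scl3 /=; congr (_, _, _); field.
  move=> a b g; rewrite /add3 /scl3 /zero3 /= => -[h1 h2 h3].
  have a0 : a = 0 by apply: (Rmult_eq_reg_r c1) => //; lra.
  by subst a; split; lra.
have [E2|n2] := Req_dec c2 0; last first.
  exists (1, 0, 0), (0, 0, 1); split.
    move=> [[d1 d2] d3]; exists (d2 / c2), (d1 - d2 / c2 * c1), (d3 - d2 / c2 * c3).
    by rewrite /add3 /scl3 /=; congr (_, _, _); field.
  move=> a b g; rewrite /add3 /scl3 /zero3 /= => -[h1 h2 h3].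
  have a0 : a = 0 by apply: (Rmult_eq_reg_r c2) => //; lra.
  by subst a; split; lra.
have n3 : c3 <> 0 by move=> E3; apply: c0; rewrite E1 E2 E3.
exists (1, 0, 0), (0, 1, 0); split.
  move=> [[d1 d2] d3]; exists (d3 / c3), (d1 - d3 / c3 * c1), (d2 - d3 / c3 * c2).
  by rewrite /add3 /scl3 /=; congr (_, _, _); field.
move=> a b g; rewrite /add3 /scl3 /zero3 /= => -[h1 h2 h3].
have a0 : a = 0 by apply: (Rmult_eq_reg_r c3) => //; lra.
by subst a; split; lra.
Qed.

Definition frame c := epsilon (inhabits (zero3, zero3)) (fun b : vec3 * vec3 =>
  (forall d, exists a b' g, d = add3 (scl3 a c) (add3 (scl3 b' b.1) (scl3 g b.2))) /\
  (forall a b' g, add3 (scl3 a c) (add3 (scl3 b' b.1) (scl3 g b.2)) = zero3 -> [/\ a = 0, b' = 0 & g = 0])).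

Lemma frameP c : c <> zero3 ->
  (forall d, exists a b g, d = add3 (scl3 a c) (add3 (scl3 b (frame c).1) (scl3 g (frame c).2))) /\
  (forall a b g, add3 (scl3 a c) (add3 (scl3 b (frame c).1) (scl3 g (frame c).2)) = zero3 -> [/\ a = 0, b = 0 & g = 0]).
Proof.
move=> c0; rewrite /frame; apply: (epsilon_spec (inhabits (zero3, zero3)) (fun b : vec3 * vec3 =>
  (forall d, exists a b' g, d = add3 (scl3 a c) (add3 (scl3 b' b.1) (scl3 g b.2))) /\
  (forall a b' g, add3 (scl3 a c) (add3 (scl3 b' b.1) (scl3 g b.2)) = zero3 -> [/\ a = 0, b' = 0 & g = 0]))).
by have [b1 [b2 H]] := basis_exists c0; exists (b1, b2).
Qed.

Lemma eye_nonzero t : inner t -> eye t <> zero3.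
Proof.
move=> it E; have ie := e_eye it (eyeP t); have [_ [z tz]] := it; have [b bb] := base_exists.
have t0 := proj1 it; have ok : idx_ok t (t, (z, b), (b, b)).
  by split=> //=; [exact: connect0|by exists z|left; rewrite bb].
have := ie _ ok; rewrite E (_ : zero3 = scl3 0 zero3) ?form_scl; first lra.
by rewrite /scl3 /zero3 /=; congr (_, _, _); ring.
Qed.

Lemma idx_exists t : inner t -> exists i, idx_ok t i.
Proof.
move=> [t0 [z tz]]; have [b bb] := base_exists; exists (t, (z, b), (b, b)).
by split=> //=; [exact: connect0|exists z|left; rewrite bb].
Qed.

(* push t i d is the multiple of eye t that brings d onto the wall i of the cut cone of t. *)
Definition push t (i : idx) d := - form e t i d / form e t i (eye t).
Definition first_idx t := epsilon (inhabits (t, (t, t), (t, t)) : inhabited idx) (idx_ok t).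
(** The largest push stops at the wall reached last, which is the boundary of the cone. The fold
    starts from a valid wall so that only valid ones enter the maximum. *)
Definition radius t d := foldr (fun i a => if pb (idx_ok t i) then Rmax (push t i d) a else a)
  (push t (first_idx t) d) (enum idx).

Lemma radiusP t d : inner t -> (forall i, idx_ok t i -> push t i d <= radius t d) /\
  exists2 i, idx_ok t i & radius t d = push t i d.
Proof.
move=> it; have ok0 : idx_ok t (first_idx t).
  by apply: (epsilon_spec (inhabits (t, (t, t), (t, t)) : inhabited idx) (idx_ok t)); apply: idx_exists.
suff [H1 H2] : (forall i, i \in enum idx -> idx_ok t i -> push t i d <= radius t d) /\
    exists2 i, idx_ok t i & radius t d = push t i d.
  by split=> // i; apply: H1; rewrite mem_enum.
rewrite /radius; elim: (enum idx) => [|j s [IH1 [k ok E]]] /=; first by split=> //; exists (first_idx t).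
case: pbP => okj; last first.
  by split; [move=> i; rewrite inE => /orP[/eqP->//|/IH1]|exists k].
split.
  move=> i; rewrite inE => /orP[/eqP-> _|/IH1 h1 /h1 h2]; first exact: Rmax_l.
  by apply: Rle_trans h2 _; apply: Rmax_r.
by rewrite E /Rmax; case: Rle_dec => _; [exists k|exists j].
Qed.

(** The rim is star-shaped about the ray of [eye t]: each direction in the plane of the frame, swept
    once by the diamond, meets it in exactly one ray. *)
Definition spoke t s := add3 (scl3 (diamond_x s) (frame (eye t)).1) (scl3 (diamond_y s) (frame (eye t)).2).
Definition rimv t s := add3 (scl3 (radius t (spoke t s)) (eye t)) (spoke t s).

Lemma form_add e1 t i c c' : form e1 t i (add3 c c') = form e1 t i c + form e1 t i c'.
Proof.
have -> : add3 c c' = mixw 1 1 c c' by rewrite /mixw !scl31.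
rewrite form_mix; ring.
Qed.

Lemma form_rimv t i s : inner t -> idx_ok t i ->
  form e t i (rimv t s) = form e t i (eye t) * (radius t (spoke t s) - push t i (spoke t s)).
Proof.
move=> it ok; rewrite /rimv form_add form_scl /push; have := e_eye it (eyeP t) ok => p.
by field; lra.
Qed.

Lemma rimv_rim t s : inner t -> 0 <= s < 1 -> rim e t (rimv t s).
Proof.
move=> it s01; have [H [i ok E]] := radiusP (spoke t s) it; split.
- move=> E0; have [_ ind] := frameP (eye_nonzero it).
  by have [_ dx dy] := ind _ _ _ E0; case: (diamond_nonzero s01); rewrite ?dx ?dy.
- move=> j okj; rewrite form_rimv //; have := H j okj; have := e_eye it (eyeP t) okj.
  by move=> p q; apply: Rmult_le_pos; lra.
- by exists i; split=> //; rewrite form_rimv // E Rminus_diag Rmult_0_r.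
Qed.

Lemma rimv_inj t s s' k : inner t -> 0 <= s < 1 -> 0 <= s' < 1 -> 0 < k -> rimv t s = scl3 k (rimv t s') -> s = s'.
Proof.
move=> it s01 s01' k0 E; have [_ ind] := frameP (eye_nonzero it).
have : add3 (scl3 (radius t (spoke t s) - k * radius t (spoke t s')) (eye t))
    (add3 (scl3 (diamond_x s - k * diamond_x s') (frame (eye t)).1)
          (scl3 (diamond_y s - k * diamond_y s') (frame (eye t)).2)) = zero3.
  move: E; rewrite /rimv /spoke /add3 /scl3 /zero3 /= => -[E1 E2 E3].
  by congr (_, _, _); lra.
by case/ind=> _ d1 d2; apply: (diamond_inj s01 s01' k0); lra.
Qed.

Lemma rim_rimv t c : inner t -> rim e t c -> exists s k, [/\ 0 <= s < 1, 0 < k & c = scl3 k (rimv t s)].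
Proof.
move=> it [c0 H [i [ok E]]]; have [gen _] := frameP (eye_nonzero it).
have [a [b [g cE]]] := gen c.
have ie := e_eye it (eyeP t).
have nz : b <> 0 \/ g <> 0.
  apply: NNPP => n0; have [b0 g0] : b = 0 /\ g = 0 by split; apply: NNPP => q; apply: n0; [left|right].
  have cE' : c = scl3 a (eye t).
    by rewrite cE b0 g0 /add3 /scl3 /=; case: (eye t) => [[? ?] ?] /=; congr (_, _, _); ring.
  have a0 : a = 0 by move: E; rewrite cE' form_scl => /Rmult_integral[//|]; have := ie i ok; lra.
  by apply: c0; rewrite cE' a0 /scl3 /zero3 /=; congr (_, _, _); ring.
have [s [k [s01 k0 bE gE]]] := diamond_surj nz.
exists s, k; split=> //.
have cS : c = scl3 k (add3 (scl3 (a / k) (eye t)) (spoke t s)).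
  by rewrite cE bE gE /spoke /add3 /scl3 /=; congr (_, _, _); field; lra.
have fE j : idx_ok t j -> form e t j c = k * (form e t j (eye t) * (a / k - push t j (spoke t s))).
  move=> okj; rewrite cS form_scl form_add form_scl /push; have := ie j okj => p.
  by field; lra.
have [R1 [m okm R2]] := radiusP (spoke t s) it.
rewrite cS /rimv; congr (scl3 _ (add3 (scl3 _ _) _)).
apply: Rle_antisym.
  have := R1 i ok; suff -> : push t i (spoke t s) = a / k by [].
  move: E; rewrite fE // => /Rmult_integral[|/Rmult_integral[|]]; [lra|have := ie i ok; lra|lra].
rewrite R2; have := H m okm; rewrite fE // => p; have q := ie m okm.
apply: Rnot_lt_le => lt.
have : 0 < k * (form e t m (eye t) * (push t m (spoke t s) - a / k)).
  by apply: Rmult_lt_0_compat => //; apply: Rmult_lt_0_compat; lra.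
lra.
Qed.

Lemma rimv_cont t : inner t -> cont3 (rimv t).
Proof.
move=> it.
have lin f a s : continuity_pt f s -> continuity_pt (fun s => f s * a) s.
  by move=> cf; apply: continuity_pt_mult => //; exact: continuity_pt_const.
have cp i s : continuity_pt (fun s => push t i (spoke t s)) s.
  have -> : (fun s => push t i (spoke t s)) = (fun s =>
      diamond_x s * push t i (frame (eye t)).1 + diamond_y s * push t i (frame (eye t)).2).
    by apply: functional_extensionality => r; rewrite /push /spoke form_add !form_scl /Rdiv; ring.
  by apply: continuity_pt_plus; apply: lin; [exact: diamond_x_cont|exact: diamond_y_cont].
have cr s : continuity_pt (fun s => radius t (spoke t s)) s.
  rewrite /radius; elim: (enum idx) => [|i l IH] /=; first exact: cp.
  by case: (pb _) => //; apply: continuity_pt_max.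
move=> s; split; rewrite /rimv /spoke /add3 /scl3 /=;
  (apply: continuity_pt_plus; [exact: lin|apply: continuity_pt_plus; apply: lin; [exact: diamond_x_cont|exact: diamond_y_cont]]).
Qed.

Definition site : finType := {i : 'I_n | pb (nontop h i) && (i != v0)}.
Definition site_leaf (a : site) : bool := pb (base h (val a)).
Definition site_lt (a b : site) : bool := ab (val a) (val b) && (val a != val b).
Definition site_edge (a b : site) : bool := pb (live_edge (val a) (val b)).
Definition site_pos (a : site) : pt := proj (eye (val a)).
Definition site_arc (a b : site) (s : R) : pt := proj (arcv (val a) (val b) s).
Definition site_cur (t : site) (s : R) : pt := proj (rimv (val t) s).
Definition site_cross (a b t : site) : R * R := epsilon (inhabits (0, 0)) (fun q =>
  [/\ 0 < q.1 < / 2, 0 <= q.2 < 1, rim e (val t) (arcv (val a) (val b) q.1)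
    & site_arc a b q.1 = site_cur t q.2]).
Definition site_pp a b t := (site_cross a b t).1.
Definition site_th a b t := (site_cross a b t).2.

Lemma site_nontop (a : site) : nontop h (val a).
Proof. by have /andP[/pbP] := valP a. Qed.

Lemma site_neq (a : site) : val a <> v0.
Proof. by have /andP[_ /eqP] := valP a. Qed.

Lemma site_inner (a : site) : ~~ site_leaf a -> inner (val a).
Proof.
move=> /pbP nb; split; last exact: site_nontop.
by have := sh_ge0 SH (val a); rewrite /base in nb; lra.
Qed.

Lemma site_ltP (a b : site) : site_lt a b -> ab (val a) (val b) /\ h (val a) < h (val b).
Proof. by case/andP=> ha /eqP ne; split=> //; case: (above_height SH ha). Qed.

Lemma site_lt_intro (a b : site) : ab (val a) (val b) -> h (val a) < h (val b) -> site_lt a b.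
Proof. by rewrite /site_lt => -> lt; apply/eqP => q; move: lt; rewrite (q : val a = val b); lra. Qed.

Lemma site_crossP (a b t : site) : cross site_lt site_edge a b t ->
  [/\ live_edge (val a) (val b), inner (val t), ab (val a) (val t) & ~ ab (val b) (val t)].
Proof.
case/and3P=> /pbP E /site_ltP[at' lt] nbt.
have [[ba _] [bb _] _] := E.
have it : inner (val t) by split; [move: lt; rewrite ba|exact: site_nontop].
split=> // bt; case/negP: nbt; rewrite /site_lt bt /=; apply/eqP => q.
by have [] := it; rewrite -(q : val b = val t) bb; lra.
Qed.

Lemma site_arc_cur (a b t : site) s r : live_edge (val a) (val b) -> inner (val t) -> 0 <= s <= 1 -> 0 <= r < 1 ->
  site_arc a b s = site_cur t r -> rim e (val t) (arcv (val a) (val b) s).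
Proof.
move=> E it s01 r01 q; have rr := rimv_rim it r01.
have [k k0 c] := proj_inj (arcv_off_pole E s01) (rim_off_pole it rr) q.
apply: (@rim_scl e (val t) (/ k)); first exact: Rinv_0_lt_compat.
by rewrite c scl3K Rinv_l ?scl31 //; lra.
Qed.

Lemma site_crossing (a b t : site) : cross site_lt site_edge a b t ->
  [/\ 0 < site_pp a b t < / 2, 0 <= site_th a b t < 1, rim e (val t) (arcv (val a) (val b) (site_pp a b t))
    & site_arc a b (site_pp a b t) = site_cur t (site_th a b t)].
Proof.
case/site_crossP=> E it at' bt; rewrite /site_pp /site_th.
apply: (epsilon_spec (inhabits (0, 0)) (fun q : R * R => [/\ 0 < q.1 < / 2, 0 <= q.2 < 1,
  rim e (val t) (arcv (val a) (val b) q.1) & site_arc a b q.1 = site_cur t q.2])).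
have [s s2 r] := rim_arc_exists E it at' bt.
have [r1 [k [r01 k0 c]]] := rim_rimv it r.
exists (s, r1); split=> //=; rewrite /site_arc /site_cur c proj_scl //.
exact: rim_off_pole it (rimv_rim it r01).
Qed.

(** The successor of [y] is itself a site: it is not highest, and being higher than [y] it is not
    the base vertex [v0]. *)
Lemma child_next (y t : site) : child site_lt y t -> val t = nx (val y).
Proof.
case/andP=> /site_ltP[yt lt] /forallP H.
have ny := above_next yt (fun q => ltac:(rewrite q in lt; lra)).
have [lt1 _] := nextP SH (site_nontop y).
case: (above_height SH ny) => [//|lt2].
have nok : pb (nontop h (nx (val y))) && (nx (val y) != v0).
  apply/andP; split; first by apply/pbP; exists (val t).
  by apply/eqP => q; have := sh_ge0 SH (val y); have b0 := base_v0; rewrite /base -q in b0; lra.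
pose z : site := Sub (nx (val y)) nok.
have yz : site_lt y z.
  apply: site_lt_intro; last exact: lt1.
  by apply: connect1 => /=.
case/orP: (implyP (H z) yz) => [/eqP -> //|/site_ltP[_ lt3]].
by case: (Rlt_irrefl _ (Rlt_trans _ _ _ lt2 lt3)).
Qed.

Lemma site_cluster_drawing : cluster_drawing site_leaf site_lt site_edge site_pos site_arc site_cur site_pp site_th.
Proof.
have leq_ab (a y : site) : (a == y) || site_lt a y -> ab (val a) (val y).
  by case/orP=> [/eqP->|/site_ltP[]//]; apply: connect0.
split.
- by move=> a; rewrite /site_lt eqxx andbF.
- move=> b a c /site_ltP[h1 l1] /site_ltP[h2 l2]; apply: site_lt_intro; first exact: above_trans h1 h2.
  exact: Rlt_trans l1 l2.
- move=> a b c /site_ltP[h1 l1] /site_ltP[h2 l2].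
  have [->|ne] := eqVneq b c; first by [].
  have ne' : val b != val c by apply: contra ne => /eqP/val_inj->.
  rewrite /site_lt ne' eq_sym ne' !andbT /=.
  by case: (above_total h1 h2) => ->; rewrite ?orbT.
- move=> a b /pbP ba; apply/negP => /site_ltP[_]; rewrite ba; have := sh_ge0 SH (val b); lra.
- by move=> a b; apply/pbP/pbP; apply: live_edge_sym.
- by move=> a; apply/negbTE/negP => /pbP/live_edge_neq.
- by move=> a b /pbP[[ba _] _ _]; apply/pbP.
- move=> a b /pbP ba /pbP bb q; apply: val_inj.
  have offa := base_max_off_pole (@site_neq a) (eye_base_max ba).
  have offb := base_max_off_pole (@site_neq b) (eye_base_max bb).
  have [k k0 c] := proj_inj offa offb q.
  apply: base_max_unique (eye_base_max ba) _; rewrite c.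
  have [_ H] := eye_base_max bb; split=> // j bj jb; rewrite !LZ.
  by apply: Rmult_lt_compat_l => //; apply: H.
- move=> a b /pbP E; apply: proj_continuous (arcv_cont _ _) _ => s s01.
  exact: arcv_off_pole.
- by move=> a b _; rewrite /site_arc arcv0.
- by move=> a b s /pbP E; rewrite /site_arc arcv_rev //; apply: live_edge_neq.
- move=> a b s s' /pbP E s01 s01' q.
  have [k k0 c] := proj_inj (arcv_off_pole E s01) (arcv_off_pole E s01') q.
  have ne := live_edge_neq E.
  have [[b1|b1]|b1] : (0 < s < 1 \/ 0 < s' < 1) \/ ((s = 0 \/ s = 1) /\ (s' = 0 \/ s' = 1)) by lra.
  + by case: (arcv_ray E E k0 b1 s01' c) => [[_ [_ ->]]|[q1 _]].
  + have k0' := Rinv_0_lt_compat _ k0.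
    have c' : arcv (val a) (val b) s' = scl3 (/ k) (arcv (val a) (val b) s).
      by rewrite c scl3K Rinv_l ?scl31 //; lra.
    by case: (arcv_ray E E k0' b1 s01 c') => [[_ [_ ->]]|[q1 _]].
  + have [[ba _] [bb _] _] := E.
    have v1 : arcv (val a) (val b) 1 = eye (val b).
      by rewrite arcv_flip // (_ : 1 - 1 = 0) ?arcv0 //; ring.
    have no k1 u v : base h u -> base h v -> 0 < k1 -> eye u = scl3 k1 (eye v) -> u = v.
      move=> bu bv k10 q1; apply: (base_max_unique (eye_base_max bu)); rewrite q1.
      have [_ H] := eye_base_max bv; split=> // j bj jb; rewrite !LZ.
      by apply: Rmult_lt_compat_l => //; apply: H.
    case: b1 => -[e1|e1] [e2|e2]; subst s s' => //; rewrite ?arcv0 ?v1 in c.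
      by case: ne; apply: no c.
    by case: ne; apply: esym; apply: no c.
- move=> a b a' b' s s' /pbP E /pbP E' s01 s01' q.
  have i01 : 0 <= s <= 1 by lra.
  have [k k0 c] := proj_inj (arcv_off_pole E i01) (arcv_off_pole E' s01') q.
  by case: (arcv_ray E E' k0 s01 s01' c) => -[/val_inj-> [/val_inj-> _]]; [left|right].
- move=> t /site_inner it; apply: proj_continuous (rimv_cont it) _ => s s01 pc.
  have [s1|s1] : s < 1 \/ s = 1 by lra.
    by apply: rim_off_pole it (rimv_rim it (conj (proj1 s01) s1)) pc.
  have E1 : rimv (val t) 1 = rimv (val t) 0.
    suff : spoke (val t) 1 = spoke (val t) 0 by rewrite /rimv => ->.
    rewrite /spoke.
    have -> : diamond_x 1 = diamond_x 0 by rewrite /diamond_x; unfold_abs.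
    by have -> : diamond_y 1 = diamond_y 0 by rewrite /diamond_y; unfold_abs.
  by rewrite s1 E1 in pc; apply: rim_off_pole it (rimv_rim it _) pc; lra.
- move=> t r r' /site_inner it r01 r01' q.
  have [k k0 c] := proj_inj (rim_off_pole it (rimv_rim it r01)) (rim_off_pole it (rimv_rim it r01')) q.
  exact: rimv_inj it r01 r01' k0 c.
- move=> t t' r r' /site_inner it /site_inner it' ne r01 r01' q; apply: ne; apply: val_inj.
  have rr := rimv_rim it r01; have rr' := rimv_rim it' r01'.
  have [k k0 c] := proj_inj (rim_off_pole it rr) (rim_off_pole it' rr') q.
  by rewrite c in rr; apply: rim_unique e0 it it' (rim_scl k0 rr) rr'.
- move=> a b t s r /pbP E /site_inner it s01 r01 q.
  have rr := site_arc_cur E it s01 r01 q.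
  have cr (a' b' : site) : live_edge (val a') (val b') -> ab (val a') (val t) -> ~ ab (val b') (val t) ->
      cross site_lt site_edge a' b' t.
    move=> E' at' bt; apply/and3P; split; first exact/pbP.
      rewrite /site_lt at' /=; apply/eqP => q'; have [[ba _] _ _] := E'.
      by have [] := it; rewrite -(q' : val a' = val t) ba; lra.
    by apply/negP => /site_ltP[].
  case: (rim_arc E it s01 rr) => -[at' [bt s2]]; [left|right].
    have c := cr a b E at' bt; split=> //; have [p1 _ p3 _] := site_crossing c.
    by apply: rim_arc_unique E it at' _ _ rr p3; lra.
  have E' := live_edge_sym E; have c := cr b a E' at' bt; split=> //; have [p1 _ p3 _] := site_crossing c.
  rewrite arcv_flip // in rr.
  by have := rim_arc_unique E' it at' _ _ rr p3; lra.
- by move=> a b t /site_crossing[p1 p2 _ p4]; split=> //; lra.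
- move=> a b t t' c c' lt.
  have [E it at' bt] := site_crossP c; have [_ it' at2 bt2] := site_crossP c'.
  have [p1 _ p3 _] := site_crossing c; have [p1' _ p3' _] := site_crossing c'.
  have ne : val t <> val t'.
    by move=> q; rewrite -q in p3'; have := rim_arc_unique E it at' _ _ p3 p3'; lra.
  rewrite /site_lt; apply/andP; split; last by apply/eqP => q; apply: ne.
  case: (above_total at' at2) => // tt; exfalso.
  (* If [t'] lay above [t], the later point on the rim of [t] would be inside the cut cone of [t'],
     and by convexity so would the earlier point on the rim of [t']. *)
  have ins := rim_inside_above e0 p3 tt ne.
  apply: inside_not_rim p3'; apply: (inside_before E it' at2 (s' := site_pp a b t)); try lra.
  by move=> i ok; apply: Rlt_le; apply: ins.
- by move=> a b t t' /site_crossing[p1 _ _ _] /site_crossing[p1' _ _ _]; lra.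
- move=> y t a b a' b' ct c h1 c' h1'.
  have [[_ _ [w e1]] it at' bt] := site_crossP c; have [[_ _ [w' e1']] _ at2 bt2] := site_crossP c'.
  have tn := child_next ct; rewrite tn in bt bt2 it.
  have [] := base_edges_sparse SH e1 e1' (site_nontop y) (proj2 it) (leq_ab _ _ h1) (leq_ab _ _ h1') bt bt2.
  by move=> /val_inj-> /val_inj->.
Qed.
End SphereDrawing.

(** * Choice of the cut and separation of the shadow *)

Section ShadowSeparator.
Variables (n : nat) (x : 'I_n -> vec3) (h : 'I_n -> R).
Hypothesis SH : shadow x h.

Lemma inside_uniform : exists2 e, 0 < e &
  [/\ forall t v, inner h t -> visible x h (eye x h v) t -> inside x h e t (eye x h v),
      forall t u v, inner h t -> visible x h (mid x h u v) t -> inside x h e t (mid x h u v)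
    & forall t, inner h t -> visible x h pole t -> inside x h e t pole].
Proof.
have small (T : finType) (c : T -> vec3) : exists2 d, 0 < d &
    forall z : 'I_n * T, forall e, 0 < e <= d -> inner h z.1 -> visible x h (c z.2) z.1 -> inside x h e z.1 (c z.2).
  have [||d d0 D] := @fin_small ('I_n * T)%type (fun z d => forall e, 0 < e <= d -> inner h z.1 ->
      visible x h (c z.2) z.1 -> inside x h e z.1 (c z.2)).
  - by move=> z d d' dd D e e0; apply: D; lra.
  - move=> z; have [it|nit] := classic (inner h z.1); last by exists 1; [lra|].
    have [vz|nvz] := classic (visible x h (c z.2) z.1); last by exists 1; [lra|].
    by have [d d0 D] := visible_inside SH it vz; exists d => // e e0 _ _; apply: D.
  by exists d.
have [d1 p1 H1] := small 'I_n (eye x h).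
have [d2 p2 H2] := small ('I_n * 'I_n)%type (fun z => mid x h z.1 z.2).
have [d3 p3 H3] := small unit (fun _ => pole).
have l1 := Rmin_l d1 (Rmin d2 d3); have l2 := Rmin_r d1 (Rmin d2 d3).
have l3 := Rmin_l d2 d3; have l4 := Rmin_r d2 d3.
exists (Rmin d1 (Rmin d2 d3)); first by apply: Rmin_pos => //; apply: Rmin_pos.
have e0 : 0 < Rmin d1 (Rmin d2 d3) by apply: Rmin_pos => //; apply: Rmin_pos.
split.
- by move=> t v; apply: (H1 (t, v)); lra.
- by move=> t u v; apply: (H2 (t, (u, v))); lra.
- by move=> t; apply: (H3 (t, tt)); lra.
Qed.

(** The height function exposes the highest vertices; three of them would bring a base vertex into
    their face. *)
Lemma card_top : (#|[set i : 'I_n | ~~ pb (nontop h i)]| <= 2)%N.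
Proof.
rewrite leqNgt; apply/negP => /card_gt2P[i [j [k [[]]]]].
rewrite !inE => /pbP ti /pbP tj /pbP tk [/eqP ij /eqP jk /eqP ki].
have top a : ~ nontop h a -> is_max x h zero3 1 a.
  move=> ta b; rewrite /vl /L /dot3 /zero3 /= !Rmult_0_l.
  have : h b <= h a by apply: Rnot_lt_le => lt; apply: ta; exists b.
  lra.
have [p [q [_ bp _ mp _]]] := sh_tree SH ij jk (fun e => ki (esym e)) (top i ti) (top j tj) (top k tk).
have [z z0] := sh_apex SH; have := mp z.
by rewrite /vl /L /dot3 /zero3 /= !Rmult_0_l bp; lra.
Qed.

Lemma shadow_separator (E : rel 'I_n) :
  (forall i j, E i j -> i <> j /\ exists w s, [/\ is_max x h w s i, is_max x h w s j &
     forall k, is_max x h w s k -> k = i \/ k = j]) ->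
  has_separator E 300 (/ 2).
Proof.
move=> HE; apply: has_separator_intro => q nq.
have [v0 [b0 m0]] : exists v0, base h v0 /\ forall j, base h j -> - L x pole v0 <= - L x pole j.
  by apply: fin_argmin; have [v [_ [_ bv _]]] := sh_base SH; exists v.
have pm j : base h j -> L x pole j <= L x pole v0 by move=> /m0; lra.
have [e e0 [He Hm Hp]] := inside_uniform.
have CD := site_cluster_drawing SH pm b0 e0 He Hm Hp.
(* At most two highest vertices and [v0]: the 3 in [has_separator_intro]. *)
pose D := [set i : 'I_n | ~~ pb (nontop h i)] :|: [set v0].
have D3 : (#|D| <= 3)%N.
  by apply: leq_trans (card_setU_le _ _) _; rewrite cards1; have := card_top; lia.
have inD i : i \notin D -> pb (nontop h i) && (i != v0).
  by rewrite /D !inE negb_or negbK.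
have [/forallP allD|/forallPn[i0 i0D]] := boolP [forall i, i \in D].
  exists D; last by move=> v; rewrite allD.
  by apply: leq_trans D3 _; apply: leq_addr.
pose s0 : site h v0 := Sub i0 (inD i0 i0D).
pose gm i : site h v0 := insubd s0 i.
have gmE i : i \notin D -> val (gm i) = i by move=> iD; rewrite /gm insubdK //; exact: (inD i iD).
have [|||S S1 S2] := @cluster_separator _ _ _ _ _ _ _ _ _ CD n E D gm q _ nq.
- by rewrite card_sig; apply: leq_trans (max_card _) _; rewrite card_ord.
- move=> a; apply: (@leq_trans #|[set val a]|); last by rewrite cards1.
  apply: subset_leq_card; apply/subsetP => i; rewrite inE => /andP[iD /eqP <-].
  by rewrite inE gmE.
- have step i j : i \notin D -> j \notin D -> h i < h j -> next x h i = j -> child (site_lt x (h:=h) (v0:=v0)) (gm i) (gm j).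
    move=> iD jD ij nij; apply/andP; split.
      apply: site_lt_intro; rewrite !gmE //.
      by apply: connect1; rewrite /= nij.
    apply/forallP => z; apply/implyP => /(site_ltP SH); rewrite gmE // => -[az lt].
    have := above_next az (fun q => ltac:(rewrite q in lt; lra)); rewrite nij => jz.
    case: (above_height SH jz) => [E1|lt1].
      by apply/orP; left; apply/eqP; apply: val_inj; rewrite gmE.
    by apply/orP; right; apply: site_lt_intro; rewrite gmE.
  move=> i j iD jD /HE[ij [w [s [mi mj H]]]].
  have H' k : is_max x h w s k -> k = j \/ k = i by move=> /H[]; [right|left].
  have [lt|[eq|gt]] := Rtotal_order (h i) (h j).
  + by constructor 3; apply: step => //; apply: (edge_next SH mi mj H lt).
  + constructor 2; have /andP[/pbP ni /eqP iv] := inD i iD; have /andP[/pbP nj /eqP jv] := inD j jD.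
    have be := edge_level SH ij mi mj H eq ni; have [_ bi bj _ _] := be.
    by apply/pbP; rewrite !gmE //; split; [split|split|exists w].
  + by constructor 4; apply: step => //; apply: (edge_next SH mj mi H' gt).
exists S => //; apply: leq_trans S1 _.
by rewrite leq_add2r.
Qed.
End ShadowSeparator.

(** * Vertices and faces of polytopes *)

Lemma dot_add c x y : dot c (vadd x y) = dot c x + dot c y.
Proof. by case: c x y => [[[? ?] ?] ?] [[[? ?] ?] ?] [[[? ?] ?] ?] /=; ring. Qed.

Lemma dot_scale c k x : dot c (vscale k x) = k * dot c x.
Proof. by case: c x => [[[? ?] ?] ?] [[[? ?] ?] ?] /=; ring. Qed.

Lemma dotC x y : dot x y = dot y x.
Proof. by case: x y => [[[? ?] ?] ?] [[[? ?] ?] ?] /=; ring. Qed.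

Lemma dot_zero c : dot c vzero = 0.
Proof. by case: c => [[[? ?] ?] ?] /=; ring. Qed.

Lemma dot_ext x y : (forall c, dot c x = dot c y) -> x = y.
Proof.
case: x y => [[[x1 x2] x3] x4] [[[y1 y2] y3] y4] H.
have := H (1, 0, 0, 0); have := H (0, 1, 0, 0); have := H (0, 0, 1, 0); have := H (0, 0, 0, 1) => /= *.
by congr (_, _, _, _); lra.
Qed.

Lemma dot_sq_eq0 x : dot x x = 0 -> x = vzero.
Proof. by case: x => [[[x1 x2] x3] x4] /= E; congr (_, _, _, _); nra. Qed.

Lemma dot_vsum c k lam q : dot c (vsum k (fun i => vscale (lam i) (q i))) = sumR k (fun i => lam i * dot c (q i)).
Proof. by elim: k => [|k IH] /=; rewrite ?dot_zero // dot_add dot_scale IH. Qed.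

Lemma sumR_scale k lam M : sumR k (fun i => lam i * M) = sumR k lam * M.
Proof. by elim: k => [|k IH] /=; rewrite ?IH; ring. Qed.

Lemma sumR_delta k j g : (j < k)%N -> sumR k (fun i => (if i == j then 1 else 0) * g i) = g j.
Proof.
elim: k => // k IH; rewrite ltnS leq_eqVlt => /orP[/eqP->|jk] /=.
  rewrite eqxx; suff -> : sumR k (fun i => (if i == k then 1 else 0) * g i) = 0 by ring.
  suff z m : (m <= k)%N -> sumR m (fun i => (if i == k then 1 else 0) * g i) = 0 by exact: z.
  by elim: m => //= m IHm mk; rewrite IHm ?ltn_eqF // 1?ltnW //; ring.
by rewrite IH // gtn_eqF //; ring.
Qed.

Lemma sumR_avg_le k lam g M : (forall i, (i < k)%N -> 0 <= lam i) ->
  (forall i, (i < k)%N -> lam i = 0 \/ g i <= M) -> sumR k (fun i => lam i * g i) <= sumR k lam * M.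
Proof.
elim: k => [|k IH] l0 H /=; first lra.
have := IH (fun i ik => l0 i (ltnW ik)) (fun i ik => H i (ltnW ik)).
by case: (H k (ltnSn k)) => [->|gM]; [lra|have := l0 k (ltnSn k); nra].
Qed.

Lemma sumR_avg_tight k lam g M : (forall i, (i < k)%N -> 0 <= lam i) -> (forall i, (i < k)%N -> g i <= M) ->
  sumR k (fun i => lam i * g i) = sumR k lam * M -> forall i, (i < k)%N -> lam i = 0 \/ g i = M.
Proof.
elim: k => // k IH l0 H /= E i.
have l0' : forall i, (i < k)%N -> 0 <= lam i by move=> j jk; apply: l0; apply: ltnW.
have H' : forall i, (i < k)%N -> g i <= M by move=> j jk; apply: H; apply: ltnW.
have le := sumR_avg_le l0' (fun j jk => or_intror (H' j jk)).
have lk := l0 k (ltnSn k); have gk := H k (ltnSn k).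
have p : 0 <= lam k * (M - g k) by apply: Rmult_le_pos; lra.
rewrite ltnS leq_eqVlt => /orP[/eqP->|ik]; last by apply: IH => //; lra.
have : lam k * (M - g k) = 0 by lra.
by case/Rmult_integral=> q; [left|right; lra].
Qed.

Section Vertices.
Variable pts : seq pt4.
Local Notation P := (conv pts).
Local Notation N := (size pts).
Local Notation p := (nth vzero pts).

Lemma conv_pt k : (k < N)%N -> P (p k).
Proof.
move=> kN; exists (fun i => if i == k then 1 else 0); split; first by move=> i _; case: ifP => _; lra.
split.
  by have := sumR_delta (fun _ => 1) kN; rewrite sumR_scale Rmult_1_r.
by apply: dot_ext => c; rewrite dot_vsum sumR_delta.
Qed.

Lemma conv_le c M x : (forall k, (k < N)%N -> dot c (p k) <= M) -> P x -> dot c x <= M.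
Proof.
move=> H [lam [l0 [l1 ->]]]; rewrite dot_vsum -(Rmult_1_l M) -l1.
by apply: sumR_avg_le => // i iN; right; apply: H.
Qed.

Lemma conv_tight_le c M d D x : (forall k, (k < N)%N -> dot c (p k) <= M) -> P x -> dot c x = M ->
  (forall k, (k < N)%N -> dot c (p k) = M -> dot d (p k) <= D) -> dot d x <= D.
Proof.
move=> H [lam [l0 [l1 ->]]]; rewrite !dot_vsum -{1}(Rmult_1_l M) -{1}l1 => E K.
rewrite -(Rmult_1_l D) -l1; apply: sumR_avg_le => // i iN.
by case: (sumR_avg_tight l0 H E iN) => [->|/(K i iN)]; [left|right].
Qed.

Definition top_pt c (k : 'I_N) := forall j : 'I_N, dot c (p j) <= dot c (p k).

Lemma top_pt_exists c : (exists x, P x) -> exists k, top_pt c k.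
Proof.
case=> x Px; have N0 : (0 < N)%N.
  by case: (posnP N) => // N0; case: Px => lam [_ []]; rewrite N0 /=; lra.
have [|k [_ H]] := @fin_argmin 'I_N (fun _ => True) (fun k => - dot c (p k)).
  by exists (Ordinal N0).
by exists k => j; have := H j I; lra.
Qed.

(** Adding a small multiple of [d] breaks ties among the maxima of [c] without creating new ones. *)
Lemma top_pt_refine c d : exists c', forall k, top_pt c' k <->
  top_pt c k /\ forall j, top_pt c j -> dot d (p j) <= dot d (p k).
Proof.
have [||e e0 H] := @fin_small ('I_N * 'I_N)%type (fun z e => top_pt c z.1 -> ~ top_pt c z.2 ->
    e * (dot d (p z.2) - dot d (p z.1)) < dot c (p z.1) - dot c (p z.2)).
- move=> z e e' [e'0 ee] H t1 t2; have := H t1 t2; have := t1 z.2 => l1 l2.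
  by have [le|gt] := Rle_lt_dec (dot d (p z.2) - dot d (p z.1)) 0; nra.
- move=> z; have [t1|n1] := classic (top_pt c z.1); last by exists 1; [lra|].
  have [t2|n2] := classic (top_pt c z.2); first by exists 1; [lra|].
  have lt : 0 < dot c (p z.1) - dot c (p z.2).
    by apply: Rnot_le_lt => le; apply: n2 => j; have := t1 j; lra.
  set u := dot c (p z.1) - dot c (p z.2) in lt *; set v := dot d (p z.2) - dot d (p z.1).
  have v0 := Rabs_pos v; exists (u / (Rabs v + 1)); first by apply: Rdiv_lt_0_compat; lra.
  move=> _ _; apply: (Rmult_lt_reg_r (Rabs v + 1)); first lra.
  have -> : u / (Rabs v + 1) * v * (Rabs v + 1) = u * v by field; lra.
  by have := Rle_abs v => va; apply: Rmult_lt_compat_l; lra.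
exists (vadd c (vscale e d)) => k.
have val j : dot (vadd c (vscale e d)) (p j) = dot c (p j) + e * dot d (p j).
  by rewrite dotC dot_add dot_scale !(dotC (p j)).
split=> [tk|[tk dk] j]; last first.
  rewrite !val; have [tj|nj] := classic (top_pt c j).
    by have := tk j; have := dk j tj; nra.
  by have := H (k, j) tk nj => /=; lra.
have tck : top_pt c k.
  apply: NNPP => nk; have [k0 t0] : exists k, top_pt c k.
    by apply: top_pt_exists; exists (p k); apply: conv_pt.
  by have := tk k0; have := H (k0, k) t0 nk; rewrite !val /=; lra.
split=> // j tj; have := tk j; rewrite !val; have := tj k; have := tck j => l1 l2 l3.
by apply: (Rmult_le_reg_l e) => //; lra.
Qed.

(** Ties are broken by [d] and by the four coordinates in turn; all remaining generators then
    coincide, and their common value is a vertex. *)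
Lemma vertex_argmax c d : (exists x, P x) -> exists v, [/\ is_face P (fun x => x = v), P v,
  forall x, P x -> dot c x <= dot c v & forall x, P x -> dot c x = dot c v -> dot d x <= dot d v].
Proof.
move=> Px; have [c1 R1] := top_pt_refine c d.
have [c2 R2] := top_pt_refine c1 (1, 0, 0, 0).
have [c3 R3] := top_pt_refine c2 (0, 1, 0, 0).
have [c4 R4] := top_pt_refine c3 (0, 0, 1, 0).
have [c5 R5] := top_pt_refine c4 (0, 0, 0, 1).
have [k t5] := top_pt_exists c5 Px.
have un j : top_pt c5 j -> p j = p k.
  move=> s5; have [t4 m5] := proj1 (R5 k) t5; have [s4 n5] := proj1 (R5 j) s5.
  have [t3 m4] := proj1 (R4 k) t4; have [s3 n4] := proj1 (R4 j) s4.
  have [t2 m3] := proj1 (R3 k) t3; have [s2 n3] := proj1 (R3 j) s3.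
  have [t1 m2] := proj1 (R2 k) t2; have [s1 n2] := proj1 (R2 j) s2.
  move: (m5 j s4) (n5 k t4) (m4 j s3) (n4 k t3) (m3 j s2) (n3 k t2) (m2 j s1) (n2 k t1).
  case: (p j) (p k) => [[[? ?] ?] ?] [[[? ?] ?] ?] /= *.
  by congr (_, _, _, _); lra.
have [t4 _] := proj1 (R5 k) t5; have [t3 _] := proj1 (R4 k) t4.
have [t2 _] := proj1 (R3 k) t3; have [t1 _] := proj1 (R2 k) t2; have [t0 m1] := proj1 (R1 k) t1.
have lift c0 : top_pt c0 k -> forall i, (i < N)%N -> dot c0 (p i) <= dot c0 (p k).
  by move=> t i iN; apply: (t (Ordinal iN)).
have Pk : P (p k) by apply: conv_pt.
exists (p k); split=> //.
- exists c5, (dot c5 (p k)); split; first by move=> x; apply: conv_le; apply: lift.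
  move=> x; split=> [->//|[Hx E]]; apply: dot_ext => e.
  have pk i : (i < N)%N -> dot c5 (p i) = dot c5 (p k) -> p i = p k.
    by move=> iN Ei; apply: (un (Ordinal iN)) => j /=; rewrite Ei; apply: t5.
  have := conv_tight_le (d := e) (D := dot e (p k)) (lift _ t5) Hx E.
  have := conv_tight_le (d := vscale (-1) e) (D := - dot e (p k)) (lift _ t5) Hx E.
  rewrite (dotC _ x) dot_scale (dotC x) => H1 H2; apply: Rle_antisym.
    by apply: H2 => i iN /(pk i iN) ->; lra.
  suff : -1 * dot e x <= - dot e (p k) by lra.
  by apply: H1 => i iN /(pk i iN) ->; rewrite dotC dot_scale dotC; lra.
- by move=> x; apply: conv_le; apply: lift.
- move=> x Hx E; apply: (conv_tight_le (lift _ t0) Hx E) => i iN Ei.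
  by apply: (m1 (Ordinal iN)) => j /=; rewrite Ei; apply: t0.
Qed.
End Vertices.

(* Right multiplication by the quaternion units: for a <> 0 the vectors quat1 a, quat2 a,
   quat3 a form an orthogonal basis of the hyperplane orthogonal to a. *)
Definition quat1 (a : pt4) : pt4 := let '(a1, a2, a3, a4) := a in (- a2, a1, - a4, a3).
Definition quat2 (a : pt4) : pt4 := let '(a1, a2, a3, a4) := a in (- a3, a4, a1, - a2).
Definition quat3 (a : pt4) : pt4 := let '(a1, a2, a3, a4) := a in (- a4, - a3, a2, a1).

Lemma quat_expand a c y : dot a a * dot c y =
  dot c (quat1 a) * dot (quat1 a) y + dot c (quat2 a) * dot (quat2 a) y + dot c (quat3 a) * dot (quat3 a) y
  + dot c a * dot a y.
Proof. by case: a c y => [[[? ?] ?] ?] [[[? ?] ?] ?] [[[? ?] ?] ?] /=; ring. Qed.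

(** The functional with base direction [w] and tilt [s]; the sign of [s] reflects that height above
    the base is [b - dot a y]. *)
Definition comb4 a (w : vec3) s :=
  vadd (vadd (vscale w.1.1 (quat1 a)) (vscale w.1.2 (quat2 a))) (vadd (vscale w.2 (quat3 a)) (vscale (- s) a)).

Lemma dot_comb4 a w s y : dot (comb4 a w s) y =
  w.1.1 * dot (quat1 a) y + w.1.2 * dot (quat2 a) y + w.2 * dot (quat3 a) y - s * dot a y.
Proof. by rewrite dotC !dot_add !dot_scale !(dotC y); ring. Qed.

Lemma common_orthogonal (u v : vec3) : exists2 d, d <> zero3 & dot3 u d = 0 /\ dot3 v d = 0.
Proof.
have one (r : vec3) : exists2 d, d <> zero3 & dot3 r d = 0.
  case: r => [[r1 r2] r3]; have [z1|n1] := Req_dec r1 0.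
    by exists (1, 0, 0); [case; lra|rewrite /dot3 /= z1; ring].
  by exists (- r2, r1, 0); [case=> _ E; exact: n1|rewrite /dot3 /=; ring].
have [u0|u0] := classic (u = zero3).
  by have [d d0 vd] := one v; exists d => //; split=> //; rewrite u0 /dot3 /=; ring.
pose w : vec3 := (u.1.2 * v.2 - u.2 * v.1.2, u.2 * v.1.1 - u.1.1 * v.2, u.1.1 * v.1.2 - u.1.2 * v.1.1).
have [w0|w0] := classic (w = zero3); last first.
  by exists w => //; rewrite /w /dot3 /=; split; ring.
have [d d0 ud] := one u; exists d => //; split=> //.
have nu : dot3 u u <> 0.
  by move=> E; apply: u0; move: E; case: (u) => [[u1 u2] u3]; rewrite /dot3 /= => E; congr (_, _, _); nra.
apply: (Rmult_eq_reg_l (dot3 u u)) => //; rewrite Rmult_0_r.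
have wz r : dot3 w r = 0 by rewrite w0 /dot3 /=; ring.
(* Lagrange's identity *)
have : dot3 u u * dot3 v d - dot3 u v * dot3 u d = dot3 w (u.1.2 * d.2 - u.2 * d.1.2,
    u.2 * d.1.1 - u.1.1 * d.2, u.1.1 * d.1.2 - u.1.2 * d.1.1).
  by rewrite /w /dot3 /=; ring.
by rewrite ud wz; lra.
Qed.

(** * The shadow of a treetope *)

Section TreetopeShadow.
Variables (pts : seq pt4) (B : pt4 -> Prop) (a : pt4) (b : R) (n : nat) (f : 'I_n -> pt4).
Local Notation P := (conv pts).
Hypothesis valid : forall y, P y -> dot a y <= b.
Hypothesis BE : forall y, B y <-> P y /\ dot a y = b.
Hypothesis P4 : dim_ge P 4.
Hypothesis B3 : dim_eq B 3.
Hypothesis tree : forall F, is_face P F -> (forall y z, F y -> B y -> F z -> B z -> y = z) -> dim_le F 1.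
Hypothesis finj : injective f.
Hypothesis fvert : forall i, is_face P (fun y => y = f i).
Hypothesis fall : forall v, is_face P (fun y => y = v) -> exists i, f i = v.

Lemma P_f i : P (f i).
Proof. by have [c [M [_ H]]] := fvert i; case: (proj1 (H (f i)) erefl). Qed.

Lemma P_nonempty : exists y, P y.
Proof. by have [q [H _]] := P4; exists (q 0%N); apply: H. Qed.

Lemma vertex_strict i : exists c, forall j, j <> i -> dot c (f j) < dot c (f i).
Proof.
have [c [M [H1 H2]]] := fvert i; exists c => j ji; have [_ E] := proj1 (H2 (f i)) erefl.
rewrite E; have := H1 _ (P_f j); case/Rle_lt_or_eq_dec=> // E'; case: ji; apply: finj.
by apply/H2; split=> //; apply: P_f.
Qed.

Lemma index_argmax c d : exists i, (forall y, P y -> dot c y <= dot c (f i)) /\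
  forall y, P y -> dot c y = dot c (f i) -> dot d y <= dot d (f i).
Proof. by have [v [fv _ H1 H2]] := vertex_argmax c d P_nonempty; have [i E] := fall fv; exists i; rewrite E. Qed.

Lemma max_of_vertices c i : (forall j, dot c (f j) <= dot c (f i)) -> forall y, P y -> dot c y <= dot c (f i).
Proof. by move=> H y Py; have [j [H1 _]] := index_argmax c c; have := H1 y Py; have := H j; lra. Qed.

Lemma a_nonzero : dot a a <> 0.
Proof.
move=> E; have a0 := dot_sq_eq0 E.
have az y : dot a y = 0 by rewrite a0 dotC dot_zero.
have [[q [Bq _]] le] := B3; have b0 : b = 0 by have /BE[_ <-] := Bq 0%N (leq0n _); apply: az.
apply: le; have [r [Pr ar]] := P4; exists r; split=> // i i4; apply/BE; split; first exact: Pr.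
by rewrite b0.
Qed.

Definition tx i : vec3 := (dot (quat1 a) (f i), dot (quat2 a) (f i), dot (quat3 a) (f i)).
Definition th i : R := b - dot a (f i).

Lemma vl_comb4 w s i : vl tx th w s i = dot (comb4 a w s) (f i) + s * b.
Proof. by rewrite dot_comb4 /vl /L /dot3 /tx /th /=; ring. Qed.

(** Expansion in the orthogonal basis of [quat_expand]: up to a constant, every functional is a base
    direction with a tilt. *)
Lemma vl_of_functional c : exists w s K, forall i, vl tx th w s i = dot c (f i) + K.
Proof.
have N0 := a_nonzero; set N := dot a a in N0.
exists (dot c (quat1 a) / N, dot c (quat2 a) / N, dot c (quat3 a) / N), (- (dot c a / N)), (- (dot c a / N) * b) => i.
apply: (Rmult_eq_reg_l N) => //; rewrite Rmult_plus_distr_l quat_expand.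
by rewrite /vl /L /dot3 /tx /th /=; field.
Qed.

(** Maximising [c + a] selects the part of the face that lies in [B]; its extreme vertices along
    [z - y] and against it are different. *)
Lemma two_base_vertices c M y z : (forall u, P u -> dot c u <= M) -> y <> z -> B y -> B z -> dot c y = M -> dot c z = M ->
  exists i j, [/\ i <> j, B (f i), B (f j), dot c (f i) = M & dot c (f j) = M].
Proof.
move=> H yz By Bz cy cz; pose d := vadd z (vscale (-1) y).
have dd : 0 < dot d (vadd z (vscale (-1) y)).
  have nn : 0 <= dot d d by case: (d) => [[[? ?] ?] ?] /=; nra.
  case: (Rle_lt_or_eq_dec _ _ nn) => // /esym/dot_sq_eq0 E; case: yz; apply: dot_ext => c0.
  by have := dot_zero c0; rewrite -E /d dot_add dot_scale; lra.
rewrite dot_add dot_scale in dd.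
have ac u : dot (vadd c a) u = dot c u + dot a u by rewrite dotC dot_add !(dotC u).
have neg d0 u : dot (vscale (-1) d0) u = - dot d0 u by rewrite dotC dot_scale (dotC u); ring.
have /BE[Py ay] := By; have /BE[Pz az] := Bz.
have [i [i1 i2]] := index_argmax (vadd c a) d.
have [j [j1 j2]] := index_argmax (vadd c a) (vscale (-1) d).
have on k : (forall u, P u -> dot (vadd c a) u <= dot (vadd c a) (f k)) ->
    [/\ B (f k), dot c (f k) = M & dot (vadd c a) (f k) = M + b].
  move=> /(_ y Py); rewrite !ac; have := H _ (P_f k); have := valid (P_f k) => l1 l2 l3.
  by split; [apply/BE; split; [exact: P_f|lra]|lra|lra].
have [Bi ci Ei] := on i i1; have [Bj cj Ej] := on j j1.
exists i, j; split=> // ij; rewrite Ei in i2; rewrite Ej in j2.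
have := i2 z Pz; rewrite ac => /(_ ltac:(lra)) l1.
have := j2 y Py; rewrite ac !neg => /(_ ltac:(lra)) l2.
rewrite ij in l1; lra.
Qed.

(** A functional strictly maximal at one vertex forces the coefficients of the other two to vanish
    or to have opposite signs. Three numbers with pairwise opposite signs do not exist. *)
Lemma vertices_independent i j k : i <> j -> j <> k -> i <> k ->
  affindep 2 (fun m => f (nth i [:: i; j; k] m)).
Proof.
move=> ij jk ik lam l0 v0.
have E c : lam 0%N * dot c (f i) + lam 1%N * dot c (f j) + lam 2%N * dot c (f k) = 0.
  by have := dot_zero c; rewrite -v0 dot_vsum /=; lra.
rewrite /= in l0.
have [ci Hi] := vertex_strict i; have [cj Hj] := vertex_strict j; have [ck Hk] := vertex_strict k.
have Ei := E ci; have Ej := E cj; have Ek := E ck.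
have i1 := Hi j (fun e => ij (esym e)); have i2 := Hi k (fun e => ik (esym e)).
have j1 := Hj i ij; have j2 := Hj k (fun e => jk (esym e)).
have k1 := Hk i ik; have k2 := Hk j jk.
have opp u v p q : 0 < p -> 0 < q -> u * p + v * q = 0 -> [\/ u = 0 /\ v = 0, u < 0 /\ 0 < v | 0 < u /\ v < 0].
  move=> p0 q0 Eu; have [lt|[eq|gt]] := Rtotal_order u 0.
  - by constructor 2; split=> //; nra.
  - by constructor 1; split=> //; nra.
  - by constructor 3; split=> //; nra.
have oi := @opp (lam 1%N) (lam 2%N) (dot ci (f i) - dot ci (f j)) (dot ci (f i) - dot ci (f k)) ltac:(lra) ltac:(lra) ltac:(nra).
have oj := @opp (lam 0%N) (lam 2%N) (dot cj (f j) - dot cj (f i)) (dot cj (f j) - dot cj (f k)) ltac:(lra) ltac:(lra) ltac:(nra).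
have ok := @opp (lam 0%N) (lam 1%N) (dot ck (f k) - dot ck (f i)) (dot ck (f k) - dot ck (f j)) ltac:(lra) ltac:(lra) ltac:(nra).
have [a0 [a1 a2]] : lam 0%N = 0 /\ lam 1%N = 0 /\ lam 2%N = 0.
  by case: oi => -[? ?]; case: oj => -[? ?]; case: ok => -[? ?]; lra.
by move=> [|[|[|]]].
Qed.

Lemma base_of_B i : B (f i) -> base th i.
Proof. by case/BE=> _ E; rewrite /base /th E; ring. Qed.

Lemma is_max_of_top w s i : (forall j, dot (comb4 a w s) (f j) <= dot (comb4 a w s) (f i)) -> is_max tx th w s i.
Proof. by move=> H j; rewrite !vl_comb4; have := H j; lra. Qed.

(** If the exposed face met [B] in at most one point, the treetope property would bound its
    dimension by one, but three vertices are affinely independent. *)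
Lemma treetope_tree w s i j k : i <> j -> j <> k -> i <> k ->
  is_max tx th w s i -> is_max tx th w s j -> is_max tx th w s k ->
  exists p q, [/\ p <> q, base th p, base th q, is_max tx th w s p & is_max tx th w s q].
Proof.
move=> ij jk ik mi mj mk; set c := comb4 a w s.
have top u v : is_max tx th w s v -> dot c (f u) <= dot c (f v).
  by move=> m; have := m u; rewrite !vl_comb4 -/c; lra.
pose M := dot c (f i); have cM u : P u -> dot c u <= M by apply: max_of_vertices => v; apply: top.
pose F u := P u /\ dot c u = M.
have FF : is_face P F by exists c, M.
have [[y [z [Fy By Fz Bz yz]]]|no] := classic (exists y z, [/\ F y, B y, F z, B z & y <> z]).
  have [p [q [pq Bp Bq cp cq]]] := two_base_vertices cM yz By Bz (proj2 Fy) (proj2 Fz).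
  exists p, q; split=> //; try exact: base_of_B; apply: is_max_of_top => v; rewrite -/c ?cp ?cq; apply: cM; apply: P_f.
case: (tree FF) => [y z Fy By Fz Bz|]; first by apply: NNPP => yz; apply: no; exists y, z.
have on v : is_max tx th w s v -> F (f v).
  by move=> m; split; [exact: P_f|apply: Rle_antisym; [exact: top|apply: top]].
exists (fun m => f (nth i [:: i; j; k] m)); split; last exact: vertices_independent.
by move=> [|[|[|]]] //= _; apply: on.
Qed.

Lemma B_two_points : exists y z, [/\ y <> z, B y & B z].
Proof.
have [[q [Bq aq]] _] := B3; exists (q 0%N), (q 1%N); split; try exact: Bq.
move=> E; pose lam m : R := if m == 0%N then 1 else if m == 1%N then -1 else 0.
have s0 : sumR 4 lam = 0 by rewrite /lam /=; ring.
have v0 : vsum 4 (fun m => vscale (lam m) (q m)) = vzero.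
  by apply: dot_ext => c; rewrite dot_vsum dot_zero /lam /= E; ring.
have := aq lam s0 v0 0%N (leq0n _); rewrite /lam /=; lra.
Qed.

(** A nonzero [w] that is constant on the base vertices is constant on [B]; with the equation of [B]
    this leaves a plane, in which four points are affinely dependent. *)
Lemma base_dim w : (forall i j, base th i -> base th j -> L tx w i = L tx w j) -> w = zero3.
Proof.
move=> cst; apply: NNPP => w0; set c := comb4 a w 0.
have cE y : dot c y = w.1.1 * dot (quat1 a) y + w.1.2 * dot (quat2 a) y + w.2 * dot (quat3 a) y.
  by rewrite dot_comb4; ring.
have [i0 Bi0] : exists i, B (f i).
  have [y [z [yz By Bz]]] := B_two_points; have [i [i1 _]] := index_argmax a a; exists i; apply/BE.
  have /BE[Py ay] := By; have := i1 y Py; have := valid (P_f i).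
  by split; [exact: P_f|lra].
have top c0 : (forall i, B (f i) -> dot c0 (f i) = dot c0 (f i0)) -> forall y, B y -> dot c0 y <= dot c0 (f i0).
  move=> H y /BE[Py ay]; have [i [i1 i2]] := index_argmax a c0.
  have /BE[_ a0] := Bi0; have := i1 _ (P_f i0); have := valid (P_f i) => l1 l2.
  have Ei : dot a (f i) = b by lra.
  by rewrite -(H i); [apply: i2 => //; lra|apply/BE; split=> //; apply: P_f].
have eq i : B (f i) -> dot c (f i) = dot c (f i0).
  by move=> Bi; have := cst i i0 (base_of_B Bi) (base_of_B Bi0); rewrite /L /dot3 /tx /= !cE.
have neg d0 u : dot (vscale (-1) d0) u = - dot d0 u by rewrite dotC dot_scale (dotC u); ring.
have cB y : B y -> dot c y = dot c (f i0).
  move=> By; have := top c eq y By; have := top (vscale (-1) c); rewrite !neg.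
  by move=> /(_ (fun i Bi => ltac:(rewrite neg eq //; lra)) y By); rewrite neg; lra.
have [b1 [b2 [gen _]]] := basis_exists w0.
have [[q [Bq aq]] _] := B3.
(* Coordinates b1 and b2 give two linear conditions on affine dependences of four points of B. *)
pose g (d : vec3) m := d.1.1 * (dot (quat1 a) (q m) - dot (quat1 a) (q 0%N)) +
  d.1.2 * (dot (quat2 a) (q m) - dot (quat2 a) (q 0%N)) + d.2 * (dot (quat3 a) (q m) - dot (quat3 a) (q 0%N)).
have [l l0 [e1 e2]] := common_orthogonal (g b1 1%N, g b1 2%N, g b1 3%N) (g b2 1%N, g b2 2%N, g b2 3%N).
have e3 : dot3 (g w 1%N, g w 2%N, g w 3%N) l = 0.
  have z m : (m <= 3)%N -> g w m = 0.
    by move=> m3; have := cB _ (Bq m m3); have := cB _ (Bq 0%N isT); rewrite !cE /g; lra.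
  by rewrite /dot3 /= !z //; ring.
have all d : dot3 (g d 1%N, g d 2%N, g d 3%N) l = 0.
  have [al [be [ga ->]]] := gen d.
  pose row d0 := dot3 (g d0 1%N, g d0 2%N, g d0 3%N) l.
  transitivity (al * row w + (be * row b1 + ga * row b2)); last by rewrite /row e1 e2 e3; ring.
  by rewrite /row /dot3 /g /add3 /scl3 /=; ring.
pose lam := nth 0 [:: - (l.1.1 + l.1.2 + l.2); l.1.1; l.1.2; l.2].
have lam0 : sumR 4 lam = 0 by rewrite /lam /=; ring.
have dq e : e = quat1 a \/ e = quat2 a \/ e = quat3 a -> dot e (vsum 4 (fun m => vscale (lam m) (q m))) = 0.
  move=> He; rewrite dot_vsum /lam /=.
  have := all (1, 0, 0); have := all (0, 1, 0); have := all (0, 0, 1); rewrite /dot3 /g /= => h3 h2 h1.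
  by case: He => [->|[->|->]]; lra.
have u0 : vsum 4 (fun m => vscale (lam m) (q m)) = vzero.
  set u := vsum _ _; apply: dot_sq_eq0; apply: (Rmult_eq_reg_l (dot a a)); last exact: a_nonzero.
  rewrite quat_expand (dq (quat1 a)) ?(dq (quat2 a)) ?(dq (quat3 a)); auto.
  have -> : dot a u = 0; last by ring.
  rewrite /u dot_vsum -[RHS](Rmult_0_l b) -lam0 -sumR_scale /=.
  have aE m : (m <= 3)%N -> dot a (q m) = b by move=> m3; have /BE[] := Bq m m3.
  by rewrite !aE.
have H := aq lam lam0 u0; apply: l0.
have := H 1%N isT; have := H 2%N isT; have := H 3%N isT; rewrite /lam.
by case: (l) => [[? ?] ?] /= -> -> ->.
Qed.

Lemma treetope_shadow : shadow tx th.
Proof.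
split.
- by move=> i; rewrite /th; have := valid (P_f i); lra.
- move=> i; have [c Hc] := vertex_strict i; have [w [s [K E]]] := vl_of_functional c.
  by exists w, s => j ji; rewrite !E; have := Hc j ji; lra.
- exact: treetope_tree.
- exact: base_dim.
- have [y [z [yz By Bz]]] := B_two_points; have /BE[_ ay] := By; have /BE[_ az] := Bz.
  have [i [j [ij Bi Bj _ _]]] := two_base_vertices valid yz By Bz ay az.
  by exists i, j; split=> //; apply: base_of_B.
- apply: NNPP => no; have [_ le] := B3; apply: le; have [r [Pr ar]] := P4; exists r; split=> // m m4.
  apply/BE; split; first exact: Pr.
  have [i [i1 _]] := index_argmax (vscale (-1) a) a.
  have neg u : dot (vscale (-1) a) u = - dot a u by rewrite dotC dot_scale (dotC u); ring.
  have := i1 _ (Pr m m4); rewrite !neg; have := valid (Pr m m4).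
  have : ~ 0 < th i by move=> z; apply: no; exists i.
  by rewrite /th; lra.
Qed.

Lemma edge_two_maxima i j : i <> j -> is_face P (segment (f i) (f j)) ->
  exists w s, [/\ is_max tx th w s i, is_max tx th w s j & forall k, is_max tx th w s k -> k = i \/ k = j].
Proof.
move=> ij [c [M [H1 H2]]]; have [w [s [K E]]] := vl_of_functional c; exists w, s.
have ext u v : vadd (vscale (1 - 0) u) (vscale 0 v) = u by apply: dot_ext => c0; rewrite dot_add !dot_scale; ring.
have ext' u v : vadd (vscale (1 - 1) u) (vscale 1 v) = v by apply: dot_ext => c0; rewrite dot_add !dot_scale; ring.
have [_ ci] := proj1 (H2 (f i)) (ex_intro _ 0 (conj (conj (Rle_refl _) Rle_0_1) (esym (ext _ _)))).
have [_ cj] := proj1 (H2 (f j)) (ex_intro _ 1 (conj (conj Rle_0_1 (Rle_refl _)) (esym (ext' _ _)))).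
split; try by move=> k; rewrite !E; have := H1 _ (P_f k); lra.
move=> k /(_ i); rewrite !E => le; have [t [t01 fk]] : segment (f i) (f j) (f k).
  by apply/H2; split; [exact: P_f|have := H1 _ (P_f k); lra].
apply: NNPP => nk; have [d Hd] := vertex_strict k.
have li := Hd i (fun e => nk (or_introl (esym e))); have lj := Hd j (fun e => nk (or_intror (esym e))).
rewrite fk dot_add !dot_scale in li; rewrite fk dot_add !dot_scale in lj.
have [le1|lt1] := Rle_lt_dec (dot d (f i)) (dot d (f j)); nra.
Qed.
End TreetopeShadow.

Lemma treetope_separator n (E : rel 'I_n) : is_4treetope_graph E -> has_separator E 300 (/ 2).
Proof.
case=> pts [B [[[P4 _] [[a [b [valid BE]]] [B3 tree]]] [f [finj [fvert [fall fE]]]]]].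
apply: (shadow_separator (treetope_shadow valid BE P4 B3 tree finj fvert fall)) => i j /fE[/eqP ij seg].
by split=> //; exact: (edge_two_maxima BE P4 B3 finj fvert ij seg).
Qed.

Theorem mainTheorem17 :
  exists c alpha : R, (0 < c)%Re /\ (alpha < 1)%Re /\
    (forall (n : nat) (E : rel 'I_n),
        simple_graph E -> subgraph_of_sparse_cluster_graph E ->
        has_separator E c alpha) /\
    (forall (n : nat) (E : rel 'I_n),
        is_4treetope_graph E -> has_separator E c alpha).
Proof.
exists 300, (/ 2); split; first lra; split; first lra; split=> n E; last exact: treetope_separator.
by move=> _; apply: sparse_cluster_separator.
Qed.
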